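(* Let $\varepsilon$ and $\alpha$ be positive real numbers and let $f\neq 0$ be a function of the class $\mathcal{H}(\alpha,-\alpha;\varepsilon)$ such that $$\inf\{|f(x-\alpha \mathrm{i})| : x\in\mathbb{R}\}>0 .$$ Then there exist functions $w_1\in\mathcal{H}(2\alpha,0;\varepsilon)$ and $w_2\in\mathcal{H}(2\alpha,-2\alpha;\varepsilon)$ such that $|w_1(x)|=|w_2(x)|=1$ a.e. on $\mathbb{R}$ and $$w_1(x)=f(x-\alpha \mathrm{i})\,w_2(x-2\alpha \mathrm{i}),\qquad w_2(x)=\bar f(x-\alpha \mathrm{i})\,w_1(x-2\alpha \mathrm{i})$$ a.e. on $\mathbb{R}$, where $w_1(x-2\alpha\mathrm{i}):=1/\overline{w_1(x+2\alpha\mathrm{i})}$. If $\tilde w_1$ and $\tilde w_2$ are two other functions with these properties, then there is a constant $c$ of modulus one such that $\tilde w_1(x)=c\,w_1(x)$ and $\tilde w_2(x)=c\,w_2(x)$ a.e. on $\mathbb{R}$.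
   Context: $\mathrm{i}$ is the imaginary unit. For real $a>b$ and $\varepsilon>0$, $\mathcal{H}(a,b;\varepsilon)$ denotes the set of all holomorphic functions $h$ on the strip $\{z\in\mathbb{C}: a>\operatorname{Im} z>b\}$ such that $$\sup_{a>y>b}\int_{-\infty}^{\infty}|h(x+y\mathrm{i})|^2e^{-2\gamma x^2}\,dx<\infty\quad\text{for all }\gamma>\varepsilon.$$ Each $h\in\mathcal{H}(a,b;\varepsilon)$ admits boundary values: measurable functions $x\mapsto h(x+b\mathrm{i})$ and $x\mapsto h(x+a\mathrm{i})$ on $\mathbb{R}$ (determined a.e.) with $$\lim_{y\downarrow b}\int|h(x+y\mathrm{i})-h(x+b\mathrm{i})|^2e^{-2\gamma x^2}dx=0,\qquad \lim_{y\uparrow a}\int|h(x+y\mathrm{i})-h(x+a\mathrm{i})|^2e^{-2\gamma x^2}dx=0$$ for all $\gamma>\varepsilon$. Functions and their boundary values are denoted by the same symbol. Thus $f(x-\alpha\mathrm{i})$, $w_1(x)$, $w_1(x+2\alpha\mathrm{i})$ and $w_2(x\pm2\alpha\mathrm{i})$ are boundary values, while $w_2(x)$ is the value at an interior point of the strip. The infimum in the hypothesis is an essential infimum. For a function $h$ on a strip, $\bar h(z):=\overline{h(\bar z)}$; in particular $\bar f(x-\alpha\mathrm{i})=\overline{f(x+\alpha\mathrm{i})}$. Convention for $w_1$ below the real axis: a function $w_1\in\mathcal{H}(2\alpha,0;\varepsilon)$ with $|w_1(x)|=1$ a.e. on $\mathbb{R}$ is continued to the strip $-2\alpha<\operatorname{Im}z<0$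 by $w_1(z):=1/\overline{w_1(\bar z)}$ (a meromorphic function), with boundary values $w_1(x-2\alpha\mathrm{i})=1/\overline{w_1(x+2\alpha\mathrm{i})}$; the boundary function $w_1(x+2\alpha\mathrm{i})$ is nonzero a.e. The same convention applies to $\tilde w_1$. *)

(* Defs.v *)
From HB Require Import structures.
From mathcomp Require Import all_boot all_order all_algebra.
From mathcomp Require Import complex.
From mathcomp Require Import all_classical all_reals all_analysis.

Set Implicit Arguments.
Unset Strict Implicit.
Unset Printing Implicit Defensive.

Import Order.TTheory GRing.Theory Num.Theory.
Import numFieldNormedType.Exports.

Local Open Scope classical_set_scope.
Local Open Scope ring_scope.
Local Open Scope complex_scope.

(* [C] is a variable so that the numeric topology of [C] is found by inference;
   for open [A] this is the usual notion, the derivative being the limit of the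
   complex difference quotient. *)
Definition holomorphic_on (C : numClosedFieldType) (A : set C) (h : C -> C) :
  Prop := forall z, A z -> derivable h z 1.

Section Strip.
Context {R : realType}.
Implicit Types (a b y eps gamma : R) (g : R -> R[i]) (h : R[i] -> R[i]).

Definition strip a b : set R[i] :=
  [set z | b < complex.Im z /\ complex.Im z < a].

Definition gauss_norm2 gamma g : \bar R :=
  (\int[@lebesgue_measure R]_x
     (Normc.normc (g x) ^+ 2 * expR (- (2 * gamma * x ^+ 2)))%:E)%E.

Definition on_line h y : R -> R[i] := fun x => h (x +i* y).

(* Functions on the strip are total functions on [R[i]] whose values outside the
   strip are irrelevant. *)
Definition Hclass a b eps h : Prop :=
  holomorphic_on (strip a b) h /\
  forall gamma, eps < gamma ->
    (ereal_sup [set gauss_norm2 gamma (on_line h y) | y in `]b, a[] < +oo)%E.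

Definition cmeasurable g : Prop :=
  measurable_fun [set: R] (fun x => complex.Re (g x)) /\
  measurable_fun [set: R] (fun x => complex.Im (g x)).

Definition is_lower_value eps h b g : Prop :=
  cmeasurable g /\
  forall gamma, eps < gamma ->
    gauss_norm2 gamma (fun x => on_line h y x - g x) @[y --> b^'+] --> 0%E.

Definition is_upper_value eps h a g : Prop :=
  cmeasurable g /\
  forall gamma, eps < gamma ->
    gauss_norm2 gamma (fun x => on_line h y x - g x) @[y --> a^'-] --> 0%E.

(* The boundary values [x |-> h (x + b i)] and [x |-> h (x + a i)]. They are
   determined only up to a null set, so a representative is chosen; the default
   value 0 is never used for [h] in [Hclass a b eps] with [b < a], for which
   boundary values exist. *)
Definition lower_value eps h b : R -> R[i] :=
  xget (fun=> 0) [set g | is_lower_value eps h b g].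

Definition upper_value eps h a : R -> R[i] :=
  xget (fun=> 0) [set g | is_upper_value eps h a g].

Definition bar_fun h : R[i] -> R[i] := fun z => (h z^*)^*.

(* [w1] is continued below the real axis by [w1 z := 1 / (w1 z^* )^*]; this is
   [x |-> w1 (x - a i)] for the continued function. *)
Definition reflected_value eps w1 a : R -> R[i] :=
  fun x => ((upper_value eps w1 a x)^*)^-1.

Definition factorization alpha eps (f w1 w2 : R[i] -> R[i]) : Prop :=
  [/\ Hclass (2 * alpha) 0 eps w1,
      Hclass (2 * alpha) (- (2 * alpha)) eps w2,
      {ae @lebesgue_measure R, forall x : R,
         Normc.normc (lower_value eps w1 0 x) = 1 /\ Normc.normc (w2 x%:C) = 1},
      {ae @lebesgue_measure R, forall x : R,
         lower_value eps w1 0 x =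
         lower_value eps f (- alpha) x *
         lower_value eps w2 (- (2 * alpha)) x} &
      {ae @lebesgue_measure R, forall x : R,
         w2 x%:C =
         lower_value eps (bar_fun f) (- alpha) x *
         reflected_value eps w1 (2 * alpha) x}].

End Strip.

(* Main.v *)
Require Import Defs.
From HB Require Import structures.
From mathcomp Require Import all_boot all_order all_algebra.
From mathcomp Require Import complex.
From mathcomp Require Import all_classical all_reals all_analysis ess_sup_inf.
From mathcomp Require Import measurable_realfun ring lra.

Set Implicit Arguments.
Unset Strict Implicit.
Unset Printing Implicit Defensive.

Import Order.TTheory GRing.Theory Num.Theory.
Import numFieldNormedType.Exports.

Local Open Scope classical_set_scope.
Local Open Scope ring_scope.
Local Open Scope complex_scope.

(* With [l = ln |f (x - alpha i)|], bounded below by hypothesis, let [O_l] be the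
   outer function of the strip [|Im z| < 2 alpha], the exponential of the Poisson
   integral of [l]: its modulus is [1] on the real axis and [exp l] on the line
   [Im z = - 2 alpha], and [O_l (z^* )] has modulus [1 / |O_l z|]. A solution is
   [w2 = O_(-l)], [w1 z = f (z - alpha i) w2 (z - 2 alpha i)]. That [1 / w2] has
   the required growth follows from a maximum principle for the weighted [L^2]
   norms of a product [h O_l], which rests on the midpoint identity
   [||h_y - h_y'||^2 = I y + I y' - 2 I ((y + y') / 2)] (contour shift), where
   [I y] is the squared [L^2] norm of [h] times a Gaussian on the line of height
   [y]; the same identity gives the boundary values. For a second solution [w2'],
   put [p z = w2 z (w2' z^* )^*] and [q z = w2' z / w2 z]: then [|p q| = 1], both
   have modulus [1] on the edges of the strip [- 2 alpha < Im z < 0], and the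
   maximum principle with weight [exp (- 2 gamma x^2)] gives, as [gamma -> 0],
   [\int (|p| - |q|)^2 <= 0]. So [|p| = 1], and [p] is constant. *)

(** * Complex derivatives *)

(** The two equations force [|w2| = 1 / |f (x - alpha i)|] on the lower edge and [|w2| = 1] on the
    axis, hence the exponent [-l]. The lower bound on [f] makes [-l] bounded above, so [w2] is
    bounded for [Im z <= 0]. The obstacle is the upper half, where [|w2|] at [z] equals [|O_l|] at
    the conjugate of [z] and [l] has no upper bound. The class gives integral bounds on lines but no
    pointwise bounds, so growth is measured throughout by [L^2] norms with a Gaussian multiplier; an
    unbounded [l] is first replaced by [min l n], and Fatou's lemma removes the truncation.
    Uniqueness needs the weight with [gamma -> 0], below the threshold [eps] of the class, where
    norms may be infinite a priori. A further factor [exp (- s z^4)] makes them finite for every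
    [gamma >= 0]; then [s -> 0]. The second equation divides by the boundary function of [f] on the
    upper edge, which therefore has to be nonzero a.e. This is where [f <> 0] enters, and outer
    functions prove it too: one that is huge exactly on the zero set of a boundary function would
    not be felt in the edge norms. *)

(** The difference quotient is multiplied out, so that [k = 0] is allowed and increments compose
    without case distinctions. The field is general because the form is used for real functions as
    well as on [R[i]]. *)
Lemma derivable_difference (K : numFieldType) (h : K -> K) (z D : K) :
  (derivable h z 1 /\ 'D_1 h z = D) <-> forall e : K, 0 < e ->
  exists2 d : K, 0 < d & forall k, `|k| < d ->
    `|h (z + k) - h z - D * k| <= e * `|k|.
Proof.
have E (D' k : K) : k != 0 ->
    h (z + k) - h z - D' * k = - (D' - k^-1 * (h (z + k) - h z)) * k.
  by move=> k0; field.
split=> [[hz <-{D}] e e0|hD].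
  have /cvgrPdist_le/(_ e e0)[d /= d0 dP] := hz.
  exists d => // k kd; have [->|k0] := eqVneq k 0.
    by rewrite addr0 subrr mulr0 subrr normr0 mulr0.
  have := dP k; rewrite /ball_/= sub0r normrN => /(_ kd k0).
  rewrite /GRing.scale/= mulr1 [k + z]addrC => H.
  by rewrite E// normrM normrN ler_wpM2r.
suff hzD : k^-1 *: ((h \o shift z) (k *: (1 : K)) - h z) @[k --> 0^'] --> D.
  split; first by apply/cvg_ex; exists D.
  exact/cvg_lim.
apply/cvgrPdist_le => e e0; have [d d0 dP] := hD _ e0.
exists d => //= k; rewrite /ball_/= sub0r normrN => kd k0.
rewrite /GRing.scale/= mulr1 [k + z]addrC.
by have /= := dP k kd; rewrite E// normrM normrN ler_pM2r// normr_gt0.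
Qed.

Lemma derivable_differenceP (C : numClosedFieldType) (h : C -> C) (z : C) :
  derivable h z 1 <-> exists D, forall e : C, 0 < e ->
  exists2 d : C, 0 < d & forall k, `|k| < d ->
    `|h (z + k) - h z - D * k| <= e * `|k|.
Proof.
split=> [hz|[D /derivable_difference[]//]]; exists ('D_1 h z).
exact/derivable_difference.
Qed.

Section ComplexBasics.
Context {R : realType}.
Implicit Types (z w k D : R[i]) (h : R[i] -> R[i]).

Lemma normc_ge0 z : 0 <= Normc.normc z.
Proof. by case: z => a b; exact: sqrtr_ge0. Qed.

Lemma normc_sqrE z : Normc.normc z ^+ 2 = complex.Re z ^+ 2 + complex.Im z ^+ 2.
Proof. by case: z => a b /=; rewrite sqr_sqrtr// addr_ge0 ?sqr_ge0. Qed.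

Lemma normcE z : `|z| = (Normc.normc z)%:C.
Proof. by []. Qed.

Lemma ler_normcD z w :
  Normc.normc (z + w) <= Normc.normc z + Normc.normc w.
Proof. by have := ler_normD z w; rewrite !normcE -rmorphD/= lecR. Qed.

Lemma normcN z : Normc.normc (- z) = Normc.normc z.
Proof. by case: z => a b /=; rewrite !sqrrN. Qed.

Lemma normc_conj z : Normc.normc z^* = Normc.normc z.
Proof. by case: z => a b /=; rewrite sqrrN. Qed.

Lemma normcR (x : R) : Normc.normc x%:C = `|x|.
Proof. by rewrite /= expr0n/= addr0 sqrtr_sqr. Qed.

Lemma ler_Re_normc z : `|complex.Re z| <= Normc.normc z.
Proof.
by rewrite -(@ler_pXn2r _ 2)// ?nnegrE ?normc_ge0// normc_sqrE real_normK ?num_real//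
  lerDl sqr_ge0.
Qed.

Lemma ler_Im_normc z : `|complex.Im z| <= Normc.normc z.
Proof.
by rewrite -(@ler_pXn2r _ 2)// ?nnegrE ?normc_ge0// normc_sqrE real_normK ?num_real//
  lerDr sqr_ge0.
Qed.

Lemma ler_normc_ReIm z :
  Normc.normc z <= `|complex.Re z| + `|complex.Im z|.
Proof.
rewrite -(@ler_pXn2r _ 2)// ?nnegrE ?normc_ge0// ?addr_ge0//.
rewrite normc_sqrE sqrrD !real_normK ?num_real// -addrA lerD2l lerDr.
by rewrite mulrn_wge0// mulr_ge0.
Qed.

Lemma normc_eq0 z : (Normc.normc z == 0) = (z == 0).
Proof.
apply/eqP/eqP => [/Normc.eq0_normc//|->]; exact: Normc.normc0.
Qed.

(** Complex derivative with real tolerances and the real-valued modulus, the form in which all later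
    estimates are made. *)
Definition cderiv h z D := forall e : R, 0 < e ->
  exists2 d : R, 0 < d & forall k, Normc.normc k < d ->
    Normc.normc (h (z + k) - h z - D * k) <= e * Normc.normc k.

Lemma holomorphic_cderivP (A : set R[i]) h :
  holomorphic_on A h <-> forall z, A z -> exists D, cderiv h z D.
Proof.
have pos (e : R[i]) : 0 < e -> exists2 e' : R, e = e'%:C & 0 < e'.
  by case: e => a b; rewrite ltcE/= => /andP[/eqP -> a0]; exists a.
split=> [hA z /hA/derivable_differenceP[D hD]|hA z /hA[D hD]].
  exists D => e e0; have [|d /pos[d' -> d0] dP] := hD e%:C; first by rewrite ltcR.
  exists d' => // k kd; have := dP k; rewrite !normcE ltcR => /(_ kd).
  by rewrite -rmorphM/= lecR.
apply/derivable_differenceP; exists D => e /pos[e' -> /hD[d d0 dP]].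
exists d%:C; first by rewrite ltcR.
by move=> k; rewrite !normcE ltcR -rmorphM/= lecR => /dP.
Qed.

Lemma cderivD h g z D1 D2 : cderiv h z D1 -> cderiv g z D2 ->
  cderiv (fun z => h z + g z) z (D1 + D2).
Proof.
move=> h1 h2 e e0; have e2 : 0 < e / 2 by rewrite divr_gt0.
have [d1 d10 H1] := h1 _ e2; have [d2 d20 H2] := h2 _ e2.
exists (Num.min d1 d2); first by rewrite lt_min d10.
move=> k; rewrite lt_min => /andP[k1 k2].
have -> : h (z + k) + g (z + k) - (h z + g z) - (D1 + D2) * k =
  (h (z + k) - h z - D1 * k) + (g (z + k) - g z - D2 * k) by ring.
rewrite (le_trans (ler_normcD _ _))// [e in leRHS](splitr e) mulrDl.
by rewrite lerD ?H1 ?H2.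
Qed.

Lemma cderiv_cont h z D : cderiv h z D ->
  exists2 d : R, 0 < d & forall k, Normc.normc k < d ->
    Normc.normc (h (z + k) - h z) <= (Normc.normc D + 1) * Normc.normc k.
Proof.
move=> /(_ 1 ltr01)[d d0 H]; exists d => // k /H.
move=> H1; have -> : h (z + k) - h z = (h (z + k) - h z - D * k) + D * k by ring.
by rewrite (le_trans (ler_normcD _ _))// mulrDl Normc.normcM addrC lerD2l.
Qed.

Lemma cderiv_comp h g z D1 D2 : cderiv h z D1 -> cderiv g (h z) D2 ->
  cderiv (fun z => g (h z)) z (D2 * D1).
Proof.
move=> h1 h2 e e0.
have [d0 d00 H0] := cderiv_cont h1.
set M := Normc.normc D1 + 1 in H0.
have M0 : 0 < M by rewrite ltr_wpDl ?normc_ge0.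
set N := Normc.normc D2 + 1.
have N0 : 0 < N by rewrite ltr_wpDl ?normc_ge0.
have e1 : 0 < e / 2 / N by rewrite !divr_gt0.
have e2 : 0 < e / 2 / M by rewrite !divr_gt0.
have [d1 d10 H1] := h1 _ e1; have [d2 d20 H2] := h2 _ e2.
exists (Num.min d0 (Num.min d1 (d2 / M))); first by rewrite !lt_min d00 d10 divr_gt0.
move=> k; rewrite !lt_min => /and3P[k0 k1 k2].
set q := h (z + k) - h z.
have qk : Normc.normc q <= M * Normc.normc k by exact: H0.
have qd : Normc.normc q < d2.
  by rewrite (le_lt_trans qk)// mulrC -ltr_pdivlMr.
have := H2 _ qd; rewrite {1}/q (_ : h z + (h (z + k) - h z) = h (z + k)); last by ring.
move=> H3.
have -> : g (h (z + k)) - g (h z) - D2 * D1 * k =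
  (g (h (z + k)) - g (h z) - D2 * q) + D2 * (q - D1 * k) by ring.
rewrite (le_trans (ler_normcD _ _))// Normc.normcM.
rewrite [e in leRHS](splitr e) mulrDl lerD//.
  rewrite (le_trans H3)// (le_trans (ler_wpM2l (ltW e2) qk))//.
  by rewrite mulrA divfK ?gt_eqF.
have H4 := H1 _ k1.
rewrite -/q in H4.
have D2N : Normc.normc D2 <= N by rewrite /N lerDl.
apply: le_trans (ler_pM _ _ D2N H4) _; rewrite ?normc_ge0//.
by rewrite mulrA [N * _]mulrC divfK ?gt_eqF.
Qed.

Lemma cderiv_quadratic h z D (C d : R) : 0 < d ->
  (forall k, Normc.normc k < d ->
    Normc.normc (h (z + k) - h z - D * k) <= C * Normc.normc k ^+ 2) ->
  cderiv h z D.
Proof.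
move=> d0 H e e0; have C1 : 0 < `|C| + 1 by rewrite ltr_wpDl.
exists (Num.min d (e / (`|C| + 1))); first by rewrite lt_min d0 divr_gt0.
move=> k; rewrite lt_min => /andP[/H kd]; rewrite ltr_pdivlMr// => ke.
apply: le_trans kd _; rewrite expr2 mulrA ler_wpM2r ?normc_ge0//.
apply: le_trans (ltW ke); rewrite mulrC ler_wpM2l ?normc_ge0//.
by rewrite (le_trans (ler_norm _))// lerDl.
Qed.

Lemma cderiv_cst c z : cderiv (fun=> c) z 0.
Proof.
apply: (@cderiv_quadratic _ _ _ 0 1) => // k _.
by rewrite subrr mul0r subrr Normc.normc0 mul0r.
Qed.

Lemma cderiv_id z : cderiv (fun w => w) z 1.
Proof.
apply: (@cderiv_quadratic _ _ _ 0 1) => // k _.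
by rewrite (_ : _ - _ = 0) ?Normc.normc0 ?mul0r//; ring.
Qed.

Lemma cderiv_sqr z : cderiv (fun w => w ^+ 2) z (2%:R * z).
Proof.
apply: (@cderiv_quadratic _ _ _ 1 1) => // k _.
have -> : (z + k) ^+ 2 - z ^+ 2 - 2%:R * z * k = k ^+ 2 by ring.
by rewrite expr2 Normc.normcM mul1r expr2.
Qed.

Lemma cderivZ h z D c : cderiv h z D -> cderiv (fun w => c * h w) z (c * D).
Proof.
move=> hD; apply: (@cderiv_comp h (fun w => c * w)) => //.
apply: (@cderiv_quadratic _ _ _ 0 1) => // k _.
by rewrite (_ : _ - _ = 0) ?Normc.normc0 ?mul0r//; ring.
Qed.

(* Polarization reduces the product to squares. *)
Lemma cderivM h g z D1 D2 : cderiv h z D1 -> cderiv g z D2 ->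
  exists D, cderiv (fun z => h z * g z) z D.
Proof.
move=> h1 h2.
have s1 := cderiv_comp (cderivD h1 h2) (cderiv_sqr _).
have s2 := cderiv_comp (cderivD h1 (cderivZ (-1) h2)) (cderiv_sqr _).
have := cderivZ (4%:R^-1) (cderivD s1 (cderivZ (-1) s2)).
set f := (X in cderiv X); have -> : f = (fun z => h z * g z).
  by apply/funext => w; rewrite /f; field.
by eexists; eauto.
Qed.

Lemma cderiv_bar h z D : cderiv h z^* D -> cderiv (bar_fun h) z D^*.
Proof.
move=> hD e /hD[d d0 dP]; exists d => // k kd.
have := dP k^*; rewrite normc_conj => /(_ kd).
rewrite -[leLHS]normc_conj !(rmorphB,rmorphM,rmorphD)/= /bar_fun.
by rewrite !conjcK rmorphD.
Qed.

Definition cexp z : R[i] :=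
  (expR (complex.Re z) * cos (complex.Im z)) +i* (expR (complex.Re z) * sin (complex.Im z)).

Lemma cexpD z w : cexp (z + w) = cexp z * cexp w.
Proof.
case: z => a b; case: w => c d; apply/eqP; rewrite eq_complex /=.
by rewrite expRD cosD sinD; apply/andP; split; apply/eqP; ring.
Qed.

Lemma normc_cexp z : Normc.normc (cexp z) = expR (complex.Re z).
Proof.
apply/eqP; rewrite -(@eqrXn2 _ 2) ?normc_ge0 ?expR_ge0// normc_sqrE /=.
by rewrite !exprMn -mulrDr cos2Dsin2 mulr1.
Qed.

Lemma cexp_neq0 z : cexp z != 0.
Proof. by rewrite -normc_eq0 normc_cexp gt_eqF ?expR_gt0. Qed.

Lemma cexp0 : cexp 0 = 1.
Proof. by apply/eqP; rewrite eq_complex/= expR0 cos0 sin0 !mul1r !eqxx. Qed.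

Lemma is_derive_difference (f : R -> R) (x df e : R) : is_derive x 1 f df ->
  0 < e -> exists2 d : R, 0 < d & forall k : R, `|k| < d ->
  `|f (x + k) - f x - df * k| <= e * `|k|.
Proof. by move=> [h1 h2]; move: e; apply/derivable_difference. Qed.

Lemma cderiv_cexp0 : cderiv cexp 0 1.
Proof.
(* The real part will cost [3 e1] and the imaginary part [4 e1], together less than [8 e1 <= e]; the
   cap [1/2] serves to bound [expR] of the real part by [2]. *)
move=> e e0; pose e1 := Num.min (e / 8) (1/2).
have e10 : 0 < e1 by rewrite lt_min !divr_gt0.
have e1e : 8 * e1 <= e by rewrite mulrC -ler_pdivlMr// ge_min lexx.
have e1h : e1 <= 1/2 by rewrite ge_min lexx orbT.
clearbody e1.
have [d1 d10 H1] := is_derive_difference (is_derive_expR 0) e10.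
have [d2 d20 H2] := is_derive_difference (is_derive_sin 0) e10.
have [d3 d30 H3] := is_derive_difference (is_derive_cos 0) e10.
exists (Num.min (Num.min d1 e1) (Num.min d2 d3)); first by rewrite !lt_min d10 d20 d30 e10.
move=> k; rewrite !lt_min => /andP[/andP[k1 ke] /andP[k2 k3]].
have ka := ler_Re_normc k; have kb := ler_Im_normc k.
have n0 := normc_ge0 k.
have {}H1 := H1 _ (le_lt_trans ka k1).
have {}H2 := H2 _ (le_lt_trans kb k2).
have {}H3 := H3 _ (le_lt_trans kb k3).
rewrite add0r mul1r cexp0.
have RE : complex.Re (cexp k - 1 - k) =
    expR (complex.Re k) * cos (complex.Im k) - 1 - complex.Re k by case: (k).
have IE : complex.Im (cexp k - 1 - k) =
    expR (complex.Re k) * sin (complex.Im k) - 0 - complex.Im k by case: (k).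
apply: le_trans (ler_normc_ReIm _) _; rewrite RE IE.
move: (complex.Re k) (complex.Im k) (Normc.normc k) ka kb n0 ke H1 H2 H3.
move=> a b n ka kb n0 ke; rewrite !add0r expR0 sin0 cos0 !(mul1r, mul0r, oppr0, addr0).
move=> H1 H2 H3.
have ean : `|a| <= 1/2 by rewrite (le_trans ka)// (le_trans (ltW ke)).
have [H1a H1b] : - (e1 * `|a|) <= expR a - 1 - a /\ expR a - 1 - a <= e1 * `|a|.
  by move: H1; rewrite ler_norml => /andP[].
have ea2 : expR a <= 2.
  have e1a : e1 * `|a| <= 1/2 * (1/2) by rewrite ler_pM// ltW.
  by have := ler_norm a; lra.
have e0a := expR_gt0 a.
have ea1 : `|expR a - 1| <= 2 * n.
  rewrite (_ : expR a - 1 = (expR a - 1 - a) + a); last by ring.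
  rewrite (le_trans (ler_normD _ _))// mulr2n mulrDl mul1r lerD//.
  rewrite (le_trans H1)// -[n]mul1r ler_pM// ?ltW//; lra.
have R1 : `|expR a * cos b - 1 - a| <= 3 * e1 * n.
  rewrite (_ : _ - a = expR a * (cos b - 1) + (expR a - 1 - a)); last by ring.
  rewrite (le_trans (ler_normD _ _))// normrM (ger0_norm (ltW e0a)).
  rewrite (_ : 3 * e1 * n = 2 * (e1 * n) + e1 * n); last by ring.
  rewrite lerD//; last by rewrite (le_trans H1)// ler_wpM2l// ltW.
  by rewrite ler_pM// ?(ltW e0a)// (le_trans H3)// ler_wpM2l// ltW.
have R2 : `|expR a * sin b - b| <= 4 * e1 * n.
  rewrite (_ : _ - b = expR a * (sin b - b) + b * (expR a - 1)); last by ring.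
  rewrite (le_trans (ler_normD _ _))// !normrM (ger0_norm (ltW e0a)).
  rewrite (_ : 4 * e1 * n = 2 * (e1 * n) + n * (2 * e1)); last by ring.
  rewrite lerD//.
    by rewrite ler_pM// ?(ltW e0a)// (le_trans H2)// ler_wpM2l// ltW.
  by rewrite ler_pM// (le_trans ea1)// ler_wpM2l// ltW.
apply: le_trans (lerD R1 R2) _.
rewrite -mulrDl ler_wpM2r//; lra.
Qed.

Lemma cderiv_cexp z : cderiv cexp z (cexp z).
Proof.
move=> e e0; have c0 : 0 < Normc.normc (cexp z) by rewrite normc_cexp expR_gt0.
have [|d d0 dP] := @cderiv_cexp0 (e / Normc.normc (cexp z)); first by rewrite divr_gt0.
exists d => // k /dP; rewrite add0r cexp0 mul1r => H.
rewrite (_ : _ - _ = cexp z * (cexp k - 1 - k)); last by rewrite cexpD; ring.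
rewrite Normc.normcM; apply: le_trans (ler_wpM2l (ltW c0) H) _.
by rewrite mulrA [_ * (e / _)]mulrC divfK ?gt_eqF.
Qed.

End ComplexBasics.

(** * Contour shift in a strip *)

Section Goursat.
Context {R : realType}.
Notation mu := (@lebesgue_measure R).
Implicit Types (F : R[i] -> R[i]).

Lemma continuous_at_le (f : R -> R) (x : R) :
  (forall e : R, 0 < e -> exists2 d : R, 0 < d &
    forall y : R, `|y - x| < d -> `|f y - f x| <= e) ->
  {for x, continuous f}.
Proof.
move=> H; apply/cvgrPdist_le => e /H[d d0 dP].
exists d => //= y; rewrite /ball_/= distrC => /dP; by rewrite distrC.
Qed.

Lemma cderiv_continuous_ReIm F (z D : R[i]) : cderiv F z D ->
  forall e : R, 0 < e -> exists2 d : R, 0 < d & forall w : R[i],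
    Normc.normc (w - z) < d -> Normc.normc (F w - F z) <= e.
Proof.
move=> /cderiv_cont[d d0 H] e e0.
set M := Normc.normc D + 1 in H; have M0 : 0 < M by rewrite ltr_wpDl ?normc_ge0.
exists (Num.min d (e / M)); first by rewrite lt_min d0 divr_gt0.
move=> w; rewrite lt_min => /andP[/H]; rewrite (_ : z + (w - z) = w); last by ring.
move=> H1; rewrite ltr_pdivlMr// => we; rewrite (le_trans H1)// mulrC ltW//.
Qed.

Lemma normc_real (x : R) : Normc.normc (x +i* 0) = `|x|.
Proof. exact: normcR. Qed.

Lemma normc_imag (y : R) : Normc.normc (0 +i* y) = `|y|.
Proof. by rewrite /= expr0n/= add0r sqrtr_sqr. Qed.

Lemma continuous_Re_x F (x y : R) D : cderiv F (x +i* y) D ->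
  {for x, continuous (fun x => complex.Re (F (x +i* y)))}.
Proof.
move=> /cderiv_continuous_ReIm H; apply: continuous_at_le => e /H[d d0 dP].
exists d => // x' xd; have := dP (x' +i* y).
have -> : (x' +i* y) - (x +i* y) = (x' - x) +i* 0.
  by apply/eqP; rewrite eq_complex/= subrr !eqxx.
rewrite normc_real => /(_ xd); apply: le_trans; rewrite -raddfB; exact: ler_Re_normc.
Qed.

Lemma continuous_Im_x F (x y : R) D : cderiv F (x +i* y) D ->
  {for x, continuous (fun x => complex.Im (F (x +i* y)))}.
Proof.
move=> /cderiv_continuous_ReIm H; apply: continuous_at_le => e /H[d d0 dP].
exists d => // x' xd; have := dP (x' +i* y).
have -> : (x' +i* y) - (x +i* y) = (x' - x) +i* 0.
  by apply/eqP; rewrite eq_complex/= subrr !eqxx.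
rewrite normc_real => /(_ xd); apply: le_trans; rewrite -raddfB; exact: ler_Im_normc.
Qed.

Lemma continuous_Im_y F (x y : R) D : cderiv F (x +i* y) D ->
  {for y, continuous (fun y => complex.Im (F (x +i* y)))}.
Proof.
move=> /cderiv_continuous_ReIm H; apply: continuous_at_le => e /H[d d0 dP].
exists d => // y' xd; have := dP (x +i* y').
have -> : (x +i* y') - (x +i* y) = 0 +i* (y' - y).
  by apply/eqP; rewrite eq_complex/= subrr !eqxx.
rewrite normc_imag => /(_ xd); apply: le_trans; rewrite -raddfB; exact: ler_Im_normc.
Qed.

Definition cont_on (p q : R) (g : R -> R) :=
  forall x, p <= x <= q -> {for x, continuous g}.

Lemma cont_on_integrable p q (g : R -> R) : cont_on p q g ->
  mu.-integrable `[p, q] (EFin \o g).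
Proof.
move=> gc; apply: continuous_compact_integrable; first exact: segment_compact.
apply: continuous_in_subspaceT => x; rewrite inE/= in_itv/= => /gc.
by [].
Qed.

Lemma Rintegral_split p m q (g : R -> R) : p <= m <= q -> cont_on p q g ->
  \int[mu]_(x in `[p, q]) g x =
  \int[mu]_(x in `[p, m]) g x + \int[mu]_(x in `[m, q]) g x.
Proof.
move=> /andP[pm mq] gc; have ig := cont_on_integrable gc.
apply/eqP; rewrite eq_sym addrC eq_sym -subr_eq; apply/eqP.
rewrite Rintegral_itvB//= Rintegral_itv_obnd_cbnd//.
apply: integrableS ig => //.
by apply: subset_itvr; rewrite bnd_simp.
Qed.

Lemma Rintegral_near p q (g : R -> R) (c e : R) : p <= q -> cont_on p q g ->
  (forall x, p <= x <= q -> `|g x - c| <= e) ->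
  `|\int[mu]_(x in `[p, q]) g x - c * (q - p)| <= e * (q - p).
Proof.
move=> pq gc H.
have muE : fine (mu `[p, q]) = q - p.
  rewrite lebesgue_measure_itv/= lte_fin; case: ltP => //= qp.
  by apply/eqP; rewrite eq_sym subr_eq0 eq_le pq qp.
rewrite -muE -!(Rintegral_cst mu (measurable_itv `[p, q])).
have ic (k : R) : mu.-integrable `[p, q] (EFin \o cst k).
  by apply: cont_on_integrable => x _; exact: cst_continuous.
have ig := cont_on_integrable gc.
rewrite -RintegralB; [|by []|exact: ig|exact: ic].
have ib : mu.-integrable `[p, q] (EFin \o (fun x => g x - c)).
  apply: cont_on_integrable => x /gc gx.
  by apply: (@continuousB _ _ _ g (cst c)) => //; exact: cst_continuous.
apply: le_trans (le_normr_Rintegral _ ib) _; first by [].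
apply: le_Rintegral; [by []|exact: (integrable_norm ib)|exact: ic|].
by move=> x /=; rewrite in_itv/= => /H.
Qed.

Definition hol_rect F p q r s := forall x y, p <= x <= q -> r <= y <= s ->
  exists D, cderiv F (x +i* y) D.

(** The real part of the counterclockwise contour integral of [F dz] along the boundary of the
    rectangle. *)
Definition bdry F p q r s : R :=
  \int[mu]_(x in `[p, q]) (complex.Re (F (x +i* r)) - complex.Re (F (x +i* s))) +
  \int[mu]_(y in `[r, s]) (complex.Im (F (p +i* y)) - complex.Im (F (q +i* y))).

Lemma cont_onB p q (f g : R -> R) : cont_on p q f -> cont_on p q g ->
  cont_on p q (fun x => f x - g x).
Proof. by move=> fc gc x xpq; apply: continuousB; [exact: fc|exact: gc]. Qed.

Lemma Rintegral_cont_onB p q (f g : R -> R) : cont_on p q f -> cont_on p q g ->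
  \int[mu]_(x in `[p, q]) (f x - g x) =
  \int[mu]_(x in `[p, q]) f x - \int[mu]_(x in `[p, q]) g x.
Proof.
by move=> /cont_on_integrable fi /cont_on_integrable gi; rewrite RintegralB.
Qed.

Lemma hol_rect_hor F p q r s y : hol_rect F p q r s -> r <= y <= s ->
  cont_on p q (fun x => complex.Re (F (x +i* y))).
Proof. by move=> H yrs x xpq; have [D /continuous_Re_x] := H _ _ xpq yrs. Qed.

Lemma hol_rect_ver F p q r s x : hol_rect F p q r s -> p <= x <= q ->
  cont_on r s (fun y => complex.Im (F (x +i* y))).
Proof. by move=> H xpq y yrs; have [D /continuous_Im_y] := H _ _ xpq yrs. Qed.

Lemma bdry_split_hor F p m q r s : hol_rect F p q r s -> p <= m <= q -> r <= s ->
  bdry F p q r s = bdry F p m r s + bdry F m q r s.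
Proof.
move=> H pmq rs; have /andP[pm mq] := pmq; have pq := le_trans pm mq.
rewrite /bdry (Rintegral_split pmq); last first.
  by apply: cont_onB; apply: (hol_rect_hor H); rewrite lexx ?rs ?andbT.
have cp : cont_on r s (fun y => complex.Im (F (p +i* y))).
  by apply: (hol_rect_ver H); rewrite lexx.
have cq : cont_on r s (fun y => complex.Im (F (q +i* y))).
  by apply: (hol_rect_ver H); rewrite lexx pq.
have cm : cont_on r s (fun y => complex.Im (F (m +i* y))).
  by apply: (hol_rect_ver H).
rewrite (Rintegral_cont_onB cp cq) (Rintegral_cont_onB cp cm) (Rintegral_cont_onB cm cq).
by ring.
Qed.

Lemma bdry_split_ver F p q r m s : hol_rect F p q r s -> p <= q -> r <= m <= s ->
  bdry F p q r s = bdry F p q r m + bdry F p q m s.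
Proof.
move=> H pq rms; have /andP[rm ms] := rms; have rs := le_trans rm ms.
rewrite /bdry (Rintegral_split rms); last first.
  by apply: cont_onB; apply: (hol_rect_ver H); rewrite lexx ?pq ?andbT.
have cp : cont_on p q (fun x => complex.Re (F (x +i* r))).
  by apply: (hol_rect_hor H); rewrite lexx.
have cq : cont_on p q (fun x => complex.Re (F (x +i* s))).
  by apply: (hol_rect_hor H); rewrite lexx rs.
have cm : cont_on p q (fun x => complex.Re (F (x +i* m))).
  by apply: (hol_rect_hor H).
rewrite (Rintegral_cont_onB cp cq) (Rintegral_cont_onB cp cm) (Rintegral_cont_onB cm cq).
by ring.
Qed.

Lemma hol_rect_sub F p q r s p' q' r' s' : hol_rect F p q r s ->
  p <= p' -> q' <= q -> r <= r' -> s' <= s -> hol_rect F p' q' r' s'.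
Proof.
move=> H pp qq rr ss x y /andP[x1 x2] /andP[y1 y2]; apply: H.
  by rewrite (le_trans pp)// (le_trans x2).
by rewrite (le_trans rr)// (le_trans y2).
Qed.

(** The width is halved, then the height; keeping each time the half with the larger contribution
    loses a factor [2] twice. *)
Lemma bdry_quarter F p r w h : 0 <= w -> 0 <= h -> hol_rect F p (p + w) r (r + h) ->
  exists p' r', [/\ p <= p' <= p + w / 2, r <= r' <= r + h / 2 &
    `|bdry F p (p + w) r (r + h)| <=
      4 * `|bdry F p' (p' + w / 2) r' (r' + h / 2)|].
Proof.
move=> w0 h0 H.
have [p' p'P le2] : exists2 p', p <= p' <= p + w / 2 &
    `|bdry F p (p + w) r (r + h)| <= 2 * `|bdry F p' (p' + w / 2) r (r + h)|.
  have pmq : p <= p + w / 2 <= p + w by apply/andP; split; lra.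
  have rs : r <= r + h by lra.
  have E := bdry_split_hor H pmq rs.
  have := ler_normD (bdry F p (p + w / 2) r (r + h)) (bdry F (p + w / 2) (p + w) r (r + h)).
  rewrite -E => N.
  have [le|lt] := leP (`|bdry F (p + w / 2) (p + w) r (r + h)|)
                      (`|bdry F p (p + w / 2) r (r + h)|).
    by exists p; [apply/andP; split; lra | lra].
  exists (p + w / 2); first by apply/andP; split; lra.
  by rewrite (_ : p + w / 2 + w / 2 = p + w); [lra|field].
have H' : hol_rect F p' (p' + w / 2) r (r + h).
  by move/andP: p'P => [? ?]; apply: (hol_rect_sub H); lra.
have [r' r'P le2'] : exists2 r', r <= r' <= r + h / 2 &
    `|bdry F p' (p' + w / 2) r (r + h)| <=
      2 * `|bdry F p' (p' + w / 2) r' (r' + h / 2)|.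
  have pmq : r <= r + h / 2 <= r + h by apply/andP; split; lra.
  have rs : p' <= p' + w / 2 by lra.
  have E := bdry_split_ver H' rs pmq.
  have := ler_normD (bdry F p' (p' + w / 2) r (r + h / 2))
                    (bdry F p' (p' + w / 2) (r + h / 2) (r + h)).
  rewrite -E => N.
  have [le|lt] := leP (`|bdry F p' (p' + w / 2) (r + h / 2) (r + h)|)
                      (`|bdry F p' (p' + w / 2) r (r + h / 2)|).
    by exists r; [apply/andP; split; lra | lra].
  exists (r + h / 2); first by apply/andP; split; lra.
  by rewrite (_ : r + h / 2 + h / 2 = r + h); [lra|field].
by exists p', r'; split => //; lra.
Qed.

(** The affine part contributes nothing: the horizontal sides give [d2 * h * w], the vertical ones
    [- d2 * w * h]. Only the error [e] remains, counted on opposite sides. *)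
Lemma bdry_near_affine F p r w h (z D : R[i]) (e : R) : 0 <= w -> 0 <= h ->
  hol_rect F p (p + w) r (r + h) ->
  (forall x y, p <= x <= p + w -> r <= y <= r + h ->
     Normc.normc (F (x +i* y) - F z - D * ((x +i* y) - z)) <= e) ->
  `|bdry F p (p + w) r (r + h)| <= 2 * e * (w + h).
Proof.
move=> w0 h0 H near.
have pq : p <= p + w by lra. have rs : r <= r + h by lra.
case: z D near => x0 y0 [d1 d2] near.
have nearRe x y : p <= x <= p + w -> r <= y <= r + h ->
    `|complex.Re (F (x +i* y)) - complex.Re (F (x0 +i* y0)) -
      (d1 * (x - x0) - d2 * (y - y0))| <= e.
  move=> xx yy; apply: le_trans (near _ _ xx yy); apply: le_trans (ler_Re_normc _).
  by rewrite !raddfB/=.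
have nearIm x y : p <= x <= p + w -> r <= y <= r + h ->
    `|complex.Im (F (x +i* y)) - complex.Im (F (x0 +i* y0)) -
      (d1 * (y - y0) + d2 * (x - x0))| <= e.
  move=> xx yy; apply: le_trans (near _ _ xx yy); apply: le_trans (ler_Im_normc _).
  by rewrite !raddfB/=.
have A1 : `|\int[mu]_(x in `[p, p + w])
    (complex.Re (F (x +i* r)) - complex.Re (F (x +i* (r + h)))) - d2 * h * (p + w - p)|
    <= 2 * e * (p + w - p).
  apply: Rintegral_near => //.
    by apply: cont_onB; apply: (hol_rect_hor H); rewrite lexx ?rs ?andbT.
  move=> x xx.
  have := nearRe x r xx; rewrite lexx rs => /(_ isT).
  have := nearRe x (r + h) xx; rewrite lexx rs => /(_ isT).
  rewrite !ler_norml => /andP[? ?] /andP[? ?]; apply/andP; split; lra.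
have A2 : `|\int[mu]_(y in `[r, r + h])
    (complex.Im (F (p +i* y)) - complex.Im (F ((p + w) +i* y))) - - (d2 * w) * (r + h - r)|
    <= 2 * e * (r + h - r).
  apply: Rintegral_near => //.
    by apply: cont_onB; apply: (hol_rect_ver H); rewrite lexx ?pq ?andbT.
  move=> y yy.
  have := nearIm p y; rewrite lexx pq => /(_ isT yy).
  have := nearIm (p + w) y; rewrite lexx pq => /(_ isT yy).
  rewrite !ler_norml => /andP[? ?] /andP[? ?]; apply/andP; split; lra.
rewrite /bdry.
move: A1 A2; set I1 := (\int[_]_(_ in _) _)%R; set I2 := (\int[_]_(_ in _) _)%R.
rewrite !ler_norml => /andP[? ?] /andP[? ?]; apply/andP; split; lra.
Qed.

End Goursat.

Section GoursatTheorem.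
Context {R : realType}.
Notation mu := (@lebesgue_measure R).
Implicit Types (F : R[i] -> R[i]).

Lemma nested_halves (p_ : nat -> R) (w : R) : 0 <= w ->
  (forall n, p_ n <= p_ n.+1 <= p_ n + w / 2 ^+ n / 2) ->
  exists l, forall n, p_ n <= l <= p_ n + w / 2 ^+ n.
Proof.
move=> w0 H.
have mono m n : (m <= n)%N -> p_ m <= p_ n.
  elim: n => [|n IH]; first by rewrite leqn0 => /eqP ->.
  rewrite leq_eqVlt => /predU1P[->//|]; rewrite ltnS => /IH mn.
  by rewrite (le_trans mn)//; case/andP: (H n).
have half n : w / 2 ^+ n.+1 = w / 2 ^+ n / 2 by rewrite exprS; field.
have mono' m n : (m <= n)%N -> p_ n + w / 2 ^+ n <= p_ m + w / 2 ^+ m.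
  elim: n => [|n IH]; first by rewrite leqn0 => /eqP ->.
  rewrite leq_eqVlt => /predU1P[->//|]; rewrite ltnS => /IH mn.
  by apply: le_trans mn; have /andP[_] := H n; rewrite half; lra.
have wn n : 0 <= w / 2 ^+ n by rewrite divr_ge0// exprn_ge0.
have ub m n : p_ m <= p_ n + w / 2 ^+ n.
  have [mn|nm] := leqP m n; first by have := mono _ _ mn; have := wn n; lra.
  by have := mono' _ _ (ltnW nm); have := wn m; lra.
have hs : has_sup (range p_).
  split; first by exists (p_ 0%N), 0%N.
  by exists (p_ 0%N + w / 2 ^+ 0) => _ [m _ <-].
exists (sup (range p_)) => n; apply/andP; split.
  by apply: ub_le_sup; [case: hs|exists n].
by apply: ge_sup; [case: hs|move=> _ [m _ <-]].
Qed.

(** Bisection: the rectangles shrink to a point, where differentiability makes the boundary integral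
    smaller than any multiple of the area. *)
Lemma goursat F p r w h : 0 <= w -> 0 <= h ->
  hol_rect F p (p + w) r (r + h) -> bdry F p (p + w) r (r + h) = 0.
Proof.
move=> w0 h0 H.
pose W n := w / 2 ^+ n; pose Hh n := h / 2 ^+ n.
have WS n : W n.+1 = W n / 2 by rewrite /W exprS; field.
have HS n : Hh n.+1 = Hh n / 2 by rewrite /Hh exprS; field.
have Wn n : 0 <= W n by rewrite divr_ge0// exprn_ge0.
have Hn n : 0 <= Hh n by rewrite divr_ge0// exprn_ge0.
(* Selection is made for every corner and every level at once; the implication lets the choice be
   arbitrary where [F] is not holomorphic. *)
have /choice[nxt nxtP] (na : nat * (R * R)) : exists b : R * R,
    let: (n, a) := na in
    hol_rect F a.1 (a.1 + W n) a.2 (a.2 + Hh n) ->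
    [/\ a.1 <= b.1 <= a.1 + W n / 2, a.2 <= b.2 <= a.2 + Hh n / 2 &
     `|bdry F a.1 (a.1 + W n) a.2 (a.2 + Hh n)| <=
        4 * `|bdry F b.1 (b.1 + W n / 2) b.2 (b.2 + Hh n / 2)|].
  case: na => n a.
  have [Ha|Ha] := pselect (hol_rect F a.1 (a.1 + W n) a.2 (a.2 + Hh n)).
    have [p' [r' [? ? ?]]] := bdry_quarter (Wn n) (Hn n) Ha.
    by exists (p', r').
  by exists a.
pose T := fix T n : R * R := if n is n'.+1 then nxt (n', T n') else (p, r).
have Thol n : hol_rect F (T n).1 ((T n).1 + W n) (T n).2 ((T n).2 + Hh n).
  elim: n => [|n IH]; first by rewrite /W /Hh expr0 !divr1.
  have /= [/andP[? ?] /andP[? ?] _] := nxtP (n, T n) IH.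
  by apply: (hol_rect_sub IH) => //=; rewrite ?WS ?HS; lra.
have TS n := nxtP (n, T n) (Thol n).
have [x0 x0P] : exists l, forall n, (T n).1 <= l <= (T n).1 + W n.
  by apply: nested_halves w0 _ => n; case: (TS n).
have [y0 y0P] : exists l, forall n, (T n).2 <= l <= (T n).2 + Hh n.
  by apply: nested_halves h0 _ => n; case: (TS n).
pose b n := `|bdry F (T n).1 ((T n).1 + W n) (T n).2 ((T n).2 + Hh n)|.
have bS n : b 0%N <= 4 ^+ n * b n.
  elim: n => [|n IH]; first by rewrite mul1r.
  rewrite (le_trans IH)// exprSr -mulrA ler_wpM2l ?exprn_ge0//.
  by have [_ _] := TS n; rewrite -WS -HS.
have [D FD] : exists D, cderiv F (x0 +i* y0) D.
  by apply: H; [have := x0P 0%N|have := y0P 0%N]; rewrite /= ?/W ?/Hh expr0 divr1.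
(* At level [n] the remainder is at most [e] times the size and the perimeter is proportional to the
   size, so the integral is of order [e 4^-n], which cancels the factor [4^n] of [bS]. *)
have b0 e : 0 < e -> b 0%N <= 2 * (w + h) ^+ 2 * e.
  move=> e0; have [d d0 dP] := FD _ e0.
  have [n nP] : exists n, W n + Hh n < d.
    have [n] : exists n, (w + h) / d < 2 ^+ n.
      exists (Num.bound ((w + h) / d)); rewrite (lt_le_trans (archi_boundP _))//.
        by rewrite divr_ge0 ?addr_ge0// ltW.
      by rewrite -natrX ler_nat ltnW// ltn_expl.
    rewrite ltr_pdivrMr// mulrC -ltr_pdivrMr ?exprn_gt0// => ?.
    by exists n; rewrite /W /Hh -mulrDl.
  have bn : b n <= 2 * (e * (W n + Hh n)) * (W n + Hh n).
    apply: (@bdry_near_affine _ _ _ _ _ _ (x0 +i* y0) D) => // x y xx yy.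
    have zn : Normc.normc ((x +i* y) - (x0 +i* y0)) <= W n + Hh n.
      apply: le_trans (ler_normc_ReIm _) _ => /=.
      have /andP[? ?] := x0P n; have /andP[? ?] := y0P n.
      move: xx yy => /andP[? ?] /andP[? ?].
      by apply: lerD; rewrite ler_norml; apply/andP; split; lra.
    have := dP _ (le_lt_trans zn nP).
    rewrite (_ : _ + (_ - _) = x +i* y); last by ring.
    move=> /le_trans; apply; by rewrite ler_wpM2l// ltW.
  apply: le_trans (bS n) _; apply: le_trans (ler_wpM2l _ bn) _.
    by rewrite exprn_ge0.
  rewrite le_eqVlt; apply/orP; left; apply/eqP.
  rewrite /W /Hh (_ : 4 ^+ n = 2 ^+ n * 2 ^+ n); last first.
    by rewrite -exprMn; congr (_ ^+ _); ring.
  by field; rewrite expf_neq0.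
have : b 0%N <= 0.
  apply/ler_addgt0Pr => e e0; rewrite add0r.
  have C0 : 0 < 2 * (w + h) ^+ 2 + 1 by rewrite ltr_wpDl// mulr_ge0// sqr_ge0.
  apply: le_trans (b0 (e / (2 * (w + h) ^+ 2 + 1)) _) _; first by rewrite divr_gt0.
  rewrite mulrA ler_pdivrMr// mulrDr mulr1 mulrC lerDl; exact: ltW.
rewrite /b /W /Hh expr0 !divr1 /= normr_le0 => /eqP//.
Qed.

End GoursatTheorem.

(** * Integrals over the line and almost-everywhere convergence *)

Section MeasureToolkit.
Context {R : realType}.
Notation mu := (@lebesgue_measure R).
Notation mfun := (measurable_fun [set: R]).
Implicit Types (f g : R -> R).

Lemma cvg_EFinP T (F : set_system T) {FF : Filter F} (u : T -> R) (l : R) :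
  (u x)%:E @[x --> F] --> l%:E <-> u x @[x --> F] --> l.
Proof.
split=> [H|H]; first exact: (fine_cvg H).
by apply: cvg_EFin => //; apply: nearW.
Qed.

Lemma ae_imp (P Q : R -> Prop) : (forall x, P x -> Q x) ->
  {ae mu, forall x, P x} -> {ae mu, forall x, Q x}.
Proof.
by move=> PQ; apply: negligibleS => x /=; apply: contra_not; exact: PQ.
Qed.

Lemma ae_and (P Q : R -> Prop) : {ae mu, forall x, P x} -> {ae mu, forall x, Q x} ->
  {ae mu, forall x, P x /\ Q x}.
Proof.
move=> HP HQ; have := negligibleU HP HQ; apply: negligibleS => x /=.
by have [Px|] := pselect (P x); [right=> Qx; exact: H|left].
Qed.

Lemma ae_all (P : nat -> R -> Prop) : (forall n, {ae mu, forall x, P n x}) ->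
  {ae mu, forall x, forall n, P n x}.
Proof.
move=> H; have := negligible_bigcup H; apply: negligibleS => x /= /existsNP[n nP].
by exists n.
Qed.

Lemma ae_every (P : R -> Prop) : (forall x, P x) -> {ae mu, forall x, P x}.
Proof.
move=> H; exists set0; split=> // x /=; by have := H x.
Qed.

Lemma le_nint f g : mfun f -> mfun g -> (forall x, 0 <= f x) ->
  (forall x, f x <= g x) ->
  (\int[mu]_x (f x)%:E <= \int[mu]_x (g x)%:E)%E.
Proof.
move=> mf mg f0 fg; apply: ge0_le_integral => //.
- by move=> x _; rewrite lee_fin.
- exact/measurable_EFinP.
- exact/measurable_EFinP.
- by move=> x _; rewrite lee_fin.
Qed.

Lemma nintD f g : mfun f -> mfun g -> (forall x, 0 <= f x) -> (forall x, 0 <= g x) ->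
  (\int[mu]_x (f x + g x)%:E = \int[mu]_x (f x)%:E + \int[mu]_x (g x)%:E)%E.
Proof.
move=> mf mg f0 g0; under eq_integral do rewrite EFinD.
rewrite ge0_integralD//; try exact/measurable_EFinP.
- by move=> x _; rewrite lee_fin.
- by move=> x _; rewrite lee_fin.
Qed.

Lemma nintZ (k : R) f : mfun f -> (forall x, 0 <= f x) -> 0 <= k ->
  (\int[mu]_x (k * f x)%:E = k%:E * \int[mu]_x (f x)%:E)%E.
Proof.
move=> mf f0 k0; under eq_integral do rewrite EFinM.
rewrite ge0_integralZl//; first exact/measurable_EFinP.
by move=> x _; rewrite lee_fin.
Qed.

Lemma nint_ge0 f : (forall x, 0 <= f x) -> (0 <= \int[mu]_x (f x)%:E)%E.
Proof. by move=> f0; apply: integral_ge0 => x _; rewrite lee_fin. Qed.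

Lemma nint_integrable f : mfun f -> (forall x, 0 <= f x) ->
  (\int[mu]_x (f x)%:E < +oo)%E -> mu.-integrable setT (EFin \o f).
Proof.
move=> mf f0 If; apply/integrableP; split; first exact/measurable_EFinP.
by under eq_integral do rewrite /= ger0_norm//.
Qed.

Lemma integrable_le f g : mfun f -> (forall x, `|f x| <= g x) ->
  mu.-integrable setT (EFin \o g) -> mu.-integrable setT (EFin \o f).
Proof.
move=> mf fg ig; apply: (le_integrable measurableT _ _ ig).
  exact/measurable_EFinP.
by move=> x _ /=; rewrite lee_fin (le_trans (fg x))// ler_norm.
Qed.

Lemma fatou_ae (f_ : nat -> R -> R) f (M : \bar R) :
  (forall n, mfun (f_ n)) -> mfun f -> (forall n x, 0 <= f_ n x) ->
  (forall x, 0 <= f x) ->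
  {ae mu, forall x, f_ n x @[n --> \oo] --> f x} ->
  (\forall n \near \oo, \int[mu]_x (f_ n x)%:E <= M)%E ->
  (\int[mu]_x (f x)%:E <= M)%E.
Proof.
move=> mf_ mf f_0 f0 cv le.
have mE n : measurable_fun [set: R] (EFin \o f_ n) by exact/measurable_EFinP.
have := @fatou _ _ _ mu setT measurableT (fun n => EFin \o f_ n) mE.
have h0 : forall n x, [set: R] x -> (0 <= (EFin \o f_ n) x)%E.
  by move=> n x _; rewrite lee_fin.
move=> /(_ h0).
rewrite (@ge0_ae_eq_integral _ _ _ mu setT _ (EFin \o f)) //; last first.
- apply: ae_imp cv => x fx _ /=.
  rewrite is_cvg_limn_einfE; last by apply/cvg_ex; exists (f x)%:E; exact/cvg_EFinP.
  by apply/cvg_lim => //; exact/cvg_EFinP.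
- by move=> x _; rewrite lee_fin.
- move=> x _; rewrite limn_einf_lim; apply: lime_ge; first exact: is_cvg_einfs.
  by apply: nearW => n; apply: le_ereal_inf_tmp => _ [m _ <-]; rewrite /= lee_fin.
- exact/measurable_EFinP.
- apply: measurableT_comp => //; apply: measurable_fun_limn_esup => // n.
  by apply: measurableT_comp (mE n); exact: oppe_measurable.
move=> /le_trans; apply; rewrite limn_einf_lim; apply: lime_le; first exact: is_cvg_einfs.
move: le; apply: filterS => n; apply: le_trans.
by apply: ge_ereal_inf; exists (\int[mu]_x (f_ n x)%:E)%E => //; exists n => /=.
Qed.

(** The sum of the functions has finite integral, hence is finite a.e., and the terms of a
    convergent series tend to zero. *)
Lemma ae_cvg0 (g_ : nat -> R -> R) : (forall n, mfun (g_ n)) ->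
  (forall n x, 0 <= g_ n x) ->
  (forall n, \int[mu]_x (g_ n x)%:E <= (2^-1 ^+ n)%:E)%E ->
  {ae mu, forall x, g_ n x @[n --> \oo] --> (0 : R)}.
Proof.
move=> mg g0 le.
have mE n : measurable_fun [set: R] (EFin \o g_ n) by exact/measurable_EFinP.
have gE0 : forall n x, [set: R] x -> (0 <= (EFin \o g_ n) x)%E.
  by move=> n x _; rewrite lee_fin.
have IS := integral_nneseries mu measurableT mE gE0.
have S2 : (\sum_(n <oo) (\int[mu]_x (g_ n x)%:E) < +oo)%E.
  (* The geometric series is brought to the shape that [epsilon_trick0] sums. *)
  apply: (@le_lt_trans _ _ (\sum_(n <oo) (2 / (2 ^ n.+1)%:R)%:E)%E).
    apply: lee_nneseries => n _; first by move=> _; exact: nint_ge0.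
    rewrite (le_trans (le n))// lee_fin natrX exprS exprVn.
    by rewrite invfM mulrA divff// mul1r.
  by rewrite (le_lt_trans (epsilon_trick0 _ _))// ltry.
have iS : mu.-integrable setT (fun x => \sum_(n <oo) (g_ n x)%:E)%E.
  apply/integrableP; split.
    by apply: ge0_emeasurable_sum => [n x _ _|n _]; [rewrite lee_fin|exact: mE].
  under eq_integral => x _.
    rewrite gee0_abs; last by apply: nneseries_ge0 => n _ _; rewrite lee_fin.
    over.
  by rewrite /= IS.
apply: ae_imp (integrable_ae measurableT iS) => x /(_ I) fx.
apply/cvg_EFinP.
have S0 : (\sum_(n <oo) (g_ n x)%:E < +oo)%E by rewrite ltey_eq fx.
have gx0 k : xpredT k -> (0%R <= (g_ k x)%:E)%E by rewrite lee_fin g0.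
have T := nneseries_tail_cvg S0 gx0.
apply: (@squeeze_cvge _ _ _ _ (cst 0%E) _ (fun N => \sum_(N <= k <oo) (g_ k x)%:E)%E).
- apply: nearW => n; rewrite lee_fin g0/=.
  have := @nneseries_lim_ge _ (fun k => (g_ k x)%:E) xpredT n n.+1.
  rewrite big_nat1; by apply=> // k *; rewrite lee_fin; exact: g0.
- exact: cvg_cst.
- exact: T.
Qed.

End MeasureToolkit.

(** * Joint measurability of functions measurable in one variable and continuous in the other *)

Section Caratheodory.
Context {R : realType}.
Notation mu := (@lebesgue_measure R).

Let step (n : nat) (y : R) : R := (Num.floor (n.+1%:R * y))%:~R / n.+1%:R.

Let step_cvg y : step n y @[n --> \oo] --> y.
Proof.
have H n : y - n.+1%:R^-1 <= step n y <= y.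
  have n0 : (0 : R) < n.+1%:R by [].
  have /andP[h1 h2] := Num.Theory.floor_itv (n.+1%:R * y).
  apply/andP; split; last by rewrite /step ler_pdivrMr// [leRHS]mulrC.
  rewrite /step ler_pdivlMr// mulrBl mulVf ?gt_eqF// lerBlDr [y * _]mulrC.
  by rewrite intrD in h2; rewrite ltW.
apply: (@squeeze_cvgr _ _ _ _ (fun n => y - n.+1%:R^-1) (cst y)).
- by apply: nearW => n.
- rewrite -[X in _ --> X]subr0; apply: cvgB; first exact: cvg_cst.
  exact: cvg_harmonic.
- exact: cvg_cst.
Qed.

(** Rounding [y] down to a multiple of [1 / (n + 1)] gives functions that are measurable on each of
    countably many horizontal bands; by continuity in [y] they converge to [G]. The integer indexing
    a band is coded by [pickle], so that the union runs over [nat]. *)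
Lemma separately_measurable (G : R -> R -> R) :
  (forall y, measurable_fun [set: R] (G ^~ y)) -> (forall x, continuous (G x)) ->
  measurable_fun [set: R * R] (fun z => G z.1 z.2).
Proof.
move=> mG cG.
apply: (@measurable_fun_cvg _ _ _ _ (fun n z => G z.1 (step n z.2))); last first.
  by move=> z _; apply: (cvg_comp (step ^~ z.2) (G z.1)); [exact: step_cvg|exact: cG].
move=> n _ B mB; rewrite setTI.
pose I (k : int) : set R := `[k%:~R / n.+1%:R, (k + 1)%:~R / n.+1%:R[%classic.
pose S (k : int) := ((G ^~ (k%:~R / n.+1%:R)) @^-1` B) `*` I k.
have -> : (fun z : R * R => G z.1 (step n z.2)) @^-1` B =
    \bigcup_(m : nat) (if unpickle m is Some k then S k else set0).
  have IP k y : I k y <-> Num.floor (n.+1%:R * y) = k.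
    rewrite /I/= in_itv/= ler_pdivrMr// ltr_pdivlMr// mulrC.
    split=> [H|<-]; last exact: Num.Theory.floor_itv.
    by apply/eqP; rewrite Num.Theory.floor_eq.
  apply/seteqP; split=> [[x y] /= Bxy|[x y] [m _]].
    exists (pickle (Num.floor (n.+1%:R * y))); first exact: Logic.I.
    by rewrite pickleK; split; [exact: Bxy|apply/IP].
  by case: unpickle => // k [/= Bxy /IP kE]; rewrite /step kE.
apply: bigcupT_measurable => m; case: unpickle => // k.
apply: measurableX; last exact: measurable_itv.
by rewrite -[X in measurable X]setTI; exact: mG.
Qed.

End Caratheodory.

Section IntegralTools.
Context {R : realType}.
Notation mu := (@lebesgue_measure R).
Notation mfun := (measurable_fun [set: R]).

Lemma Rint_dominated (f_ : nat -> R -> R) (f g : R -> R) :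
  (forall n, mfun (f_ n)) -> mfun f ->
  {ae mu, forall x, f_ n x @[n --> \oo] --> f x} ->
  mu.-integrable setT (EFin \o g) -> (forall n x, `|f_ n x| <= g x) ->
  \int[mu]_x f_ n x @[n --> \oo] --> \int[mu]_x f x.
Proof.
move=> mf_ mf cv ig le.
have mE n : measurable_fun [set: R] (EFin \o f_ n) by exact/measurable_EFinP.
have mfE : measurable_fun [set: R] (EFin \o f) by exact/measurable_EFinP.
have cvE : {ae mu, forall x, setT x -> (EFin \o f_ n) x @[n --> \oo] --> (EFin \o f) x}.
  by apply: ae_imp cv => x fx _; apply/cvg_EFinP.
have leE : {ae mu, forall x n, setT x -> (`|(EFin \o f_ n) x| <= (EFin \o g) x)%E}.
  by apply: ae_every => x n _ /=; rewrite lee_fin.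
have [iF _ cF] := @dominated_convergence _ _ _ mu setT measurableT _ _ _ mE mfE cvE ig leE.
apply: fine_cvg; rewrite fineK//; exact: integrable_fin_num.
Qed.

(** Otherwise [g >= e] on a half-line of infinite measure. An integrable function need not tend to
    zero, but these points suffice as places for the vertical sides of large rectangles. *)
Lemma exists_small_right (g : R -> \bar R) (X e : R) : measurable_fun [set: R] g ->
  (forall x, 0 <= g x)%E -> (\int[mu]_x g x < +oo)%E -> 0 < e ->
  exists2 q, X <= q & (g q < e%:E)%E.
Proof.
move=> mg g0 Ig e0; apply: contrapT => H.
have {}H q : X <= q -> (e%:E <= g q)%E.
  by move=> Xq; rewrite leNgt; apply/negP => gq; apply: H; exists q.
suff : (\int[mu]_x g x >= +oo)%E by rewrite leye_eq => /eqP E; rewrite E in Ig.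
apply: (@le_trans _ _ (\int[mu]_(x in `[X, +oo[) (cst e%:E) x)%E); last first.
  apply: (@le_trans _ _ (\int[mu]_(x in `[X, +oo[) g x)%E).
    apply: ge0_le_integral; [exact: measurable_itv| | | |].
    - by move=> x _; rewrite lee_fin ltW.
    - exact: measurable_cst.
    - exact: measurable_funTS.
    - by move=> x /=; rewrite in_itv/= andbT => /H.
  by apply: ge0_subset_integral; rewrite ?subsetT//; exact: measurable_itv.
have E := @lebesgue_measure_itv R `[X, +oo[; rewrite /= ltry addye// in E.
rewrite integral_cst// leye_eq; apply/eqP; apply: etrans (congr1 (mule e%:E) E) _.
by rewrite gt0_muley ?lte_fin.
Qed.

Lemma exists_small_left (g : R -> \bar R) (X e : R) : measurable_fun [set: R] g ->
  (forall x, 0 <= g x)%E -> (\int[mu]_x g x < +oo)%E -> 0 < e ->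
  exists2 q, q <= X & (g q < e%:E)%E.
Proof.
move=> mg g0 Ig e0; apply: contrapT => H.
have {}H q : q <= X -> (e%:E <= g q)%E.
  by move=> Xq; rewrite leNgt; apply/negP => gq; apply: H; exists q.
suff : (\int[mu]_x g x >= +oo)%E by rewrite leye_eq => /eqP E; rewrite E in Ig.
apply: (@le_trans _ _ (\int[mu]_(x in `]-oo, X]) (cst e%:E) x)%E); last first.
  apply: (@le_trans _ _ (\int[mu]_(x in `]-oo, X]) g x)%E).
    apply: ge0_le_integral; [exact: measurable_itv| | | |].
    - by move=> x _; rewrite lee_fin ltW.
    - exact: measurable_cst.
    - exact: measurable_funTS.
    - by move=> x /=; rewrite in_itv/= => /H.
  by apply: ge0_subset_integral; rewrite ?subsetT//; exact: measurable_itv.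
have E := @lebesgue_measure_itv R `]-oo, X]; rewrite /= ltNyr addey// in E.
rewrite integral_cst// leye_eq; apply/eqP; apply: etrans (congr1 (mule e%:E) E) _.
by rewrite gt0_muley ?lte_fin.
Qed.

End IntegralTools.

(** * Integrals over horizontal lines of a strip *)

Section ContourShift.
Context {R : realType}.
Notation mu := (@lebesgue_measure R).
Notation mfun := (measurable_fun [set: R]).
Implicit Types (F : R[i] -> R[i]) (a b y : R).

Definition hol F a b := forall z : R[i], strip a b z -> exists D, cderiv F z D.

Lemma ler_dist_normc (z w : R[i]) :
  `|Normc.normc z - Normc.normc w| <= Normc.normc (z - w).
Proof.
rewrite ler_norml; apply/andP; split.
  have := ler_normcD z (w - z); rewrite addrC subrK -[in X in _ + X](normcN (w - z)) opprB; lra.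
have := ler_normcD w (z - w); rewrite addrC subrK; lra.
Qed.

Lemma hol_line_continuous F a b y : hol F a b -> b < y < a ->
  [/\ continuous (fun x => complex.Re (F (x +i* y))),
      continuous (fun x => complex.Im (F (x +i* y))) &
      continuous (fun x => Normc.normc (F (x +i* y)))].
Proof.
move=> hF /andP[y1 y2].
have H x : exists D, cderiv F (x +i* y) D by apply: hF.
split=> x; have [D hD] := H x.
- exact: continuous_Re_x hD.
- exact: continuous_Im_x hD.
- apply: continuous_at_le => e /(cderiv_continuous_ReIm hD)[d d0 dP].
  exists d => // x' xd; have := dP (x' +i* y).
  have -> : (x' +i* y) - (x +i* y) = (x' - x) +i* 0.
    by apply/eqP; rewrite eq_complex/= subrr !eqxx.
  rewrite normc_real => /(_ xd); apply: le_trans; exact: ler_dist_normc.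
Qed.

Lemma hol_line_measurable F a b y : hol F a b -> b < y < a ->
  [/\ mfun (fun x => complex.Re (F (x +i* y))),
      mfun (fun x => complex.Im (F (x +i* y))) &
      mfun (fun x => Normc.normc (F (x +i* y)))].
Proof.
by move=> hF yab; have [c1 c2 c3] := hol_line_continuous hF yab;
  split; apply: continuous_measurable_fun.
Qed.

Lemma hol_normc_continuous_y F a b x y : hol F a b -> b < y < a ->
  {for y, continuous (fun y => Normc.normc (F (x +i* y)))}.
Proof.
move=> hF /andP[y1 y2]; have [|D hD] := hF (x +i* y); first by [].
apply: continuous_at_le => e /(cderiv_continuous_ReIm hD)[d d0 dP].
exists d => // y' yd; have := dP (x +i* y').
have -> : (x +i* y') - (x +i* y) = 0 +i* (y' - y).
  by apply/eqP; rewrite eq_complex/= subrr !eqxx.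
rewrite normc_imag => /(_ yd); apply: le_trans; exact: ler_dist_normc.
Qed.

(** Composition with the projection onto [[s1, s2]] extends a function continuous inside the strip
    to all heights, as [separately_measurable] requires. *)
Definition clamp (s1 s2 y : R) := Num.max s1 (Num.min s2 y).

Lemma clamp_continuous s1 s2 : continuous (clamp s1 s2).
Proof.
move=> y; apply: continuous_at_le => e e0; exists e => // y' yy'.
apply: le_trans (ltW yy'); rewrite /clamp.
have [h1|h1] := leP s2 y; have [h2|h2] := leP s2 y'; rewrite ?subrr ?normr0//.
- have [h3|h3] := leP s1 s2; have [h4|h4] := leP s1 y'; rewrite ?subrr ?normr0// ?ler_norml; apply/andP;
  (have := ler_norm (y' - y); have := ler_norm (y - y'); rewrite [`|y - y'|]distrC; split; lra).
- have [h3|h3] := leP s1 y; have [h4|h4] := leP s1 s2; rewrite ?subrr ?normr0// ?ler_norml; apply/andP;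
  (have := ler_norm (y' - y); have := ler_norm (y - y'); rewrite [`|y - y'|]distrC; split; lra).
- have [h3|h3] := leP s1 y; have [h4|h4] := leP s1 y'; rewrite ?subrr ?normr0// ?ler_norml; apply/andP;
  (have := ler_norm (y' - y); have := ler_norm (y - y'); rewrite [`|y - y'|]distrC; split; lra).
Qed.

Lemma clamp_id s1 s2 y : s1 <= y <= s2 -> clamp s1 s2 y = y.
Proof. by move=> /andP[h1 h2]; rewrite /clamp (min_idPr h2) (max_idPr h1). Qed.

Lemma clamp_itv s1 s2 y : s1 <= s2 -> s1 <= clamp s1 s2 y <= s2.
Proof. by move=> h; rewrite /clamp le_max lexx/= ge_max h ge_min lexx. Qed.

Definition L1strip F a b := exists M : R, forall y, b < y < a ->
  (\int[mu]_x (Normc.normc (F (x +i* y)))%:E <= M%:E)%E.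

(** Tonelli: integrating the vertical integrals over [x] gives the line integrals integrated over
    [[s1, s2]], each of which is at most [M]. *)
Lemma vertical_integrable F a b s1 s2 : hol F a b -> L1strip F a b ->
  b < s1 -> s1 < s2 -> s2 < a ->
  exists g : R -> \bar R, [/\ measurable_fun [set: R] g, (forall x, 0 <= g x)%E,
    (\int[mu]_x g x < +oo)%E &
    forall x, g x = (\int[mu]_(y in `[s1, s2]) (Normc.normc (F (x +i* y)))%:E)%E].
Proof.
move=> hF [M MP] bs1 s12 s2a.
pose D : set R := `[s1, s2]%classic.
pose G x y := Normc.normc (F (x +i* clamp s1 s2 y)).
have Gc x : continuous (G x).
  move=> y; have /andP[c1 c2] := clamp_itv y (ltW s12).
  apply: (@continuous_comp R R R (clamp s1 s2) (fun y => Normc.normc (F (x +i* y))) y).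
    exact: clamp_continuous.
  have yy : b < clamp s1 s2 y < a by apply/andP; split; lra.
  exact: (@hol_normc_continuous_y F a b x (clamp s1 s2 y) hF yy).
have Gm y : mfun (G ^~ y).
  have /andP[c1 c2] := clamp_itv y (ltW s12).
  have [|_ _ //] := @hol_line_measurable F a b (clamp s1 s2 y) hF.
  apply/andP; split; lra.
pose f (z : R * R) : \bar R := (\1_D z.2 * G z.1 z.2)%:E.
have fm : measurable_fun [set: R * R] f.
  have m1 : measurable_fun [set: R * R] (fun z => \1_D z.2 : R).
    apply: measurableT_comp; last exact: measurable_snd.
    by apply: measurable_indic; exact: measurable_itv.
  have m2 := separately_measurable Gm Gc.
  by apply/measurable_EFinP; exact: (measurable_funM m1 m2).
have f0 z : (0 <= f z)%E by rewrite lee_fin mulr_ge0// normc_ge0.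
pose g x := (\int[mu]_y f (x, y))%E.
exists g; split.
- exact: (@measurable_fun_fubini_tonelli_F _ _ _ _ R mu f fm f0).
- by move=> x; apply: integral_ge0.
- rewrite /g (@fubini_tonelli _ _ _ _ R mu mu f fm f0).
  apply: (@le_lt_trans _ _ (\int[mu]_y (`|M| * \1_D y)%:E)%E).
    apply: ge0_le_integral => //.
    + by move=> y _; exact: integral_ge0.
    + exact: (@measurable_fun_fubini_tonelli_G _ _ _ _ R mu f fm f0).
    + apply/measurable_EFinP; apply: measurable_funM => //.
      apply: measurable_indic; exact: measurable_itv.
    + move=> y _; rewrite /f/= indicE; case: (boolP (y \in D)) => yD.
        under eq_integral do rewrite mul1r.
        have yy : s1 <= y <= s2 by move: yD; rewrite inE /D /= in_itv.
        rewrite /G clamp_id// mulr1; apply: (le_trans (MP y _)).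
          by move/andP: yy => [? ?]; apply/andP; split; lra.
        by rewrite lee_fin ler_norm.
      by under eq_integral do rewrite mul0r; rewrite integral0 mulr0.
  rewrite nintZ//; last first.
    apply: measurable_indic; exact: measurable_itv.
  rewrite integral_indic//; last exact: measurable_itv.
  rewrite setIT.
  have E := @lebesgue_measure_itv R `[s1, s2]; rewrite /= lte_fin s12 in E.
  apply: le_lt_trans (_ : ((`|M| * (s2 - s1))%:E < +oo)%E); last exact: ltry.
  by rewrite EFinM; apply: lee_wpmul2l; rewrite ?lee_fin//; rewrite le_eqVlt; apply/orP; left; apply/eqP; exact: E.
- move=> x; rewrite /g [RHS]integral_mkcond; apply: eq_integral => y _.
  rewrite /f patchE indicE /=; case: (boolP (y \in `[s1, s2])) => yD.
    by rewrite mem_set// mul1r /G clamp_id//; move: yD; rewrite in_itv.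
  by rewrite memNset ?mul0r//; apply/negP.
Qed.

End ContourShift.

Section ContourShiftTheorem.
Context {R : realType}.
Notation mu := (@lebesgue_measure R).
Notation mfun := (measurable_fun [set: R]).
Implicit Types (F : R[i] -> R[i]) (a b y : R).

Lemma L1strip_integrable F a b y : hol F a b -> L1strip F a b -> b < y < a ->
  mu.-integrable setT (EFin \o (fun x => Normc.normc (F (x +i* y)))).
Proof.
move=> hF [M MP] yab; apply: nint_integrable.
- by have [] := hol_line_measurable hF yab.
- by move=> x; exact: normc_ge0.
- exact: le_lt_trans (MP _ yab) (ltry _).
Qed.

Lemma L1strip_integrable_Re F a b y : hol F a b -> L1strip F a b -> b < y < a ->
  mu.-integrable setT (EFin \o (fun x => complex.Re (F (x +i* y)))).
Proof.
move=> hF LF yab; apply: integrable_le (L1strip_integrable hF LF yab).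
- by have [] := hol_line_measurable hF yab.
- by move=> x; exact: ler_Re_normc.
Qed.

Lemma bdry_vertical_le F p q r s : r <= s ->
  cont_on r s (fun y => complex.Im (F (p +i* y))) ->
  cont_on r s (fun y => complex.Im (F (q +i* y))) ->
  cont_on r s (fun y => Normc.normc (F (p +i* y))) ->
  cont_on r s (fun y => Normc.normc (F (q +i* y))) ->
  (`|\int[mu]_(y in `[r, s]) (complex.Im (F (p +i* y)) - complex.Im (F (q +i* y)))|%:E
   <= \int[mu]_(y in `[r, s]) (Normc.normc (F (p +i* y)))%:E +
     \int[mu]_(y in `[r, s]) (Normc.normc (F (q +i* y)))%:E)%E.
Proof.
move=> rs c1 c2 c3 c4.
have i12 := cont_on_integrable (cont_onB c1 c2).
have i3 := cont_on_integrable c3. have i4 := cont_on_integrable c4.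
rewrite EFin_normr_Rintegral//.
apply: le_trans (le_abse_integral _ _ _) _ => //.
  by case/integrableP: i12.
rewrite -integralD//=.
apply: ge0_le_integral => //.
- by case/integrableP: (integrable_abse i12).
- apply: emeasurable_funD; [by case/integrableP: i3|by case/integrableP: i4].
- move=> y _; rewrite /= lee_fin; apply: le_trans (ler_normB _ _) _.
  by apply: lerD; exact: ler_Im_normc.
Qed.

(** Goursat's theorem on rectangles between the two lines, with vertical sides chosen far out where
    their integrals are below [1 / (n + 1)]. *)
Lemma contour_shift_lt F a b s1 s2 : hol F a b -> L1strip F a b ->
  b < s1 -> s1 < s2 -> s2 < a ->
  \int[mu]_x complex.Re (F (x +i* s1)) = \int[mu]_x complex.Re (F (x +i* s2)).
Proof.
move=> hF LF bs1 s12 s2a.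
have s1ab : b < s1 < a by apply/andP; split; lra.
have s2ab : b < s2 < a by apply/andP; split; lra.
have [g [mg g0 Ig gE]] := vertical_integrable hF LF bs1 s12 s2a.
have i1 := L1strip_integrable_Re hF LF s1ab.
have i2 := L1strip_integrable_Re hF LF s2ab.
apply/eqP; rewrite -subr_eq0 -RintegralB//; apply/eqP.
pose u x := complex.Re (F (x +i* s1)) - complex.Re (F (x +i* s2)).
have iu : mu.-integrable setT (EFin \o u) by exact: (integrableB measurableT i1 i2).
have mu_u : mfun u by case/integrableP: iu => /measurable_EFinP.
have /choice[p_ pP] (n : nat) : exists p : R, p <= - n%:R /\ (g p < n.+1%:R^-1%:E)%E.
  by have [|p] := @exists_small_left _ _ (- n%:R) n.+1%:R^-1 mg g0 Ig; [|exists p].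
have /choice[q_ qP] (n : nat) : exists q : R, n%:R <= q /\ (g q < n.+1%:R^-1%:E)%E.
  by have [|q] := @exists_small_right _ _ n%:R n.+1%:R^-1 mg g0 Ig; [|exists q].
pose f n x := u x * \1_(`[p_ n, q_ n]%classic) x.
have cvf : \int[mu]_x f n x @[n --> \oo] --> \int[mu]_x u x.
  apply: (@Rint_dominated _ _ _ (fun x => `|u x|)) => //.
  - move=> n.
    have m1 : mfun (\1_(`[p_ n, q_ n]%classic) : R -> R).
      by apply: measurable_indic; exact: measurable_itv.
    exact: (measurable_funM mu_u m1).
  - apply: ae_every => x; apply: cvg_near_cst.
    near=> n; rewrite /f indicE mem_set ?mulr1//= in_itv/=.
    have xn : `|x| <= n%:R.
      near: n; exists (Num.bound `|x|) => // n /= nx.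
      by rewrite (le_trans (ltW (archi_boundP _)))// ?ler_nat//.
    have [pn _] := pP n; have [qn _] := qP n.
    by move: xn; rewrite ler_norml => /andP[? ?]; apply/andP; split; lra.
  - exact: (integrable_norm iu).
  - move=> n x; rewrite /f indicE normrM -[leRHS]mulr1 ler_wpM2l//.
    by case: (_ \in _); rewrite ?normr1 ?normr0.
have fE n : \int[mu]_x f n x = \int[mu]_(x in `[p_ n, q_ n]) u x.
  rewrite [RHS]Rintegral_mkcond; apply: eq_Rintegral => x _.
  by rewrite /f patchE indicE; case: ifPn; rewrite ?mulr1 ?mulr0.
have f0 n : `|\int[mu]_x f n x| <= 2 * n.+1%:R^-1.
  rewrite fE; have [pn gp] := pP n; have [qn gq] := qP n.
  have n0 : (0 : R) <= n%:R by [].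
  have H : hol_rect F (p_ n) (p_ n + (q_ n - p_ n)) s1 (s1 + (s2 - s1)).
    by move=> x y _ /andP[y1 y2]; apply: hF; split => /=; lra.
  have pq : 0 <= q_ n - p_ n by lra.
  have ss : 0 <= s2 - s1 by lra.
  have := goursat pq ss H; rewrite /bdry !(addrC _ (_ - _)) !subrK.
  move=> /eqP; rewrite addr_eq0 => /eqP E.
  rewrite (E : \int[mu]_(x in `[p_ n, q_ n]) u x = _).
  rewrite normrN -lee_fin.
  have ch x y : s1 <= y <= s2 -> exists D, cderiv F (x +i* y) D.
    by move=> /andP[y1 y2]; apply: hF; split => /=; lra.
  have cI x : cont_on s1 s2 (fun y => complex.Im (F (x +i* y))).
    by move=> y yy; have [D /continuous_Im_y] := ch x y yy.
  have cN x : cont_on s1 s2 (fun y => Normc.normc (F (x +i* y))).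
    move=> y /andP[y1 y2]; apply: (@hol_normc_continuous_y _ F a b) => //.
    by apply/andP; split; lra.
  apply: le_trans (bdry_vertical_le (ltW s12) (cI _) (cI _) (cN _) (cN _)) _.
  by rewrite -!gE mulr_natl mulr2n EFinD leeD// ltW.
have lim0 : \int[mu]_x f n x @[n --> \oo] --> (0 : R).
  apply/cvgr0Pnorm_le => e e0; have e2 : 0 < e / 2 by rewrite divr_gt0.
  have /cvgr0Pnorm_le/(_ (e/2)) : n.+1%:R^-1 @[n --> \oo] --> (0 : R) by exact: cvg_harmonic.
  move=> /(_ e2); apply: filterS => n.
  rewrite ger0_norm// => h; by apply: le_trans (f0 n) _; rewrite mulrC -ler_pdivlMr.
exact: (cvg_unique _ cvf lim0).
Unshelve. all: by end_near. Qed.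

Theorem contour_shift F a b s1 s2 : hol F a b -> L1strip F a b ->
  b < s1 < a -> b < s2 < a ->
  \int[mu]_x complex.Re (F (x +i* s1)) = \int[mu]_x complex.Re (F (x +i* s2)).
Proof.
move=> hF LF /andP[? ?] /andP[? ?].
have [s12|s21|->//] := ltgtP s1 s2; first exact: (contour_shift_lt hF LF).
by apply/esym; exact: (contour_shift_lt hF LF).
Qed.

End ContourShiftTheorem.

(** * Boundary values in weighted L2 *)

Section MidpointConvex.
Context {R : realType}.
Notation mu := (@lebesgue_measure R).
Notation mfun := (measurable_fun [set: R]).
Implicit Types (a b y : R).

(** Each doubling uses the inequality for [y] and [y + 2^(k+1) d], whose midpoint is [y + 2^k d]. *)
Lemma midconvex_doubling (I : R -> R) a b y d : b < y -> 0 < d ->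
  (forall y y', b < y < a -> b < y' < a -> 2 * I ((y + y') / 2) <= I y + I y') ->
  forall k, y + 2 ^+ k * d < a -> 2 ^+ k * (I (y + d) - I y) <= I (y + 2 ^+ k * d) - I y.
Proof.
move=> by0 d0 mid; elim=> [|k IH]; first by rewrite !mul1r.
rewrite exprS -!mulrA => h.
have t0 : 0 < 2 ^+ k * d by rewrite mulr_gt0// exprn_gt0.
have {}IH := IH ltac:(lra).
have yab : b < y < a by apply/andP; split; lra.
have y'ab : b < y + 2 * (2 ^+ k * d) < a by apply/andP; split; lra.
have := mid _ _ yab y'ab.
rewrite (_ : (y + _) / 2 = y + 2 ^+ k * d); last by field.
by move=> ?; lra.
Qed.

(** A steep increase near [b] would double up to the middle of the interval and exceed the bound
    [M]. So increments are at most [C] times the distance, and [I y - C * y] is monotone and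
    bounded. *)
Lemma midconvex_right_limit (I : R -> R) a b M : b < a ->
  (forall y, b < y < a -> 0 <= I y <= M) ->
  (forall y y', b < y < a -> b < y' < a -> 2 * I ((y + y') / 2) <= I y + I y') ->
  cvg (I y @[y --> b^'+]).
Proof.
move=> ba bnd mid; pose r := (a - b) / 2; pose c := (a + b) / 2.
have r0 : 0 < r by rewrite /r; lra.
have lip y y' : b < y -> y <= y' -> y' < c -> I y' - I y <= 2 * M / r * (y' - y).
  move=> y1; rewrite le_eqVlt => /predU1P[->|yy'] y2; first by rewrite !subrr mulr0.
  pose d := y' - y; have d0 : 0 < d by rewrite /d; lra.
  have dr : d < r by rewrite /d /r; rewrite /c in y2; lra.
  (* The minimal such [k] satisfies [2^k d <= r < 2^(k+1) d]: it is the last doubling that stays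
     inside the interval. *)
  have ex : exists k, r < 2 ^+ k.+1 * d.
    exists (Num.bound (r / d)); rewrite -ltr_pdivrMr//.
    rewrite (lt_le_trans (archi_boundP _))//; first by rewrite divr_ge0// ltW.
    by rewrite -natrX ler_nat ltnW// (leq_trans (ltn_expl _ (ltnSn 1)))// leq_exp2l.
  case: (ex_minnP ex) => k kP kmin.
  have kr : 2 ^+ k * d <= r.
    case: k kP kmin => [|k] kP kmin; first by rewrite mul1r ltW.
    by rewrite leNgt; apply/negP => /kmin; rewrite ltnn.
  have ya : y + 2 ^+ k * d < a by rewrite /c /r in y2 kr *; lra.
  have := midconvex_doubling y1 d0 mid ya.
  have /bnd/andP[_ H1] : b < y + 2 ^+ k * d < a.
    by rewrite ya andbT (lt_le_trans y1)// lerDl mulr_ge0// ?exprn_ge0// ltW.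
  have /bnd/andP[H2 _] : b < y < a by apply/andP; split => //; rewrite /c in y2; lra.
  rewrite (_ : y + d = y'); last by rewrite /d; ring.
  move=> H; have H3 : 2 ^+ k * (I y' - I y) <= M by apply: (le_trans H); lra.
  have k0 : (0 : R) < 2 ^+ k by rewrite exprn_gt0.
  have M0 : 0 <= M by apply: le_trans H1; have /bnd/andP[] : b < y + 2 ^+ k * d < a
    by rewrite ya andbT (lt_le_trans y1)// lerDl mulr_ge0// ?exprn_ge0// ltW.
  have H4 : I y' - I y <= (2 ^+ k)^-1 * M by rewrite ler_pdivlMl.
  apply: le_trans H4 _.
  have : (2 ^+ k)^-1 <= 2 * d / r.
    rewrite ler_pdivlMr// ler_pdivrMl//; rewrite exprS in kP; lra.
  move=> /(ler_wpM2r M0) /le_trans; apply; rewrite -/d.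
  by rewrite le_eqVlt; apply/orP; left; apply/eqP; field; rewrite gt_eqF.
pose C := 2 * M / r; pose K y := I y - C * y.
have bc : b < c by rewrite /c; lra.
have ca : c < a by rewrite /c; lra.
have cK : cvg (K y @[y --> b^'+]).
  apply/cvg_ex; eexists; apply: (@nonincreasing_at_right_cvgr _ K b (BLeft c)).
  - by rewrite bnd_simp.
  - move=> y y'. rewrite !in_itv/= => /andP[y1 y2] /andP[y3 y4] yy'.
    by have := lip _ _ y1 yy' y4; rewrite -/C /K; lra.
  - exists (M + `|C| * (`|a| + `|b|)) => z [y /=]; rewrite in_itv/= => /andP[y1 y2] <-.
    have /bnd/andP[_ h] : b < y < a by rewrite y1 (lt_trans y2).
    rewrite /K lerD// -mulrN (le_trans (ler_norm _))// normrM ler_wpM2l// normrN.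
    have := ler_norm a; have := ler_norm (-b); rewrite normrN.
    by have := normr_ge0 a; have := normr_ge0 b; rewrite ler_norml => *; apply/andP; split; lra.
rewrite (_ : I = (fun y => K y + C * y)); last by apply/funext => y; rewrite /K subrK.
apply: is_cvgD => //; apply: is_cvgM; first exact: is_cvg_cst.
by apply/cvg_ex; exists b; exact: cvg_at_right_filter.
Qed.

End MidpointConvex.

(** * The midpoint identity for [L^2] norms on lines *)

Section HardyPairing.
Context {R : realType}.
Notation mu := (@lebesgue_measure R).
Notation mfun := (measurable_fun [set: R]).
Notation nrm := Normc.normc.
Implicit Types (F G : R[i] -> R[i]) (a b y : R).

Definition L2strip G a b := exists M : R, forall y, b < y < a ->
  (\int[mu]_x (nrm (G (x +i* y)) ^+ 2)%:E <= M%:E)%E.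

Definition nrm2 G y : R := \int[mu]_x nrm (G (x +i* y)) ^+ 2.

Lemma normc_sqrB (z w : R[i]) :
  nrm (z - w) ^+ 2 = nrm z ^+ 2 + nrm w ^+ 2 - 2 * complex.Re (z * w^*).
Proof. by rewrite !normc_sqrE; case: z => a b; case: w => c d /=; ring. Qed.

Lemma normc_sqrB_le (z w : R[i]) : nrm (z - w) ^+ 2 <= 2 * (nrm z ^+ 2 + nrm w ^+ 2).
Proof.
have := ler_normcD z (- w); rewrite normcN => h.
have h1 := normc_ge0 z; have h2 := normc_ge0 w; have h3 := normc_ge0 (z - w).
apply: (@le_trans _ _ ((nrm z + nrm w) ^+ 2)); first by rewrite lerXn2r// nnegrE addr_ge0.
by have := sqr_ge0 (nrm z - nrm w); lra.
Qed.

Lemma Re_mul_conj (z : R[i]) : complex.Re (z * z^*) = nrm z ^+ 2.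
Proof. by rewrite normc_sqrE; case: z => a b /=; ring. Qed.

Lemma hol_sub F a b a' b' : hol F a b -> b <= b' -> a' <= a -> hol F a' b'.
Proof.
by move=> hF bb aa z [z1 z2]; apply: hF; split; [exact: le_lt_trans z1|exact: lt_le_trans aa].
Qed.

Lemma holM F G a b : hol F a b -> hol G a b -> hol (fun z => F z * G z) a b.
Proof.
move=> hF hG z zab; have [D1 h1] := hF z zab; have [D2 h2] := hG z zab.
exact: cderivM h1 h2.
Qed.

Lemma hol_bar F a b : hol F a b -> hol (bar_fun F) (- b) (- a).
Proof.
move=> hF z [z1 z2]; have [|D hD] := hF (z^*).
  by case: z z1 z2 => x y /= *; split => /=; lra.
by exists (D^*); exact: cderiv_bar.
Qed.

Lemma hol_shift F a b (c : R) : hol F a b ->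
  hol (fun z => F (z + (0 +i* c))) (a - c) (b - c).
Proof.
move=> hF z [z1 z2]; have [|D hD] := hF (z + (0 +i* c)).
  by case: z z1 z2 => x y /= *; split => /=; lra.
exists (D * 1); apply: (@cderiv_comp _ (fun z => z + (0 +i* c)) F) => //.
by have := cderivD (cderiv_id z) (cderiv_cst (0 +i* c) z); rewrite addr0.
Qed.

Lemma L2strip_integrable G a b y : hol G a b -> L2strip G a b -> b < y < a ->
  mu.-integrable setT (EFin \o (fun x => nrm (G (x +i* y)) ^+ 2)).
Proof.
move=> hG [M MP] yab; apply: nint_integrable.
- by apply: measurable_funX; have [] := hol_line_measurable hG yab.
- by move=> x; exact: sqr_ge0.
- exact: le_lt_trans (MP _ yab) (ltry _).
Qed.

Lemma nrm2E G a b y : hol G a b -> L2strip G a b -> b < y < a ->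
  (\int[mu]_x (nrm (G (x +i* y)) ^+ 2)%:E = (nrm2 G y)%:E)%E.
Proof.
move=> hG LG yab; rewrite /nrm2 fineK//.
exact: (integrable_fin_num measurableT (L2strip_integrable hG LG yab)).
Qed.

(* The function [G z * (G (z^* + i (y + y')))^*] is holomorphic, and equals
   [G_y * G_y'^*] on the line of height [y] and [|G|^2] on the middle line. *)
Lemma pairing_midpoint G a b y y' : hol G a b -> L2strip G a b ->
  b < y < a -> b < y' < a ->
  \int[mu]_x complex.Re (G (x +i* y) * (G (x +i* y'))^*) = nrm2 G ((y + y') / 2).
Proof.
move=> hG LG /andP[y1 y2] /andP[y3 y4]; pose c := y + y'.
pose F z := G z * bar_fun (fun w => G (w + (0 +i* c))) z.
(* The strip of heights [s] for which both [s] and the reflected height [c - s] lie between [b] and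
   [a]. *)
pose a' := Num.min a (c - b); pose b' := Num.max b (c - a).
have a1 : a' <= a by rewrite ge_min lexx.
have a2 : a' <= c - b by rewrite ge_min lexx orbT.
have b1 : b <= b' by rewrite le_max lexx.
have b2 : c - a <= b' by rewrite le_max lexx orbT.
have FE x s : F (x +i* s) = G (x +i* s) * (G (x +i* (c - s)))^*.
  rewrite /F /bar_fun; congr (_ * (G _)^*).
  by apply/eqP; rewrite eq_complex /= addr0 addrC !eqxx.
have hF : hol F a' b'.
  apply: holM; first exact: hol_sub hG _ _.
  have := hol_bar (hol_shift (c := c) hG); rewrite !opprB => H; exact: hol_sub H _ _.
have LF : L1strip F a' b'.
  have [M MP] := LG; exists M => s /andP[s1 s2].
  have sab : b < s < a by apply/andP; split; lra.
  have csab : b < c - s < a by apply/andP; split; lra.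
  have [_ _ m1] := hol_line_measurable hG sab.
  have [_ _ m2] := hol_line_measurable hG csab.
  apply: (@le_trans _ _ (\int[mu]_x (2^-1 * (nrm (G (x +i* s)) ^+ 2)
                    + 2^-1 * (nrm (G (x +i* (c - s))) ^+ 2))%:E)%E).
    apply: le_nint.
    - have sab' : b' < s < a' by apply/andP; split; lra.
      by have [] := hol_line_measurable hF sab'.
    - by apply: measurable_funD; apply: measurable_funM => //; apply: measurable_funX.
    - by move=> x; exact: normc_ge0.
    - move=> x; rewrite FE Normc.normcM normc_conj.
      by have := sqr_ge0 (nrm (G (x +i* s)) - nrm (G (x +i* (c - s)))); lra.
  have h0 (w : R[i]) : 0 <= 2^-1 * nrm w ^+ 2 by rewrite mulr_ge0// ?sqr_ge0// invr_ge0.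
  rewrite nintD//; try by apply: measurable_funM => //; apply: measurable_funX.
  rewrite !nintZ ?invr_ge0//; try by [apply: measurable_funX|move=> x; exact: sqr_ge0].
  rewrite (_ : M = 2^-1 * M + 2^-1 * M); last by field.
  rewrite EFinD !EFinM; apply: leeD; apply: lee_wpmul2l; rewrite ?lee_fin ?invr_ge0//; exact: MP.
have sub s : b < s -> c - a < s -> s < a -> s < c - b -> b' < s < a'.
  by move=> h1 h2 h3 h4; rewrite /a' /b' gt_max lt_min h1 h2 h3 h4.
have yab : b' < y < a' by apply: sub; rewrite /c; lra.
have mab : b' < c / 2 < a' by apply: sub; rewrite /c; lra.
have E1 : \int[mu]_x complex.Re (F (x +i* y)) =
    \int[mu]_x complex.Re (G (x +i* y) * (G (x +i* y'))^*).
  by apply: eq_Rintegral => x _; rewrite FE (_ : c - y = y')// /c; ring.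
rewrite -E1 (contour_shift hF LF yab mab); apply: eq_Rintegral => x _.
by rewrite FE (_ : c - c / 2 = c / 2) ?Re_mul_conj//; field.
Qed.

Lemma dist_midpoint G a b y y' : hol G a b -> L2strip G a b ->
  b < y < a -> b < y' < a ->
  (\int[mu]_x (nrm (G (x +i* y) - G (x +i* y')) ^+ 2)%:E =
   (nrm2 G y + nrm2 G y' - 2 * nrm2 G ((y + y') / 2))%:E)%E.
Proof.
move=> hG LG y1 y2.
have i1 := L2strip_integrable hG LG y1. have i2 := L2strip_integrable hG LG y2.
have [m1 m2 m5] := hol_line_measurable hG y1. have [m3 m4 m6] := hol_line_measurable hG y2.
have mRe : mfun (fun x => complex.Re (G (x +i* y) * (G (x +i* y'))^*)).
  rewrite (_ : (fun _ => _) = (fun x => complex.Re (G (x +i* y)) * complex.Re (G (x +i* y'))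
     + complex.Im (G (x +i* y)) * complex.Im (G (x +i* y')))).
    by apply: measurable_funD; apply: measurable_funM.
  apply/funext => x; case: (G _) => p q; case: (G _) => r s /=; ring.
have i3 : mu.-integrable setT (EFin \o (fun x => complex.Re (G (x +i* y) * (G (x +i* y'))^*))).
  apply: (@integrable_le _ _ (fun x => nrm (G (x +i* y)) ^+ 2 + nrm (G (x +i* y')) ^+ 2)) => //.
    move=> x; apply: le_trans (ler_Re_normc _) _; rewrite Normc.normcM normc_conj.
    by have := sqr_ge0 (nrm (G (x +i* y)) - nrm (G (x +i* y')));
       have := sqr_ge0 (nrm (G (x +i* y))); have := sqr_ge0 (nrm (G (x +i* y'))); lra.
  exact: (integrableD measurableT i1 i2).
have iD := integrableD measurableT i1 i2.
have iZ := integrableZl measurableT 2 i3.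
have iB : mu.-integrable setT (EFin \o (fun x => nrm (G (x +i* y) - G (x +i* y')) ^+ 2)).
  rewrite (_ : _ \o _ = EFin \o (fun x => (nrm (G (x +i* y)) ^+ 2 + nrm (G (x +i* y')) ^+ 2) -
     2 * complex.Re (G (x +i* y) * (G (x +i* y'))^*))).
    exact: (integrableB measurableT iD iZ).
  by apply/funext => x /=; rewrite normc_sqrB.
rewrite -[LHS]fineK; last exact: (integrable_fin_num measurableT iB).
congr EFin; rewrite -(pairing_midpoint hG LG y1 y2) /nrm2.
rewrite -RintegralZl// -RintegralD// -RintegralB//.
by apply: eq_Rintegral => x _; rewrite normc_sqrB.
Qed.

Lemma nrm2_midconvex G a b y y' : hol G a b -> L2strip G a b ->
  b < y < a -> b < y' < a -> 2 * nrm2 G ((y + y') / 2) <= nrm2 G y + nrm2 G y'.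
Proof.
move=> hG LG y1 y2; rewrite -subr_ge0 -lee_fin -(dist_midpoint hG LG y1 y2).
by apply: nint_ge0 => x; exact: sqr_ge0.
Qed.

Lemma nrm2_ge0 G y : 0 <= nrm2 G y.
Proof. by apply: Rintegral_ge0 => x _; exact: sqr_ge0. Qed.

Lemma nrm2_cvg_right G a b : b < a -> hol G a b -> L2strip G a b ->
  cvg (nrm2 G y @[y --> b^'+]).
Proof.
move=> ba hG LG; have [M MP] := LG.
apply: (@midconvex_right_limit _ (nrm2 G) a b M) => //.
  by move=> y yab; rewrite nrm2_ge0/= -lee_fin -(nrm2E hG LG yab) MP.
by move=> y y'; exact: nrm2_midconvex.
Qed.

(** By [dist_midpoint] the squared distance is [I y + I y' - 2 I ((y + y') / 2)]; near the edge all
    three values are within [e / 4] of the limit of [I], and their coefficients have total weight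
    [4]. *)
Lemma hardy_cauchy G a b : b < a -> hol G a b -> L2strip G a b ->
  forall e : R, 0 < e -> exists2 d : R, 0 < d & forall y y', b < y < b + d -> b < y' < b + d ->
    (\int[mu]_x (nrm (G (x +i* y) - G (x +i* y')) ^+ 2)%:E <= e%:E)%E.
Proof.
move=> ba hG LG e e0; have /cvg_ex[l /cvgrPdist_le] := nrm2_cvg_right ba hG LG.
have e4 : 0 < e / 4 by rewrite divr_gt0.
move=> /(_ _ e4)[d /= d0 dP].
exists (Num.min d (a - b)); first by rewrite lt_min d0; lra.
have H y : b < y < b + Num.min d (a - b) -> (b < y < a) /\ `|l - nrm2 G y| <= e / 4.
  move=> /andP[y1]; rewrite -ltrBlDl lt_min => /andP[y2 y3]; split.
    by apply/andP; split => //; lra.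
  by apply: dP => //=; rewrite distrC ger0_norm; lra.
move=> y y' yb yb'.
have [y1 h1] := H _ yb; have [y2 h2] := H _ yb'.
have [] := H ((y + y') / 2).
  by move/andP: yb => [? ?]; move/andP: yb' => [? ?]; apply/andP; split; lra.
move=> _ h3; rewrite (dist_midpoint hG LG y1 y2) lee_fin.
by move: h1 h2 h3; rewrite !ler_norml => /andP[? ?] /andP[? ?] /andP[? ?]; lra.
Qed.

End HardyPairing.

(** * Completeness of [L^2] for families indexed by the height *)

Section L2Complete.
Context {R : realType}.
Notation mu := (@lebesgue_measure R).
Notation mfun := (measurable_fun [set: R]).
Notation nrm := Normc.normc.
Implicit Types (g h : R -> R[i]) (b y : R).

Lemma right_lim0P (N : R -> \bar R) b : (forall y, 0 <= N y)%E ->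
  (N y @[y --> b^'+] --> 0%E) <->
  (forall e : R, 0 < e -> exists2 d : R, 0 < d &
    forall y, b < y < b + d -> (N y <= e%:E)%E).
Proof.
move=> N0; split=> [H e e0|H].
  have /(_ [set x | (x < e%:E)%E])[] := H.
    by exists e => //; move=> r /=; rewrite /ball_/= sub0r normrN lte_fin; exact: le_lt_trans (ler_norm _).
  move=> d /= d0 dP; exists d => // y /andP[y1 y2]; apply/ltW/(dP y) => //=.
  by rewrite distrC ger0_norm; lra.
apply/fine_cvgP; split.
  have [d d0 dP] := H 1 ltr01; exists d => //= y; rewrite /ball_/= => yd y1.
  rewrite ge0_fin_numE//; apply: le_lt_trans (dP y _) (ltry _).
  by move: yd; rewrite distrC ger0_norm; [move=> ?; apply/andP; split; lra|lra].
apply/cvgr0Pnorm_le => e e0; have [d d0 dP] := H e e0.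
exists d => //= y; rewrite /ball_/= => yd y1.
rewrite ger0_norm ?fine_ge0// -lee_fin fineK.
  by apply: dP; move: yd; rewrite distrC ger0_norm; [move=> ?; apply/andP; split; lra|lra].
rewrite ge0_fin_numE//; apply: le_lt_trans (dP y _) (ltry _).
by move: yd; rewrite distrC ger0_norm; [move=> ?; apply/andP; split; lra|lra].
Qed.

Lemma cmeasurable_nrm g : cmeasurable g -> mfun (fun x => nrm (g x)).
Proof.
move=> [m1 m2].
rewrite (_ : (fun _ => _) = (fun x => Num.sqrt (complex.Re (g x) ^+ 2 + complex.Im (g x) ^+ 2))).
  apply: (@measurableT_comp _ _ _ _ _ _ (@Num.sqrt R)).
    by apply: continuous_measurable_fun; exact: sqrt_continuous.
  by apply: measurable_funD; exact: measurable_funX.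
by apply/funext => x; case: (g x).
Qed.

Lemma cmeasurableB g h : cmeasurable g -> cmeasurable h -> cmeasurable (fun x => g x - h x).
Proof.
move=> [m1 m2] [m3 m4]; split.
  rewrite (_ : (fun _ => _) = (fun x => complex.Re (g x) - complex.Re (h x))).
    exact: measurable_funB.
  by apply/funext => x; rewrite raddfB.
rewrite (_ : (fun _ => _) = (fun x => complex.Im (g x) - complex.Im (h x))).
  exact: measurable_funB.
by apply/funext => x; rewrite raddfB.
Qed.

Lemma cmeasurableM g h : cmeasurable g -> cmeasurable h -> cmeasurable (fun x => g x * h x).
Proof.
move=> [m1 m2] [m3 m4]; split.
  rewrite (_ : (fun _ => _) = (fun x => complex.Re (g x) * complex.Re (h x)
     - complex.Im (g x) * complex.Im (h x))).
    by apply: measurable_funB; exact: measurable_funM.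
  by apply/funext => x; case: (g x) => ? ?; case: (h x).
rewrite (_ : (fun _ => _) = (fun x => complex.Re (g x) * complex.Im (h x)
     + complex.Im (g x) * complex.Re (h x))).
  by apply: measurable_funD; exact: measurable_funM.
by apply/funext => x; case: (g x) => ? ?; case: (h x).
Qed.

Lemma cmeasurable_conj g : cmeasurable g -> cmeasurable (fun x => (g x)^*).
Proof.
move=> [m1 m2]; split.
  by rewrite (_ : (fun _ => _) = (fun x => complex.Re (g x)))//; apply/funext => x; case: (g x).
rewrite (_ : (fun _ => _) = (fun x => - complex.Im (g x))); first exact: measurable_funN.
by apply/funext => x; case: (g x).
Qed.

(** The increments are bounded by a multiple of [2^-n], so their series converges absolutely. *)
Lemma cvg_of_fast (x : nat -> R) :
  4 ^+ n * (x n.+1 - x n) ^+ 2 @[n --> \oo] --> (0 : R) -> cvgn x.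
Proof.
move=> H; have /cvg_seq_bounded[C [_ CP]] : cvgn (fun n => 4 ^+ n * (x n.+1 - x n) ^+ 2).
  by apply/cvg_ex; exists 0.
have {CP} := CP (`|C| + 1); rewrite (le_lt_trans (ler_norm _)) ?ltrDl// => /(_ isT) CP.
(* [M >= 1] gives [M <= M^2], so the bound on squares yields the bound [M] after taking roots. *)
pose M : R := `|C| + 1 + 1; have M1 : 1 <= M by rewrite /M lerDr addr_ge0.
have d n : `|x n.+1 - x n| <= geometric M 2^-1 n.
  have M0 : 0 <= M by apply: le_trans M1.
  have A : (2 ^+ n * `|x n.+1 - x n|) ^+ 2 <= M ^+ 2.
    rewrite exprMn real_normK ?num_real// -exprM mulnC exprM.
    rewrite (_ : 2 ^+ 2 = 4); last by ring.
    have := CP n Logic.I; rewrite /= ger0_norm; last by rewrite mulr_ge0 ?sqr_ge0 ?exprn_ge0.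
    move=> /le_trans; apply; apply: (@le_trans _ _ M); first by rewrite /M lerDl.
    by rewrite expr2 ler_peMl.
  have B : 2 ^+ n * `|x n.+1 - x n| <= M.
    by move: A; rewrite ler_pXn2r// nnegrE// mulr_ge0// exprn_ge0.
  by rewrite /= exprVn ler_pdivlMr ?exprn_gt0// mulrC.
have sE n : series (fun k => x k.+1 - x k) n = x n - x 0%N.
  by rewrite /series /= telescope_sumr.
have -> : x = (fun n => x 0%N + series (fun k => x k.+1 - x k) n).
  by apply/funext => n; rewrite sE; ring.
apply: is_cvgD; first exact: is_cvg_cst.
apply: normed_cvg; apply: series_le_cvg d _ => //.
- by move=> n; rewrite /= mulr_ge0 ?exprn_ge0 ?invr_ge0// (le_trans ler01).
- by apply: is_cvg_geometric_series; rewrite ger0_norm ?invr_ge0//; lra.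
Qed.

(** The Riesz-Fischer argument: a rapidly converging sequence of heights gives an a.e. limit, and
    Fatou's lemma carries the Cauchy estimate over to it. *)
Lemma L2_complete (G : R -> R -> R[i]) b (dl : R) : 0 < dl ->
  (forall y, b < y < b + dl -> cmeasurable (G y)) ->
  (forall e : R, 0 < e -> exists2 d : R, 0 < d & forall y y', b < y < b + d -> b < y' < b + d ->
    (\int[mu]_x (nrm (G y x - G y' x) ^+ 2)%:E <= e%:E)%E) ->
  exists g, cmeasurable g /\
   forall e : R, 0 < e -> exists2 d : R, 0 < d & forall y, b < y < b + d ->
    (\int[mu]_x (nrm (G y x - g x) ^+ 2)%:E <= e%:E)%E.
Proof.
move=> dl0 mG cau.
have /choice[dt dtP] (n : nat) : exists d : R, 0 < d /\
    forall y y', b < y < b + d -> b < y' < b + d ->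
    (\int[mu]_x (nrm (G y x - G y' x) ^+ 2)%:E <= (8^-1 ^+ n)%:E)%E.
  by have [|d d0 dP] := cau (8^-1 ^+ n); [rewrite exprn_gt0|exists d].
(* Staying below [dt n] and at least halving puts both [y_ n] and [y_ n.+1] within reach of the
   [n]-th Cauchy estimate, and forces [r n -> 0]. *)
pose r := fix r n : R := if n is n'.+1 then Num.min (r n') (dt n) / 2 else Num.min (dt 0%N) dl / 2.
have r0 n : 0 < r n.
  by elim: n => [|n IH] /=; rewrite divr_gt0// lt_min ?IH// (dtP _).1.
have rdt n : r n < dt n.
  have := (dtP n).1; have := r0 n; case: n => [|n] /= h1 h2.
    have : Num.min (dt 0%N) dl <= dt 0%N by rewrite ge_min lexx.
    by lra.
  have : Num.min (r n) (dt n.+1) <= dt n.+1 by rewrite ge_min lexx orbT.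
  by lra.
have rS n : r n.+1 <= r n / 2 by rewrite /= ler_pM2r// ge_min lexx.
have rle n : r n <= dl * 2^-1 ^+ n.
  elim: n => [|n IH]; last by apply: le_trans (rS n) _; rewrite exprS; lra.
  rewrite /= mulr1; have : Num.min (dt 0%N) dl <= dl by rewrite ge_min lexx orbT.
  by lra.
have rdl n : r n < dl.
  case: n => [|n] /=.
    have : Num.min (dt 0%N) dl <= dl by rewrite ge_min lexx orbT. by lra.
  apply: (le_lt_trans (rS n)); have := rle n; have : 2^-1 ^+ n <= 1 :> R.
    by rewrite exprn_ile1 ?invr_ge0// ?invf_le1//; lra.
  by move=> /(ler_wpM2l (ltW dl0)); lra.
have rsmall (d : R) : 0 < d -> \forall n \near \oo, r n < d.
  move=> d0; have : dl * 2^-1 ^+ n @[n --> \oo] --> (0 : R).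
    by apply: cvg_geometric; rewrite ger0_norm ?invr_ge0//; lra.
  move=> /cvgr0Pnorm_lt/(_ d d0); apply: filterS => n.
  by apply: le_lt_trans; rewrite (le_trans (rle n))// ler_norm.
pose y_ n := b + r n.
have yb n : b < y_ n < b + dt n.
  by have := r0 n; have := rdt n; rewrite /y_ => *; apply/andP; split; lra.
have ybS n : b < y_ n.+1 < b + dt n.
  by have := r0 n.+1; have := r0 n; have := rS n; have := rdt n; rewrite /y_ => *; apply/andP; split; lra.
have my n : cmeasurable (G (y_ n)).
  by apply: mG; have := r0 n; have := rdl n; rewrite /y_ => *; apply/andP; split; lra.
pose Dl n x := nrm (G (y_ n.+1) x - G (y_ n) x) ^+ 2.
have mD n : mfun (Dl n).
  by apply: measurable_funX; apply: cmeasurable_nrm; exact: cmeasurableB.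
(* The rate [8^-n] is chosen so that the factor [4^n] demanded by [cvg_of_fast] still leaves the
   summable [2^-n]. *)
have ae0 : {ae mu, forall x, 4 ^+ n * Dl n x @[n --> \oo] --> (0 : R)}.
  apply: ae_cvg0.
  - by move=> n; apply: measurable_funM => //; exact: measurable_cst.
  - by move=> n x; rewrite mulr_ge0 ?sqr_ge0 ?exprn_ge0.
  - move=> n; rewrite nintZ ?exprn_ge0//; last by move=> x; exact: sqr_ge0.
    apply: (@le_trans _ _ ((4 ^+ n)%:E * (8^-1 ^+ n)%:E)%E).
      by apply: lee_wpmul2l; rewrite ?lee_fin ?exprn_ge0//; apply: (dtP n).2.
    rewrite -EFinM -exprMn lee_fin (_ : 4 * 8^-1 = 2^-1)//.
    by field.
(* An upper limit is defined and measurable everywhere; it is the actual limit where the sequence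
   converges, that is a.e. *)
pose gr x := fine (limn_esup (fun n => (complex.Re (G (y_ n) x))%:E)).
pose gi x := fine (limn_esup (fun n => (complex.Im (G (y_ n) x))%:E)).
pose g x := gr x +i* gi x.
have mg : cmeasurable g.
  split.
    apply: (@measurableT_comp _ _ _ _ _ _ (@fine R)); first exact: fine_measurable.
    by apply: measurable_fun_limn_esup => n; apply/measurable_EFinP; case: (my n).
  apply: (@measurableT_comp _ _ _ _ _ _ (@fine R)); first exact: fine_measurable.
  by apply: measurable_fun_limn_esup => n; apply/measurable_EFinP; case: (my n).
have fineE (u : nat -> R) : cvgn u -> u n @[n --> \oo] --> fine (limn_esup (fun n => (u n)%:E)).
  move=> /cvg_ex[l ul]; have /cvg_EFinP ulE := ul.
  by have [_ ->] := cvg_limn_einf_sup ulE.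
have cvg_g : {ae mu, forall x, nrm (G (y_ n) x - g x) @[n --> \oo] --> (0 : R)}.
  apply: ae_imp ae0 => x H.
  have sq (s : nat -> R) : (forall n, 0 <= s n <= 4 ^+ n * Dl n x) -> s n @[n --> \oo] --> (0 : R).
    move=> hs; apply: (@squeeze_cvgr _ _ _ _ (cst 0) (fun n => 4 ^+ n * Dl n x)) => //.
    - exact: nearW.
    - exact: cvg_cst.
  have cr : cvgn (fun n => complex.Re (G (y_ n) x)).
    apply: cvg_of_fast; apply: sq => n; rewrite mulr_ge0 ?sqr_ge0 ?exprn_ge0//=.
    rewrite ler_wpM2l ?exprn_ge0// /Dl -raddfB normc_sqrE lerDl sqr_ge0//.
  have ci : cvgn (fun n => complex.Im (G (y_ n) x)).
    apply: cvg_of_fast; apply: sq => n; rewrite mulr_ge0 ?sqr_ge0 ?exprn_ge0//=.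
    rewrite ler_wpM2l ?exprn_ge0// /Dl -raddfB normc_sqrE lerDr sqr_ge0//.
  have h1 := fineE _ cr; have h2 := fineE _ ci.
  have h3 : `|complex.Re (G (y_ n) x) - gr x| + `|complex.Im (G (y_ n) x) - gi x|
      @[n --> \oo] --> (0 : R).
    rewrite -[X in _ --> X]addr0 -(@normr0 _ R) -{1}(subrr (gr x)) -(subrr (gi x)).
    apply: cvgD; apply: cvg_norm; apply: cvgB => //; exact: cvg_cst.
  apply: (@squeeze_cvgr _ _ _ _ (cst 0) _ _ _ _ _ h3); last exact: cvg_cst.
  apply: nearW => n; rewrite normc_ge0/=.
  by apply: le_trans (ler_normc_ReIm _) _; rewrite !raddfB.
exists g; split => // e e0; have [d d0 dP] := cau _ e0.
exists (Num.min d dl); first by rewrite lt_min d0.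
move=> y /andP[y1 y2].
have y3 : y < b + d by apply: lt_le_trans y2 _; rewrite lerD2l ge_min lexx.
have y4 : y < b + dl by apply: lt_le_trans y2 _; rewrite lerD2l ge_min lexx orbT.
have myy : cmeasurable (G y) by apply: mG; rewrite y1.
apply: (@fatou_ae _ (fun n x => nrm (G y x - G (y_ n) x) ^+ 2)).
- by move=> n; apply: measurable_funX; apply: cmeasurable_nrm; exact: cmeasurableB.
- by apply: measurable_funX; apply: cmeasurable_nrm; exact: cmeasurableB.
- by move=> n x; exact: sqr_ge0.
- by move=> x; exact: sqr_ge0.
- apply: ae_imp cvg_g => x H; rewrite expr2; under eq_fun do rewrite expr2.
  suff S : nrm (G y x - G (y_ n) x) @[n --> \oo] --> nrm (G y x - g x) by exact: cvgM.
  apply/cvgrPdist_le => e' e'0; move/cvgr0Pnorm_le: H => /(_ _ e'0); apply: filterS => n.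
  rewrite ger0_norm ?normc_ge0//; apply: le_trans.
  apply: le_trans (ler_dist_normc _ _) _.
  by rewrite (_ : _ - _ - _ = G (y_ n) x - g x)//; ring.
- move: (rsmall _ d0); apply: filterS => n rn; apply: dP; first by rewrite y1.
  by have := r0 n; rewrite /y_ => *; apply/andP; split; lra.
Qed.

End L2Complete.

(** * Uniqueness of boundary values and the Gaussian multiplier *)

Section BoundaryValues.
Context {R : realType}.
Notation mu := (@lebesgue_measure R).
Notation mfun := (measurable_fun [set: R]).
Notation nrm := Normc.normc.
Implicit Types (h : R[i] -> R[i]) (g : R -> R[i]) (a b y eps gamma : R).

Definition rlim0 (N : R -> \bar R) b := forall e : R, 0 < e ->
  exists2 d : R, 0 < d & forall y, b < y < b + d -> (N y <= e%:E)%E.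

Lemma rlim0P (N : R -> \bar R) b : (forall y, 0 <= N y)%E ->
  (N y @[y --> b^'+] --> 0%E) <-> rlim0 N b.
Proof. exact: right_lim0P. Qed.

Lemma rlim0_seq (N : R -> \bar R) b a : b < a -> rlim0 N b ->
  exists y_ : nat -> R, [/\ forall n, b < y_ n < a, y_ n @[n --> \oo] --> b &
    forall n, (N (y_ n) <= (2^-1 ^+ n)%:E)%E].
Proof.
move=> ba NP.
have /choice[y_ yP] (n : nat) : exists y : R, [/\ b < y < a, y - b <= n.+1%:R^-1 &
    (N y <= (2^-1 ^+ n)%:E)%E].
  have e0 : (0 : R) < 2^-1 ^+ n by rewrite exprn_gt0// invr_gt0.
  have [d d0 dP] := NP _ e0.
  have : (0 : R) < n.+1%:R^-1 by rewrite invr_gt0.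
  move: (n.+1%:R^-1) => t t0; pose m := Num.min (Num.min d (a - b)) t.
  have m0 : 0 < m by rewrite !lt_min d0 t0 andbT subr_gt0.
  have m1 : m <= d by rewrite /m !ge_min lexx.
  have m2 : m <= a - b by rewrite /m !ge_min lexx orbT.
  have m3 : m <= t by rewrite /m !ge_min lexx orbT.
  exists (b + m / 2); split; first by apply/andP; split; lra.
    by lra.
  by apply: dP; apply/andP; split; lra.
exists y_; split; [by move=> n; have [] := yP n| |by move=> n; have [] := yP n].
apply: (@squeeze_cvgr _ _ _ _ (cst b) (fun n => b + n.+1%:R^-1)).
- apply: nearW => n; have [/andP[h1 h2] h3 _] := yP n; apply/andP; split; first exact: ltW.
  by rewrite addrC -lerBlDr.
- exact: cvg_cst.
- rewrite -[X in _ --> X]addr0; apply: cvgD; [exact: cvg_cst|exact: cvg_harmonic].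
Qed.

Lemma nint_eq0_ae (f : R -> R) : mfun f -> (forall x, 0 <= f x) ->
  (\int[mu]_x (f x)%:E <= 0)%E -> {ae mu, forall x, f x = 0}.
Proof.
move=> mf f0 If.
have E : (\int[mu]_x `|(EFin \o f) x| = 0)%E.
  apply/eqP; rewrite eq_le; apply/andP; split; last by apply: integral_ge0.
  by under eq_integral do rewrite /= ger0_norm//.
have mE : measurable_fun [set: R] (EFin \o f) by exact/measurable_EFinP.
have [H _] := @ae_eq_integral_abs _ _ _ mu setT measurableT (EFin \o f) mE.
by apply: ae_imp (H E) => x /(_ Logic.I) /= [].
Qed.

Lemma on_line_cmeasurable h a b y : hol h a b -> b < y < a -> cmeasurable (on_line h y).
Proof. by move=> hh yab; have [m1 m2 _] := hol_line_measurable hh yab. Qed.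

Lemma gauss_weight_ge0 gamma (z : R[i]) (x : R) : 0 <= nrm z ^+ 2 * expR (- (2 * gamma * x ^+ 2)).
Proof. by rewrite mulr_ge0 ?sqr_ge0 ?expR_ge0. Qed.

Lemma gauss_norm2_ge0 gamma g : (0 <= gauss_norm2 gamma g)%E.
Proof. by apply: nint_ge0 => x; exact: gauss_weight_ge0. Qed.

Lemma gauss_measurable gamma : mfun (fun x => expR (- (2 * gamma * x ^+ 2))).
Proof.
apply: (@measurableT_comp _ _ _ _ _ _ (@expR R)); first exact: measurable_expR.
by apply: measurable_funN; apply: measurable_funM => //; exact: measurable_funX.
Qed.

Lemma gauss_integrand_measurable gamma g : cmeasurable g ->
  mfun (fun x => nrm (g x) ^+ 2 * expR (- (2 * gamma * x ^+ 2))).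
Proof.
move=> mg; apply: measurable_funM; last exact: gauss_measurable.
by apply: measurable_funX; exact: cmeasurable_nrm.
Qed.

Lemma gauss_norm2_mono gamma gamma' g : cmeasurable g -> gamma <= gamma' ->
  (gauss_norm2 gamma' g <= gauss_norm2 gamma g)%E.
Proof.
move=> mg gg; apply: le_nint; try exact: gauss_integrand_measurable.
  by move=> x; exact: gauss_weight_ge0.
move=> x; rewrite ler_wpM2l ?sqr_ge0// ler_expR lerN2 ler_wpM2r ?sqr_ge0//; lra.
Qed.

Lemma gauss_norm2_triangle gamma g1 g2 : cmeasurable g1 -> cmeasurable g2 ->
  (gauss_norm2 gamma (fun x => g1 x - g2 x)%R <=
   2%:E * (gauss_norm2 gamma g1 + gauss_norm2 gamma g2))%E.
Proof.
move=> m1 m2; have i1 := gauss_integrand_measurable gamma m1.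
have i2 := gauss_integrand_measurable gamma m2.
rewrite /gauss_norm2 -nintD//; try by move=> x; exact: gauss_weight_ge0.
rewrite -nintZ//; first last.
- by move=> x; apply: addr_ge0; exact: gauss_weight_ge0.
- exact: measurable_funD.
apply: le_nint; first exact: (gauss_integrand_measurable _ (cmeasurableB m1 m2)).
- by apply: measurable_funM; [exact: measurable_cst|exact: measurable_funD].
- by move=> x; exact: gauss_weight_ge0.
- by move=> x; rewrite -mulrDl mulrA ler_wpM2r ?expR_ge0// normc_sqrB_le.
Qed.

Lemma gauss_norm2_ae gamma g1 g2 : cmeasurable g1 -> cmeasurable g2 ->
  {ae mu, forall x, nrm (g1 x) = nrm (g2 x)} -> gauss_norm2 gamma g1 = gauss_norm2 gamma g2.
Proof.
move=> m1 m2 E; apply: ge0_ae_eq_integral => //.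
- by apply/measurable_EFinP; exact: gauss_integrand_measurable.
- by apply/measurable_EFinP; exact: gauss_integrand_measurable.
- by move=> x _; rewrite lee_fin gauss_weight_ge0.
- by move=> x _; rewrite lee_fin gauss_weight_ge0.
- by apply: ae_imp E => x -> _.
Qed.

Lemma gauss_norm2_eq0 gamma g : cmeasurable g -> (gauss_norm2 gamma g <= 0)%E ->
  {ae mu, forall x, g x = 0}.
Proof.
move=> mg g0; have := @nint_eq0_ae _ (gauss_integrand_measurable gamma mg) _ g0.
move=> /(_ (fun x => gauss_weight_ge0 _ _ _)); apply: ae_imp => x /eqP.
by rewrite mulf_eq0 (gt_eqF (expR_gt0 _)) orbF sqrf_eq0 normc_eq0 => /eqP.
Qed.

Definition rconv gamma h b g := rlim0 (fun y => gauss_norm2 gamma (fun x => on_line h y x - g x)) b.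

Lemma is_lower_valueP eps h b g : is_lower_value eps h b g <->
  cmeasurable g /\ forall gamma, eps < gamma -> rconv gamma h b g.
Proof.
split=> -[mg H]; split => // gamma /H; first by move/rlim0P; apply=> y; exact: gauss_norm2_ge0.
by move=> ?; apply/rlim0P => // y; exact: gauss_norm2_ge0.
Qed.

Lemma rconv_unique gamma h a b g1 g2 : b < a -> hol h a b ->
  cmeasurable g1 -> cmeasurable g2 -> rconv gamma h b g1 -> rconv gamma h b g2 ->
  {ae mu, forall x, g1 x = g2 x}.
Proof.
move=> ba hh m1 m2 H1 H2.
have m12 := cmeasurableB m1 m2.
suff : {ae mu, forall x, g1 x - g2 x = 0} by apply: ae_imp => x /eqP; rewrite subr_eq0 => /eqP.
apply: (gauss_norm2_eq0 (gamma := gamma)) => //.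
apply/lee_addgt0Pr => e e0; rewrite add0e.
have e4 : 0 < e / 4 by rewrite divr_gt0.
have [d1 d10 dP1] := H1 _ e4; have [d2 d20 dP2] := H2 _ e4.
pose m := Num.min (Num.min d1 d2) (a - b).
have m0 : 0 < m by rewrite !lt_min d10 d20; lra.
have m_1 : m <= d1 by rewrite /m !ge_min lexx.
have m_2 : m <= d2 by rewrite /m !ge_min lexx orbT.
have m_3 : m <= a - b by rewrite /m !ge_min lexx orbT.
pose y := b + m / 2.
have yab : b < y < a by rewrite /y; apply/andP; split; lra.
have my := on_line_cmeasurable hh yab.
have E1 : (gauss_norm2 gamma (fun x => on_line h y x - g1 x)%R <= (e / 4)%:E)%E.
  by apply: dP1; rewrite /y; apply/andP; split; lra.
have E2 : (gauss_norm2 gamma (fun x => on_line h y x - g2 x)%R <= (e / 4)%:E)%E.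
  by apply: dP2; rewrite /y; apply/andP; split; lra.
rewrite (_ : (fun x => g1 x - g2 x) =
   (fun x => (on_line h y x - g2 x) - (on_line h y x - g1 x))); last first.
  by apply/funext => x; ring.
apply: le_trans (gauss_norm2_triangle _ (cmeasurableB my m2) (cmeasurableB my m1)) _.
apply: (@le_trans _ _ (2%:E * ((e / 4)%:E + (e / 4)%:E))%E).
  by apply: lee_wpmul2l => //; exact: leeD.
by rewrite -EFinD -EFinM lee_fin; lra.
Qed.

(** The entire function [exp (- c z^2)]. On the line of height [y] the square of its modulus is
    [exp (2 c y^2)] times the weight [exp (- 2 c x^2)], so it turns weighted norms into plain [L^2]
    norms of a holomorphic function. *)
Definition gmul (c : R) (z : R[i]) : R[i] := cexp (- c%:C * z ^+ 2).

Lemma cderiv_gmul c z : exists D, cderiv (gmul c) z D.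
Proof.
have h1 := cderivZ (- c%:C) (cderiv_sqr z).
by eexists; exact: (cderiv_comp h1 (cderiv_cexp _)).
Qed.

Lemma normc_gmul c (x y : R) : nrm (gmul c (x +i* y)) = expR (- (c * (x ^+ 2 - y ^+ 2))).
Proof. by rewrite normc_cexp /=; congr expR; ring. Qed.

Lemma gmulN c z : gmul c z * gmul (- c) z = 1.
Proof. by rewrite -cexpD rmorphN opprK -mulrDl addNr mul0r cexp0. Qed.

Lemma sqr_expR (x : R) : expR x ^+ 2 = expR (2 * x).
Proof. by rewrite -expRM_natl. Qed.

Lemma Hclass_hol a b eps h : Hclass a b eps h -> hol h a b.
Proof. by move=> [/holomorphic_cderivP hh _] z zab; exact: hh. Qed.

Lemma Hclass_bound a b eps h gamma : b < a -> Hclass a b eps h -> eps < gamma ->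
  exists2 M : R, 0 <= M & forall y, b < y < a -> (gauss_norm2 gamma (on_line h y) <= M%:E)%E.
Proof.
move=> ba [_ /[apply]]; set S := ereal_sup _ => Soo.
have Sub y : b < y < a -> (gauss_norm2 gamma (on_line h y) <= S)%E.
  by move=> yab; apply: ereal_sup_ubound; exists y => //=; rewrite in_itv.
have S0 : (0 <= S)%E.
  apply: le_trans (gauss_norm2_ge0 gamma (on_line h ((a + b) / 2))) (Sub _ _).
  by apply/andP; split; lra.
exists (fine S); first exact: fine_ge0.
by move=> y /Sub; rewrite fineK// ge0_fin_numE.
Qed.

Lemma Hclass_intro a b eps h : hol h a b ->
  (forall gamma, eps < gamma ->
    exists M : R, forall y, b < y < a -> (gauss_norm2 gamma (on_line h y) <= M%:E)%E) ->
  Hclass a b eps h.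
Proof.
move=> hh H; split; first by apply/holomorphic_cderivP.
move=> gamma /H[M MP]; apply: (@le_lt_trans _ _ M%:E); last exact: ltry.
by apply: ge_ereal_sup => z [y /=]; rewrite in_itv/= => /MP ? <-.
Qed.

Lemma gmul_L2strip a b eps h gamma : b < a -> Hclass a b eps h -> eps < gamma -> 0 <= gamma ->
  L2strip (fun z => h z * gmul gamma z) a b.
Proof.
move=> ba hH eg g0; have [M M0 MP] := Hclass_bound ba hH eg.
have hh := Hclass_hol hH.
pose B := Num.max `|a| `|b|; exists (expR (2 * gamma * B ^+ 2) * M) => y yab.
have yB : y ^+ 2 <= B ^+ 2.
  have B0 : 0 <= B by rewrite /B le_max normr_ge0.
  rewrite -real_normK ?num_real// lerXn2r// ?nnegrE//.
  move/andP: yab => [y1 y2]; rewrite ler_norml.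
  have := ler_norm a; have := ler_norm (- b); rewrite normrN.
  have : `|a| <= B by rewrite /B le_max lexx.
  have : `|b| <= B by rewrite /B le_max lexx orbT.
  by move=> *; apply/andP; split; lra.
rewrite EFinM; apply: le_trans (lee_wpmul2l _ (MP _ yab)); last by rewrite lee_fin expR_ge0.
have my := on_line_cmeasurable hh yab.
have mi := gauss_integrand_measurable gamma my.
rewrite /gauss_norm2 -nintZ//; last by move=> x; exact: gauss_weight_ge0.
have E x : nrm (h (x +i* y) * gmul gamma (x +i* y)) ^+ 2 =
   expR (2 * gamma * y ^+ 2) * (nrm (h (x +i* y)) ^+ 2 * expR (- (2 * gamma * x ^+ 2))).
  rewrite Normc.normcM exprMn normc_gmul sqr_expR mulrCA -expRD.
  by congr (_ * expR _); ring.
under eq_integral do rewrite E.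
apply: le_nint.
- by apply: measurable_funM; [exact: measurable_cst|exact: mi].
- by apply: measurable_funM; [exact: measurable_cst|exact: mi].
- by move=> x; rewrite mulr_ge0 ?expR_ge0// gauss_weight_ge0.
- move=> x; rewrite ler_wpM2r ?gauss_weight_ge0// ler_expR ler_wpM2l//.
  by rewrite mulr_ge0.
Qed.

End BoundaryValues.

(** * Existence of boundary values *)

Section BoundaryExistence.
Context {R : realType}.
Notation mu := (@lebesgue_measure R).
Notation mfun := (measurable_fun [set: R]).
Notation nrm := Normc.normc.
Implicit Types (h : R[i] -> R[i]) (g : R -> R[i]) (a b y eps gamma : R).

Lemma seq_cvgM (u v : nat -> R) (l m : R) : u n @[n --> \oo] --> l ->
  v n @[n --> \oo] --> m -> u n * v n @[n --> \oo] --> l * m.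
Proof. exact: cvgM. Qed.

Lemma seq_cvg_cst (l : R) : (fun=> l) n @[n --> \oo] --> l.
Proof. exact: cvg_cst. Qed.

(** If [G = h * gmul gamma], then [h] times [exp (- gamma x^2)] equals [G] times this factor on the
    line of height [y]. Its modulus does not depend on [x]. *)
Let phase gamma y x : R[i] := gmul (- gamma) (x +i* y) * (expR (- (gamma * x ^+ 2)))%:C.

Let normc_phase gamma y x : nrm (phase gamma y x) = expR (- (gamma * y ^+ 2)).
Proof.
rewrite Normc.normcM normc_gmul normcR ger0_norm ?expR_ge0// -expRD.
by congr expR; ring.
Qed.

Let phase_cmeasurable gamma y : cmeasurable (phase gamma y).
Proof.
have hol_e : hol (fun z => gmul (- gamma) z) (y + 1) (y - 1).
  by move=> z _; exact: cderiv_gmul.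
have yy : y - 1 < y < y + 1 by apply/andP; split; lra.
apply: cmeasurableM; first exact: (on_line_cmeasurable hol_e yy).
have mg : mfun (fun x => expR (- (gamma * x ^+ 2))).
  apply: (@measurableT_comp _ _ _ _ _ _ (@expR R)); first exact: measurable_expR.
  by apply: measurable_funN; apply: measurable_funM => //; exact: measurable_funX.
by split => /=; [exact: mg|exact: measurable_cst].
Qed.

Let phase_cvg gamma b x (u : nat -> R) : u n @[n --> \oo] --> b ->
  nrm (phase gamma (u n) x - phase gamma b x) @[n --> \oo] --> (0 : R).
Proof.
move=> ub; have [D hD] := cderiv_gmul (- gamma) (x +i* b).
apply/cvgrPdist_le => e e0.
have c0 : 0 < expR (- (gamma * x ^+ 2)) by exact: expR_gt0.
have [|d d0 dP] := cderiv_continuous_ReIm hD (e := e / expR (- (gamma * x ^+ 2))).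
  by rewrite divr_gt0.
move/cvgrPdist_lt: ub => /(_ d d0); apply: filterS => n bu.
rewrite sub0r normrN ger0_norm ?normc_ge0// /phase -mulrBl Normc.normcM normcR (ger0_norm (ltW c0)).
rewrite -ler_pdivlMr//; apply: dP.
rewrite (_ : _ - _ = 0 +i* (u n - b)); last by apply/eqP; rewrite eq_complex/= subrr !eqxx.
by rewrite normc_imag distrC.
Qed.

(** Dominated convergence: both factors have modulus at most one, so the integrand is at most
    [4 |g|^2], and it tends to zero pointwise. *)
Let phase_limit gamma b g : 0 <= gamma -> cmeasurable g ->
  mu.-integrable setT (EFin \o (fun x => nrm (g x) ^+ 2)) ->
  rlim0 (fun y => \int[mu]_x (nrm (g x) ^+ 2 * nrm (phase gamma y x - phase gamma b x) ^+ 2)%:E)%E b.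
Proof.
move=> g0 mg ig.
pose f y x := nrm (g x) ^+ 2 * nrm (phase gamma y x - phase gamma b x) ^+ 2.
have mf y : mfun (f y).
  apply: measurable_funM; apply: measurable_funX; apply: cmeasurable_nrm => //.
  by apply: cmeasurableB; exact: phase_cmeasurable.
have f0 y x : 0 <= f y x by rewrite mulr_ge0// sqr_ge0.
have ph1 y x : nrm (phase gamma y x) <= 1.
  by rewrite normc_phase -expR0 ler_expR oppr_le0 mulr_ge0// sqr_ge0.
have fle y x : `|f y x| <= 4 * nrm (g x) ^+ 2.
  rewrite ger0_norm// /f mulrC ler_wpM2r ?sqr_ge0//.
  apply: le_trans (normc_sqrB_le _ _) _.
  have := ph1 y x; have := ph1 b x; have := normc_ge0 (phase gamma y x).
  have := normc_ge0 (phase gamma b x) => h1 h2 h3 h4.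
  have := exprn_ile1 2 h2 h4; have := exprn_ile1 2 h1 h3; lra.
have ig4 : mu.-integrable setT (EFin \o (fun x => 4 * nrm (g x) ^+ 2)).
  exact: (integrableZl measurableT 4 ig).
have If y : (\int[mu]_x (f y x)%:E = (\int[mu]_x f y x)%:E)%E.
  rewrite /Rintegral fineK//; apply: (integrable_fin_num measurableT).
  exact: (integrable_le (mf y) (fle y) ig4).
have lim : \int[mu]_x f y x @[y --> b^'+] --> (0 : R).
  apply/cvg_at_rightP => u [_ ub].
  rewrite -[X in _ --> X](_ : \int[mu]_x (cst 0 x) = 0); last first.
    by rewrite /Rintegral integral0.
  apply: (Rint_dominated _ _ _ ig4) => //.
  apply: ae_every => x; rewrite /f; have C := phase_cvg gamma x ub.
  have := @seq_cvgM _ _ _ _ (@seq_cvg_cst (nrm (g x) ^+ 2)) (@seq_cvgM _ _ _ _ C C).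
  rewrite !mulr0.
  by under eq_fun do rewrite -expr2.
move=> e e0; move/cvgr0Pnorm_le: lim => /(_ e e0)[d /= d0 dP].
exists d => // y /andP[y1 y2]; rewrite [leLHS]If lee_fin.
apply: le_trans (ler_norm _) _; apply: dP => //=.
by rewrite distrC ger0_norm; lra.
Qed.

(** The function [h * gmul gamma] has an [L^2] limit [g] by the Cauchy property; dividing [g] by the
    multiplier on the edge gives the boundary value of [h]. *)
Lemma rconv_exists a b eps h gamma : b < a -> Hclass a b eps h -> eps < gamma -> 0 <= gamma ->
  exists2 g, cmeasurable g & rconv gamma h b g.
Proof.
move=> ba hH eg g0; have hh := Hclass_hol hH.
pose G z := h z * gmul gamma z.
have hG : hol G a b by apply: holM => // z _; exact: cderiv_gmul.
have LG : L2strip G a b by exact: (gmul_L2strip ba hH eg g0).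
have ab0 : 0 < a - b by lra.
have mG y : b < y < b + (a - b) -> cmeasurable (fun x => G (x +i* y)).
  by rewrite (_ : b + _ = a); [exact: (on_line_cmeasurable hG)|ring].
have [g [mg gP]] := L2_complete ab0 mG (hardy_cauchy ba hG LG).
have ig : mu.-integrable setT (EFin \o (fun x => nrm (g x) ^+ 2)).
  have [d d0 dP] := gP 1 ltr01; pose m := Num.min d (a - b).
  have m0 : 0 < m by rewrite lt_min d0.
  have m1 : m <= d by rewrite ge_min lexx.
  have m2 : m <= a - b by rewrite ge_min lexx orbT.
  pose y := b + m / 2.
  have y1 : b < y < b + d by rewrite /y; apply/andP; split; lra.
  have yab : b < y < a by rewrite /y; apply/andP; split; lra.
  have my := on_line_cmeasurable hG yab.
  have mgy := cmeasurableB my mg.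
  apply: (@integrable_le _ _ (fun x => 2 * (nrm (on_line G y x) ^+ 2 +
      nrm (on_line G y x - g x) ^+ 2))).
  - by apply: measurable_funX; exact: cmeasurable_nrm.
  - move=> x; rewrite ger0_norm ?sqr_ge0//.
    have := normc_sqrB_le (on_line G y x) (on_line G y x - g x).
    by rewrite (_ : _ - (_ - _) = g x)//; ring.
  have i1 := L2strip_integrable hG LG yab.
  have i2 : mu.-integrable setT (EFin \o (fun x => nrm (on_line G y x - g x) ^+ 2)).
    apply: nint_integrable.
    - by apply: measurable_funX; exact: cmeasurable_nrm.
    - by move=> x; exact: sqr_ge0.
    - exact: le_lt_trans (dP y y1) (ltry _).
  exact: (integrableZl measurableT 2 (integrableD measurableT i1 i2)).
exists (fun x => g x * gmul (- gamma) (x +i* b)).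
  apply: cmeasurableM => //.
  have hol_e : hol (fun z => gmul (- gamma) z) (b + 1) (b - 1).
    by move=> z _; exact: cderiv_gmul.
  by apply: (on_line_cmeasurable hol_e); apply/andP; split; lra.
move=> e e0; have e4 : 0 < e / 4 by rewrite divr_gt0.
have [d1 d10 dP1] := gP _ e4; have [d2 d20 dP2] := @phase_limit gamma b g g0 mg ig _ e4.
exists (Num.min (Num.min d1 d2) (a - b)); first by rewrite !lt_min d10 d20.
move=> y /andP[y1]; rewrite -ltrBlDl !lt_min => /andP[/andP[y2 y3] y4].
have yb1 : b < y < b + d1 by apply/andP; split; lra.
have yb2 : b < y < b + d2 by apply/andP; split; lra.
have yab : b < y < a by apply/andP; split; lra.
have my := on_line_cmeasurable hG yab.
have E x : on_line h y x = on_line G y x * gmul (- gamma) (x +i* y).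
  by rewrite /on_line /G -mulrA gmulN mulr1.
have ph1 x : nrm (phase gamma y x) <= 1.
  by rewrite normc_phase -expR0 ler_expR oppr_le0 mulr_ge0// sqr_ge0.
have le x : nrm (on_line h y x - g x * gmul (- gamma) (x +i* b)) ^+ 2 *
    expR (- (2 * gamma * x ^+ 2)) <=
  2 * (nrm (on_line G y x - g x) ^+ 2 + nrm (g x) ^+ 2 * nrm (phase gamma y x - phase gamma b x) ^+ 2).
  have -> : expR (- (2 * gamma * x ^+ 2)) = nrm ((expR (- (gamma * x ^+ 2)))%:C) ^+ 2.
    by rewrite normcR ger0_norm ?expR_ge0// sqr_expR; congr expR; ring.
  rewrite -exprMn -Normc.normcM E.
  (* The error splits into the [L^2] distance of [G] from [g] and the change of the phase factor
     applied to the fixed function [g]. *)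
  rewrite (_ : (_ - _) * _ = (on_line G y x - g x) * phase gamma y x
      - (- (g x * (phase gamma y x - phase gamma b x)))); last by rewrite /phase; ring.
  apply: le_trans (normc_sqrB_le _ _) _; rewrite normcN.
  rewrite (Normc.normcM (on_line G y x - g x)) (Normc.normcM (g x)) !exprMn.
  rewrite ler_pM2l// lerD2r -[leRHS]mulr1 ler_wpM2l ?sqr_ge0// exprn_ile1// normc_ge0//.
have mphase : mfun (fun x => nrm (g x) ^+ 2 * nrm (phase gamma y x - phase gamma b x) ^+ 2).
  apply: measurable_funM; apply: measurable_funX; apply: cmeasurable_nrm => //.
  by apply: cmeasurableB; exact: phase_cmeasurable.
have mdiff : mfun (fun x => nrm (on_line G y x - g x) ^+ 2).
  by apply: measurable_funX; apply: cmeasurable_nrm; exact: cmeasurableB.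
have mgm : cmeasurable (fun x => on_line h y x - g x * gmul (- gamma) (x +i* b)).
  apply: cmeasurableB; first exact: (on_line_cmeasurable hh yab).
  apply: cmeasurableM => //.
  have hol_e : hol (fun z => gmul (- gamma) z) (b + 1) (b - 1).
    by move=> z _; exact: cderiv_gmul.
  by apply: (on_line_cmeasurable hol_e); apply/andP; split; lra.
apply: le_trans (le_nint (gauss_integrand_measurable gamma mgm) _ _ le) _.
- by apply: measurable_funM; [exact: measurable_cst|exact: measurable_funD].
- by move=> x; exact: gauss_weight_ge0.
rewrite nintZ//; last 2 first.
- exact: measurable_funD.
- by move=> x; apply: addr_ge0; [exact: sqr_ge0|rewrite mulr_ge0 ?sqr_ge0].
rewrite nintD//; last 2 first.
- by move=> x; exact: sqr_ge0.
- by move=> x; rewrite mulr_ge0 ?sqr_ge0.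
apply: (@le_trans _ _ (2%:E * ((e / 4)%:E + (e / 4)%:E))%E).
  by apply: lee_wpmul2l => //; apply: leeD; [exact: dP1|exact: dP2].
by rewrite -EFinD -EFinM lee_fin; lra.
Qed.

(** One function has to serve all [gamma > eps]. Convergence for some [gamma] implies it for every
    larger one; for [gamma] below [eps + 1] the limit agrees a.e. with that for [eps + 1] by
    uniqueness. *)
Theorem lower_value_exists a b eps h : 0 <= eps -> b < a -> Hclass a b eps h ->
  exists g, is_lower_value eps h b g.
Proof.
move=> eps0 ba hH; have hh := Hclass_hol hH.
have ex gamma : eps < gamma -> exists2 g, cmeasurable g & rconv gamma h b g.
  by move=> eg; apply: (rconv_exists ba hH eg); lra.
have mono gamma gamma' g : cmeasurable g -> gamma <= gamma' -> rconv gamma h b g -> rconv gamma' h b g.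
  move=> mg gg H e /H[d d0 dP]; exists (Num.min d (a - b)); first by rewrite lt_min d0; lra.
  move=> y /andP[y1]; rewrite -ltrBlDl lt_min => /andP[y2 y3].
  have yab : b < y < a by apply/andP; split; lra.
  apply: le_trans (gauss_norm2_mono _ gg) (dP y _).
    by apply: cmeasurableB => //; exact: (on_line_cmeasurable hh yab).
  by apply/andP; split; lra.
have [|g mg gP] := ex (eps + 1); first lra.
exists g; apply/is_lower_valueP; split => // gamma eg.
have [gg|gg] := leP (eps + 1) gamma; first exact: mono gP.
have [g' mg' gP'] := ex _ eg.
have E := rconv_unique ba hh mg' mg (mono _ _ _ mg' (ltW gg) gP') gP.
move=> e /gP'[d d0 dP]; exists (Num.min d (a - b)); first by rewrite lt_min d0; lra.
move=> y /andP[y1]; rewrite -ltrBlDl lt_min => /andP[y2 y3].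
have yab : b < y < a by apply/andP; split; lra.
have my := on_line_cmeasurable hh yab.
rewrite (@gauss_norm2_ae _ _ _ (fun x => on_line h y x - g' x)).
- by apply: dP; apply/andP; split; lra.
- exact: cmeasurableB.
- exact: cmeasurableB.
- by apply: ae_imp E => x ->.
Qed.

Lemma lower_valueP a b eps h : 0 <= eps -> b < a -> Hclass a b eps h ->
  is_lower_value eps h b (lower_value eps h b).
Proof. by move=> e0 ba /(lower_value_exists e0 ba)[g gP]; apply: xgetPex; exists g. Qed.

Lemma is_lower_value_unique a b eps h g1 g2 : b < a -> hol h a b ->
  is_lower_value eps h b g1 -> is_lower_value eps h b g2 -> {ae mu, forall x, g1 x = g2 x}.
Proof.
move=> ba hh /is_lower_valueP[m1 H1] /is_lower_valueP[m2 H2].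
by apply: (rconv_unique ba hh m1 m2 (H1 (eps + 1) _) (H2 (eps + 1) _)); lra.
Qed.

Lemma gauss_norm2_conj gamma g : gauss_norm2 gamma (fun x => (g x)^*) = gauss_norm2 gamma g.
Proof. by apply: eq_integral => x _; rewrite normc_conj. Qed.

Lemma Hclass_bar a b eps h : b < a -> Hclass a b eps h -> Hclass (- b) (- a) eps (bar_fun h).
Proof.
move=> ba hH; apply: Hclass_intro; first exact: hol_bar (Hclass_hol hH).
move=> gamma eg; have [M M0 MP] := Hclass_bound ba hH eg.
exists M => y /andP[y1 y2].
rewrite (_ : gauss_norm2 gamma _ = gauss_norm2 gamma (on_line h (- y))).
  by apply: MP; apply/andP; split; lra.
by rewrite -[RHS]gauss_norm2_conj.
Qed.

(** Reflection in the real axis exchanges the edges, so every fact about upper edges follows from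
    the one about lower edges. *)
Lemma is_upper_valueP eps h a g :
  is_upper_value eps h a g <-> is_lower_value eps (bar_fun h) (- a) (fun x => (g x)^*).
Proof.
have N gamma y : gauss_norm2 gamma (fun x => on_line (bar_fun h) y x - (g x)^*) =
    gauss_norm2 gamma (fun x => on_line h (- y) x - g x).
  by rewrite -[RHS]gauss_norm2_conj; congr gauss_norm2; apply/funext => x; rewrite rmorphB.
have Nf gamma : (fun y => gauss_norm2 gamma (fun x => on_line (bar_fun h) y x - (g x)^*)) =
    (fun y => gauss_norm2 gamma (fun x => on_line h y x - g x)) \o -%R.
  by apply/funext => y; exact: N.
split=> -[mg H]; split.
- exact: cmeasurable_conj.
- by move=> gamma /H /cvg_at_leftNP; rewrite -Nf.
- by move: (cmeasurable_conj mg); under eq_fun do rewrite conjcK.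
- by move=> gamma /H; rewrite Nf => /cvg_at_leftNP.
Qed.

End BoundaryExistence.

(** * The maximum principle *)

Section MaxPrinciple.
Context {R : realType}.
Notation mu := (@lebesgue_measure R).
Notation mfun := (measurable_fun [set: R]).
Notation nrm := Normc.normc.
Implicit Types (h : R[i] -> R[i]) (g : R -> R[i]) (a b y eps gamma : R).

(** Each [y] is the midpoint of a point near the closer edge, where [I <= E + e], and an interior
    point, where [I] is at most its supremum [S]. Hence [S <= (E + e + S) / 2], that is
    [S <= E + e]. *)
Lemma midconvex_max (I : R -> R) a b E M : b < a ->
  (forall y, b < y < a -> I y <= M) ->
  (forall y y', b < y < a -> b < y' < a -> 2 * I ((y + y') / 2) <= I y + I y') ->
  (forall t d, E < t -> 0 < d -> exists2 y, b < y < b + d & I y <= t) ->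
  (forall t d, E < t -> 0 < d -> exists2 y, a - d < y < a & I y <= t) ->
  forall y, b < y < a -> I y <= E.
Proof.
move=> ba IM mid lo up y0 y0ab.
pose A := [set I y | y in [set y | b < y < a]].
have hs : has_sup A.
  by split; [exists (I y0), y0|exists M => z [y /= yab <-]; exact: IM].
have le y : b < y < a -> I y <= sup A by move=> yab; apply: ub_le_sup; [case: hs|exists y].
apply: (le_trans (le _ y0ab)); apply/ler_addgt0Pr => e e0.
suff : sup A <= ((E + e) + sup A) / 2 by lra.
apply: ge_sup; first by case: hs.
move=> z [y /= /andP[y1 y2] <-].
have Ee : E < E + e by lra.
have [yc|yc] := leP y ((a + b) / 2).
  have yb0 : 0 < y - b by lra.
  have [y' /andP[y3 y4] Iy'] := lo _ _ Ee yb0.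
  have y'ab : b < y' < a by apply/andP; split; lra.
  have y''ab : b < 2 * y - y' < a by apply/andP; split; lra.
  have := mid _ _ y'ab y''ab; rewrite (_ : (y' + _) / 2 = y); last by field.
  by have := le _ y''ab; lra.
have ya0 : 0 < a - y by lra.
have [y' /andP[y3 y4] Iy'] := up _ _ Ee ya0.
have y'ab : b < y' < a by apply/andP; split; lra.
have y''ab : b < 2 * y - y' < a by apply/andP; split; lra.
have := mid _ _ y'ab y''ab; rewrite (_ : (y' + _) / 2 = y); last by field.
by have := le _ y''ab; lra.
Qed.

(** The squared modulus of [exp (- gamma z^2 - s z^4)]. For [s > 0] it decays faster than every
    Gaussian, so norms with this weight are finite on the class even when [gamma <= eps]. *)
Definition quartic gamma (s x y : R) : R :=
  expR (- (2 * gamma * (x ^+ 2 - y ^+ 2)) - 2 * s * (x ^+ 4 - 6 * x ^+ 2 * y ^+ 2 + y ^+ 4)).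

Definition qmul gamma (s : R) (z : R[i]) : R[i] :=
  cexp (- gamma%:C * z ^+ 2 + - s%:C * (z ^+ 2) ^+ 2).

Lemma normc_qmul gamma s x y : nrm (qmul gamma s (x +i* y)) ^+ 2 = quartic gamma s x y.
Proof. by rewrite normc_cexp sqr_expR /quartic; congr expR => /=; ring. Qed.

Lemma cderiv_qmul gamma s z : exists D, cderiv (qmul gamma s) z D.
Proof.
have h1 := cderivZ (- gamma%:C) (cderiv_sqr z).
have h2 := cderivZ (- s%:C) (cderiv_comp (cderiv_sqr z) (cderiv_sqr _)).
by eexists; exact: (cderiv_comp (cderivD h1 h2) (cderiv_cexp _)).
Qed.

(** Completing the square in [x^2] gives the constant: the quadratic terms [- 12 s B x^2] and
    [- 2 gamma' x^2] are absorbed by [2 s x^4]. *)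
Lemma quartic_gauss gamma gamma' s (B x y : R) : 0 <= gamma -> 0 < s -> y ^+ 2 <= B ->
  quartic gamma s x y <=
  expR (2 * gamma * B + (6 * s * B + gamma') ^+ 2 / (2 * s)) * expR (- (2 * gamma' * x ^+ 2)).
Proof.
move=> g0 s0 yB; rewrite /quartic -expRD ler_expR -subr_ge0.
have B0 : 0 <= B by apply: le_trans yB; exact: sqr_ge0.
have -> : 2 * gamma * B + (6 * s * B + gamma') ^+ 2 / (2 * s) + - (2 * gamma' * x ^+ 2) -
  (- (2 * gamma * (x ^+ 2 - y ^+ 2)) - 2 * s * (x ^+ 4 - 6 * x ^+ 2 * y ^+ 2 + y ^+ 4)) =
  2 * gamma * (B - y ^+ 2) + 2 * gamma * x ^+ 2 +
  2 * s * (x ^+ 2 - (6 * s * B + gamma') / (2 * s)) ^+ 2 + 12 * s * x ^+ 2 * (B - y ^+ 2)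
   + 2 * s * y ^+ 4.
  by field; rewrite gt_eqF.
have yB0 : 0 <= B - y ^+ 2 by rewrite subr_ge0.
have y4 : 0 <= y ^+ 4 by rewrite (_ : y ^+ 4 = (y ^+ 2) ^+ 2) ?sqr_ge0//; ring.
have s0' := ltW s0.
by repeat (done || exact: sqr_ge0 || apply: addr_ge0 || apply: mulr_ge0).
Qed.

(** Since [x^4 - 6 x^2 y^2 + y^4 = (x^2 - 3 y^2)^2 - 8 y^4], the quartic factor exceeds one by at
    most [exp (16 s y^4)], which disappears as [s -> 0]. *)
Lemma quartic_edge gamma s x y : 0 <= s ->
  quartic gamma s x y <= expR (16 * s * y ^+ 4) * (expR (2 * gamma * y ^+ 2) * expR (- (2 * gamma * x ^+ 2))).
Proof.
move=> s0; rewrite /quartic -!expRD ler_expR -subr_ge0.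
rewrite (_ : _ - _ = 2 * s * (x ^+ 2 - 3 * y ^+ 2) ^+ 2); last by ring.
by repeat (done || exact: sqr_ge0 || apply: mulr_ge0).
Qed.

Lemma quartic_measurable gamma s y : mfun (fun x => quartic gamma s x y).
Proof.
apply: (@measurableT_comp _ _ _ _ _ _ (@expR R)); first exact: measurable_expR.
by repeat (apply: measurable_funB || apply: measurable_funD || apply: measurable_funM ||
  apply: measurable_funN || apply: measurable_funX || exact: measurable_cst || exact: measurable_id).
Qed.

Lemma quartic_cvg_y gamma s x (u : nat -> R) b : u n @[n --> \oo] --> b ->
  quartic gamma s x (u n) @[n --> \oo] --> quartic gamma s x b.
Proof.
move=> ub; apply: (continuous_cvg _ (@continuous_expR R _)).
have u2 : u n ^+ 2 @[n --> \oo] --> b ^+ 2.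
  by have := @seq_cvgM _ _ _ _ _ ub ub; rewrite -expr2; under eq_fun do rewrite -expr2.
have u4 : u n ^+ 4 @[n --> \oo] --> b ^+ 4.
  by have := @seq_cvgM _ _ _ _ _ u2 u2; rewrite -exprD; under eq_fun do rewrite -exprD.
apply: cvgB.
  by apply: cvgN; apply: (@seq_cvgM _ _ _ _ _ (@seq_cvg_cst _ _)); apply: cvgB => //; exact: cvg_cst.
apply: (@seq_cvgM _ _ _ _ _ (@seq_cvg_cst _ _)); apply: cvgD => //.
by apply: cvgB; [exact: cvg_cst|exact: (@seq_cvgM _ _ _ _ _ (@seq_cvg_cst _ _))].
Qed.

Lemma quartic_cvg_s gamma x y (u : nat -> R) (b : R) : u n @[n --> \oo] --> b ->
  quartic gamma (u n) x y @[n --> \oo] --> quartic gamma b x y.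
Proof.
move=> ub; apply: (continuous_cvg _ (@continuous_expR R _)).
apply: cvgB; first exact: cvg_cst.
apply: (@seq_cvgM _ _ _ _ _ _ (@seq_cvg_cst _ _)).
exact: (@seq_cvgM _ _ _ _ _ (@seq_cvg_cst _ _)).
Qed.

Definition qnorm gamma s h y : \bar R :=
  (\int[mu]_x (nrm (h (x +i* y)) ^+ 2 * quartic gamma s x y)%:E)%E.

Lemma qnorm_bar gamma s h y : qnorm gamma s (bar_fun h) (- y) = qnorm gamma s h y.
Proof.
apply: eq_integral => x _; rewrite /bar_fun normc_conj /= opprK.
by congr (_ * expR _)%:E; ring.
Qed.

Lemma normc_sqr_young (u v : R[i]) (k : R) : 0 < k ->
  nrm u ^+ 2 <= (1 + k) * nrm v ^+ 2 + (1 + k^-1) * nrm (u - v) ^+ 2.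
Proof.
move=> k0; have h := ler_normcD (u - v) v; rewrite subrK in h.
have n1 := normc_ge0 u; have n2 := normc_ge0 v; have n3 := normc_ge0 (u - v).
apply: (@le_trans _ _ ((nrm (u - v) + nrm v) ^+ 2)).
  by rewrite lerXn2r// nnegrE addr_ge0.
rewrite -subr_ge0 (_ : _ - _ = k * (nrm v - k^-1 * nrm (u - v)) ^+ 2).
  by rewrite mulr_ge0 ?sqr_ge0// ltW.
by field; rewrite gt_eqF.
Qed.

(** The hypothesis concerns the weight [gamma], whereas [h] approaches [g] only in norms with weight
    above [eps]. The quartic weight is dominated by the Gaussian of [gamma' = eps + 1], so that
    convergence can be used; [g] itself is handled by dominated convergence in [y]. *)
Lemma qnorm_lower_edge a b eps h g gamma s E : 0 <= eps -> b < a -> Hclass a b eps h ->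
  is_lower_value eps h b g -> 0 <= gamma -> 0 < s ->
  ((expR (2 * gamma * b ^+ 2))%:E * gauss_norm2 gamma g <= E%:E)%E ->
  forall t d, expR (16 * s * b ^+ 4) * E < t -> 0 < d ->
  exists2 y, b < y < b + d & (qnorm gamma s h y <= t%:E)%E.
Proof.
move=> eps0 ba hH /is_lower_valueP[mg gP] g0 s0 gE t d Et d0.
have hh := Hclass_hol hH.
pose gamma' := eps + 1; have eg : eps < gamma' by rewrite /gamma'; lra.
pose a' := Num.min a (b + d).
have a'1 : a' <= a by rewrite ge_min lexx.
have a'2 : a' <= b + d by rewrite ge_min lexx orbT.
have ba' : b < a' by rewrite lt_min ba; lra.
have [y_ [yab yb yP]] := rlim0_seq ba' (gP _ eg).
pose B := Num.max (a ^+ 2) (b ^+ 2).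
have yB y : b <= y <= a -> y ^+ 2 <= B.
  move=> /andP[y1 y2]; rewrite /B le_max.
  have [y0|y0] := leP 0 y.
    by apply/orP; left; rewrite lerXn2r// ?nnegrE//; lra.
  apply/orP; right; rewrite -[leLHS]sqrrN -[leRHS]sqrrN lerXn2r// ?nnegrE; lra.
pose C := expR (2 * gamma * B + (6 * s * B + gamma') ^+ 2 / (2 * s)).
have C0 : 0 <= C by exact: expR_ge0.
have qC y x : b <= y <= a -> quartic gamma s x y <= C * expR (- (2 * gamma' * x ^+ 2)).
  by move=> yy; apply: quartic_gauss => //; exact: yB.
have yn_ab n : b < y_ n < a by move: (yab n) => /andP[? ?]; apply/andP; split; lra.
have yn_ab' n : b <= y_ n <= a by move: (yab n) => /andP[? ?]; apply/andP; split; lra.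
have mh n := on_line_cmeasurable hh (yn_ab n).
have ig : mu.-integrable setT (EFin \o (fun x => nrm (g x) ^+ 2 * expR (- (2 * gamma' * x ^+ 2)))).
  apply: nint_integrable; first exact: gauss_integrand_measurable.
    by move=> x; exact: gauss_weight_ge0.
  have [M M0 MP] := Hclass_bound ba hH eg.
  have N1 := yP 0%N; rewrite expr0 in N1.
  have := gauss_norm2_triangle gamma' (mh 0%N) (cmeasurableB (mh 0%N) mg).
  rewrite (_ : (fun x => _ - (_ - g x)) = g); last by apply/funext => x; ring.
  move=> /le_lt_trans; apply; apply: (@le_lt_trans _ _ (2%:E * (M%:E + 1%:E))%E).
    by apply: lee_wpmul2l => //; apply: leeD => //; exact: MP.
  by rewrite -EFinD -EFinM ltry.
have ib : (\int[mu]_x (nrm (g x) ^+ 2 * quartic gamma s x (y_ n)))  @[n --> \oo] -->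
     \int[mu]_x (nrm (g x) ^+ 2 * quartic gamma s x b).
  apply: (Rint_dominated _ _ _ (integrableZl measurableT C ig)).
  - move=> n; apply: measurable_funM; last exact: quartic_measurable.
    by apply: measurable_funX; exact: cmeasurable_nrm.
  - apply: measurable_funM; last exact: quartic_measurable.
    by apply: measurable_funX; exact: cmeasurable_nrm.
  - apply: ae_every => x; apply: (@seq_cvgM _ _ _ _ _ (@seq_cvg_cst _ _)).
    exact: quartic_cvg_y.
  - move=> n x; rewrite ger0_norm; last exact: mulr_ge0 (sqr_ge0 _) (expR_ge0 _).
    by rewrite /= mulrCA ler_wpM2l ?sqr_ge0// qC.
have mq y : mfun (fun x => nrm (g x) ^+ 2 * quartic gamma s x y).
  apply: measurable_funM; last exact: quartic_measurable.
  by apply: measurable_funX; exact: cmeasurable_nrm.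
have q0 y x : 0 <= nrm (g x) ^+ 2 * quartic gamma s x y.
  exact: mulr_ge0 (sqr_ge0 _) (expR_ge0 _).
have iq y : b <= y <= a ->
   (\int[mu]_x (nrm (g x) ^+ 2 * quartic gamma s x y)%:E =
    (\int[mu]_x (nrm (g x) ^+ 2 * quartic gamma s x y)%R)%:E)%E.
  move=> yy; rewrite /Rintegral fineK//; apply: (integrable_fin_num measurableT).
  apply: (integrable_le (mq y) _ (integrableZl measurableT C ig)) => x.
  by rewrite ger0_norm//= mulrCA ler_wpM2l ?sqr_ge0// qC.
pose E' := expR (16 * s * b ^+ 4) * E.
have Eb : \int[mu]_x (nrm (g x) ^+ 2 * quartic gamma s x b) <= E'.
  rewrite -lee_fin -iq ?lexx ?(ltW ba)// /E' EFinM.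
  apply: le_trans (lee_wpmul2l _ gE); last by rewrite lee_fin expR_ge0.
  rewrite /gauss_norm2 -!nintZ ?expR_ge0//; first last.
  - by move=> x; exact: gauss_weight_ge0.
  - exact: gauss_integrand_measurable.
  - by move=> x; rewrite mulr_ge0 ?expR_ge0// gauss_weight_ge0.
  - by apply: measurable_funM; [exact: measurable_cst|exact: gauss_integrand_measurable].
  apply: le_nint => //.
  - apply: measurable_funM; first exact: measurable_cst.
    by apply: measurable_funM; [exact: measurable_cst|exact: gauss_integrand_measurable].
  - move=> x; apply: le_trans (ler_wpM2l (sqr_ge0 _) (quartic_edge _ _ _ (ltW s0))) _.
    by rewrite le_eqVlt; apply/orP; left; apply/eqP; ring.
have E'0 : 0 <= E' by apply: le_trans Eb; apply: Rintegral_ge0.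
have tE' : 0 < t - E' by rewrite subr_gt0.
(* Young's inequality with parameter [k] costs [k E'] on the main term; this choice keeps it below
   [(t - E') / 4], leaving room for the two error terms. *)
pose k := (t - E') / (4 * (E' + 1)).
have k0 : 0 < k by rewrite divr_gt0// mulr_gt0//; lra.
have kE : k * (E' + 1) <= (t - E') / 4.
  by rewrite /k le_eqVlt; apply/orP; left; apply/eqP; field; rewrite gt_eqF//; lra.
have k1 : (1 + k) * E' + (t - E') / 2 < t.
  have : k * E' <= k * (E' + 1) by rewrite ler_wpM2l ?(ltW k0)// lerDl.
  by rewrite mulrDl mul1r; lra.
(* eventually both error terms are at most [(t - E') / 4] *)
pose e1 := (t - E') / 4 / (1 + k); pose e2 := (t - E') / 4 / ((1 + k^-1) * (C + 1)).
have kk : 0 < (1 + k^-1) * (C + 1) by apply: mulr_gt0; [rewrite addr_gt0// invr_gt0|rewrite ltr_wpDl].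
have k10 : 0 < 1 + k by lra.
have e10 : 0 < e1 by rewrite !divr_gt0.
have e20 : 0 < e2 by rewrite /e2 divr_gt0// divr_gt0.
have : \forall n \near \oo, \int[mu]_x (nrm (g x) ^+ 2 * quartic gamma s x (y_ n)) <= E' + e1.
  move/cvgrPdist_le: ib => /(_ _ e10); apply: filterS => n; rewrite distrC.
  by move=> /(le_trans (ler_norm _)); rewrite lerBlDl => /le_trans; apply; rewrite lerD2r.
have : \forall n \near \oo, (2^-1 : R) ^+ n <= e2.
  have : (1 : R) * 2^-1 ^+ n @[n --> \oo] --> (0 : R).
    by apply: cvg_geometric; rewrite ger0_norm ?invr_ge0//; lra.
  move/cvgr0Pnorm_le => /(_ _ e20); apply: filterS => n; rewrite mul1r; apply: le_trans.
  exact: ler_norm.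
move=> near2 near1; have [n [n1 n2]] := filter_ex (filterI near1 near2).
exists (y_ n); first by move: (yab n) => /andP[? ?]; apply/andP; split; lra.
have mhg := cmeasurableB (mh n) mg.
apply: (@le_trans _ _ (\int[mu]_x ((1 + k) * (nrm (g x) ^+ 2 * quartic gamma s x (y_ n)) +
  ((1 + k^-1) * C) * (nrm (on_line h (y_ n) x - g x) ^+ 2 * expR (- (2 * gamma' * x ^+ 2))))%:E)%E).
  apply: le_nint.
  - apply: measurable_funM; last exact: quartic_measurable.
    by apply: measurable_funX; exact: (cmeasurable_nrm (mh n)).
  - apply: measurable_funD; apply: measurable_funM; try exact: measurable_cst; first exact: mq.
    exact: gauss_integrand_measurable.
  - by move=> x; exact: mulr_ge0 (sqr_ge0 _) (expR_ge0 _).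
  - move=> x; have W0 : 0 <= quartic gamma s x (y_ n) by exact: expR_ge0.
    apply: (le_trans (ler_wpM2r W0 (normc_sqr_young (h (x +i* y_ n)) (g x) k0))).
    rewrite [leLHS]mulrDl -[(1 + k) * _ * _]mulrA lerD2l.
    rewrite -[leLHS]mulrA -[leRHS]mulrA.
    rewrite ler_wpM2l//; first by rewrite addr_ge0// invr_ge0 ltW.
    by rewrite [leRHS]mulrCA ler_wpM2l ?sqr_ge0// qC.
have kC0 : 0 <= (1 + k^-1) * C by rewrite mulr_ge0// addr_ge0// invr_ge0 ltW.
have gi := gauss_integrand_measurable gamma' mhg.
have gi0 x := gauss_weight_ge0 gamma' (on_line h (y_ n) x - g x) x.
rewrite nintD; last 4 first.
- by apply: measurable_funM; [exact: measurable_cst|exact: mq].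
- by apply: measurable_funM; [exact: measurable_cst|exact: gi].
- by move=> x; rewrite mulr_ge0// ltW.
- by move=> x; rewrite mulr_ge0.
rewrite !nintZ//; last exact: ltW.
rewrite iq//.
apply: (@le_trans _ _ ((1 + k)%:E * (E' + e1)%:E + ((1 + k^-1) * C)%:E * (2^-1 ^+ n)%:E)%E).
  apply: leeD; apply: lee_wpmul2l; rewrite ?lee_fin ?(ltW k10)//.
  exact: yP.
rewrite -!EFinM -EFinD lee_fin.
have A1 : (1 + k) * e1 = (t - E') / 4 by rewrite /e1 mulrC divfK// gt_eqF.
have A2 : (1 + k^-1) * C * 2^-1 ^+ n <= (t - E') / 4.
  apply: (@le_trans _ _ ((1 + k^-1) * (C + 1) * e2)); last first.
    by rewrite /e2 mulrC divfK// gt_eqF.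
  apply: ler_pM => //.
  by rewrite ler_wpM2l ?addr_ge0 ?invr_ge0 ?(ltW k0)// lerDl.
by rewrite mulrDr A1; lra.
Qed.

End MaxPrinciple.

Section MaxPrincipleTheorem.
Context {R : realType}.
Notation mu := (@lebesgue_measure R).
Notation mfun := (measurable_fun [set: R]).
Notation nrm := Normc.normc.
Implicit Types (h : R[i] -> R[i]) (g : R -> R[i]) (a b y eps gamma : R).

Lemma sqr_le_max a b y : b <= y <= a -> y ^+ 2 <= Num.max (a ^+ 2) (b ^+ 2).
Proof.
move=> /andP[y1 y2]; rewrite le_max.
have [y0|y0] := leP 0 y.
  by apply/orP; left; rewrite lerXn2r// ?nnegrE//; lra.
by apply/orP; right; rewrite -[leLHS]sqrrN -[leRHS]sqrrN lerXn2r// ?nnegrE; lra.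
Qed.

Lemma qmul_L2strip a b eps h gamma s : 0 <= eps -> b < a -> Hclass a b eps h ->
  0 <= gamma -> 0 < s -> L2strip (fun z => h z * qmul gamma s z) a b.
Proof.
move=> eps0 ba hH g0 s0; have hh := Hclass_hol hH.
pose gamma' := eps + 1; have eg : eps < gamma' by rewrite /gamma'; lra.
have [M M0 MP] := Hclass_bound ba hH eg.
pose B := Num.max (a ^+ 2) (b ^+ 2).
pose C := expR (2 * gamma * B + (6 * s * B + gamma') ^+ 2 / (2 * s)).
have C0 : 0 <= C by exact: expR_ge0.
exists (C * M) => y yab; rewrite EFinM.
apply: le_trans (lee_wpmul2l _ (MP _ yab)); last by rewrite lee_fin.
have my := on_line_cmeasurable hh yab.
have mi := gauss_integrand_measurable gamma' my.
rewrite /gauss_norm2 -nintZ//; last by move=> x; exact: gauss_weight_ge0.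
have E x : nrm (h (x +i* y) * qmul gamma s (x +i* y)) ^+ 2 =
   nrm (h (x +i* y)) ^+ 2 * quartic gamma s x y by rewrite Normc.normcM exprMn normc_qmul.
under eq_integral do rewrite E.
apply: le_nint.
- apply: measurable_funM; last exact: quartic_measurable.
  by apply: measurable_funX; exact: (cmeasurable_nrm my).
- by apply: measurable_funM; [exact: measurable_cst|exact: mi].
- by move=> x; exact: mulr_ge0 (sqr_ge0 _) (expR_ge0 _).
- move=> x; rewrite [leRHS]mulrCA ler_wpM2l ?sqr_ge0// quartic_gauss//.
  by apply: sqr_le_max; move/andP: yab => [? ?]; apply/andP; split; exact: ltW.
Qed.

(** The factor [exp (2 gamma y^2)] makes each side the squared [L^2] norm of [h * gmul gamma] on a
    line. These norms are midpoint convex in the height once a quartic factor secures their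
    finiteness, and a midpoint-convex bounded function is controlled by its edge values. *)
Theorem max_principle a b eps h gb ga gamma E : 0 <= eps -> b < a -> Hclass a b eps h ->
  is_lower_value eps h b gb -> is_upper_value eps h a ga -> 0 <= gamma ->
  ((expR (2 * gamma * b ^+ 2))%:E * gauss_norm2 gamma gb <= E%:E)%E ->
  ((expR (2 * gamma * a ^+ 2))%:E * gauss_norm2 gamma ga <= E%:E)%E ->
  forall y, b < y < a ->
  ((expR (2 * gamma * y ^+ 2))%:E * gauss_norm2 gamma (on_line h y) <= E%:E)%E.
Proof.
move=> eps0 ba hH lb ua g0 Eb Ea y yab; have hh := Hclass_hol hH.
have my := on_line_cmeasurable hh yab.
pose B := Num.max (a ^+ 4) (b ^+ 4).
have E0 : 0 <= E.
  by rewrite -lee_fin; apply: le_trans Eb; rewrite mule_ge0 ?gauss_norm2_ge0// lee_fin expR_ge0.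
have main s : 0 < s -> (qnorm gamma s h y <= (expR (16 * s * B) * E)%:E)%E.
  move=> s0; pose G z := h z * qmul gamma s z.
  have hG : hol G a b by apply: holM => // z _; exact: cderiv_qmul.
  have LG : L2strip G a b by exact: (qmul_L2strip eps0 ba hH g0 s0).
  have QG y' : b < y' < a -> qnorm gamma s h y' = (nrm2 G y')%:E.
    move=> y'ab; rewrite -(nrm2E hG LG y'ab); apply: eq_integral => x _.
    by rewrite Normc.normcM exprMn normc_qmul.
  have [M MP] := LG.
  rewrite QG// lee_fin; apply: (@midconvex_max _ (nrm2 G) a b _ M) => //.
  - by move=> y' y'ab; rewrite -lee_fin -(nrm2E hG LG y'ab) MP.
  - by move=> y1 y2; exact: nrm2_midconvex.
  - move=> t d Et d0.
    have d1 : 0 < Num.min d (a - b) by rewrite lt_min d0 subr_gt0.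
    have Et' : expR (16 * s * b ^+ 4) * E < t.
      apply: le_lt_trans Et; rewrite ler_wpM2r// ler_expR ler_wpM2l//.
        by rewrite mulr_ge0// ltW.
      by rewrite /B le_max lexx orbT.
    have [y' /andP[y1 y2] y3] := qnorm_lower_edge eps0 ba hH lb g0 s0 Eb Et' d1.
    have m1 : Num.min d (a - b) <= d by rewrite ge_min lexx.
    have m2 : Num.min d (a - b) <= a - b by rewrite ge_min lexx orbT.
    exists y'; first by apply/andP; split; lra.
    by rewrite -lee_fin -QG//; apply/andP; split; lra.
  - move=> t d Et d0.
    have d1 : 0 < Num.min d (a - b) by rewrite lt_min d0 subr_gt0.
    have Et' : expR (16 * s * (- a) ^+ 4) * E < t.
      apply: le_lt_trans Et; rewrite ler_wpM2r// ler_expR ler_wpM2l//.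
        by rewrite mulr_ge0// ltW.
      by rewrite /B le_max (_ : (- a) ^+ 4 = a ^+ 4) ?lexx//; ring.
    have ba' : - a < - b by rewrite ltrN2.
    have Ea' : ((expR (2 * gamma * (- a) ^+ 2))%:E * gauss_norm2 gamma (fun x => (ga x)^*) <= E%:E)%E.
      by rewrite sqrrN gauss_norm2_conj.
    have /is_upper_valueP ub := ua.
    have [y' /andP[y1 y2] y3] := qnorm_lower_edge eps0 ba' (Hclass_bar ba hH) ub g0 s0 Ea' Et' d1.
    have m1 : Num.min d (a - b) <= d by rewrite ge_min lexx.
    have m2 : Num.min d (a - b) <= a - b by rewrite ge_min lexx orbT.
    exists (- y'); first by apply/andP; split; lra.
    rewrite -lee_fin -QG; last by apply/andP; split; lra.
    by rewrite -qnorm_bar opprK.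
rewrite /gauss_norm2 -nintZ ?expR_ge0//; last 2 first.
- exact: gauss_integrand_measurable.
- by move=> x; exact: gauss_weight_ge0.
(* The regularization is removed along [s = 1 / (n + 1)]; Fatou's lemma needs no domination. *)
pose u (n : nat) : R := n.+1%:R^-1.
have u0 n : 0 < u n by rewrite invr_gt0.
have ucv : u n @[n --> \oo] --> (0 : R) by exact: cvg_harmonic.
apply/lee_addgt0Pr => e e0; rewrite -EFinD.
apply: (@fatou_ae _ (fun n x => nrm (h (x +i* y)) ^+ 2 * quartic gamma (u n) x y)).
- move=> n; apply: measurable_funM; last exact: quartic_measurable.
  by apply: measurable_funX; exact: (cmeasurable_nrm my).
- by apply: measurable_funM; [exact: measurable_cst|exact: gauss_integrand_measurable].
- by move=> n x; exact: mulr_ge0 (sqr_ge0 _) (expR_ge0 _).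
- by move=> x; rewrite mulr_ge0 ?expR_ge0// gauss_weight_ge0.
- apply: ae_every => x.
  rewrite (_ : expR _ * _ = nrm (h (x +i* y)) ^+ 2 * quartic gamma 0 x y).
    apply: (@seq_cvgM _ _ _ _ _ (@seq_cvg_cst _ _)); exact: quartic_cvg_s.
  rewrite mulrCA; congr (_ * _); rewrite -expRD /quartic; congr expR; ring.
- have : expR (16 * u n * B) * E @[n --> \oo] --> expR (16 * 0 * B) * E.
    apply: (@seq_cvgM _ _ _ _ _ _ (@seq_cvg_cst _ _)).
    apply: (continuous_cvg _ (@continuous_expR R _)).
    apply: (@seq_cvgM _ _ _ _ _ _ (@seq_cvg_cst _ _)).
    exact: (@seq_cvgM _ _ _ _ _ (@seq_cvg_cst _ _)).
  rewrite mulr0 mul0r expR0 mul1r => /cvgrPdist_le/(_ e e0); apply: filterS => n.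
  rewrite distrC => /(le_trans (ler_norm _)); rewrite lerBlDl => H.
  by apply: (le_trans (main _ (u0 n))); rewrite lee_fin.
Qed.

End MaxPrincipleTheorem.

(** * The identity theorem *)

Section IdentityTheorem.
Context {R : realType}.
Notation mu := (@lebesgue_measure R).
Notation mfun := (measurable_fun [set: R]).
Notation nrm := Normc.normc.
Implicit Types (F h : R[i] -> R[i]) (g : R -> R[i]) (a b y eps gamma : R).

(* Testing [F] against the Gaussians [exp (- n (z - z0)^2)], whose integrals do
   not depend on the line, isolates the value [F z0]. *)
Theorem hol_L1_zero F a b s0 : hol F a b -> L1strip F a b -> b < s0 < a ->
  (forall x, F (x +i* s0) = 0) -> forall z, strip a b z -> F z = 0.
Proof.
move=> hF LF s0ab F0 z0 z0ab; apply: contrapT => /eqP Fz0.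
case: z0 z0ab Fz0 => x0 y0 [/= y01 y02] Fz0.
have y0ab : b < y0 < a by rewrite y01.
set z0 := x0 +i* y0 in Fz0 *.
(* With this factor [p] takes the positive value [|F z0|^2] at [x0]. *)
pose c0 := (F z0)^*; pose p x := complex.Re (F (x +i* y0) * c0).
have hcst c : hol (fun=> c) a b by move=> z _; exists 0; exact: cderiv_cst.
pose w n z := cexp (- (n%:R : R)%:C * (z - z0) ^+ 2).
have hw n : hol (w n) a b.
  move=> z _; have h1 := cderivD (cderiv_id z) (cderiv_cst (- z0) z).
  have h2 := cderivZ (- (n%:R : R)%:C) (cderiv_comp h1 (cderiv_sqr _)).
  by eexists; exact: (cderiv_comp h2 (cderiv_cexp _)).
have nw n x y : nrm (w n (x +i* y)) = expR (- (n%:R * ((x - x0) ^+ 2 - (y - y0) ^+ 2))).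
  by rewrite normc_cexp /=; congr expR; ring.
have ip : mu.-integrable setT (EFin \o p).
  apply: (@integrable_le _ _ (fun x => nrm c0 * nrm (F (x +i* y0)))).
  - have [] := hol_line_measurable (holM hF (hcst c0)) y0ab; done.
  - by move=> x; rewrite -Normc.normcM mulrC; exact: ler_Re_normc.
  - exact: (integrableZl measurableT _ (L1strip_integrable hF LF y0ab)).
(* The integral vanishes on the line of height [s0], where [F] does, hence also on the line through
   [z0], where the Gaussian is real and centred at [x0]. *)
have shift n : \int[mu]_x (p x * expR (- (n%:R * (x - x0) ^+ 2))) = 0.
  pose H z := F z * c0 * w n z.
  have hH : hol H a b by apply: holM => //; exact: holM.
  have LH : L1strip H a b.
    have [M MP] := LF; pose C := nrm c0 * expR (n%:R * (a - b) ^+ 2).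
    have C0 : 0 <= C by rewrite mulr_ge0 ?normc_ge0 ?expR_ge0.
    exists (C * M) => y yab; rewrite EFinM; apply: le_trans (lee_wpmul2l _ (MP _ yab)); last by rewrite lee_fin.
    have [_ _ m1] := hol_line_measurable hF yab.
    have [_ _ m2] := hol_line_measurable hH yab.
    rewrite -nintZ//; last by move=> x; exact: normc_ge0.
    apply: le_nint => //.
    - by apply: measurable_funM; [exact: measurable_cst|exact: m1].
    - by move=> x; exact: normc_ge0.
    - move=> x; rewrite /H !Normc.normcM nw [_ * nrm c0]mulrC mulrAC.
      rewrite ler_wpM2r ?normc_ge0// /C ler_wpM2l ?normc_ge0// ler_expR -mulrN ler_wpM2l//.
      rewrite opprB; apply: (@le_trans _ _ ((y - y0) ^+ 2)); first by rewrite gerBl sqr_ge0.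
      move/andP: yab => [y1 y2].
      have [yy|yy] := leP y0 y; first by rewrite lerXn2r// ?nnegrE; lra.
      by rewrite -[leLHS]sqrrN opprB lerXn2r// ?nnegrE; lra.
  have := contour_shift hH LH y0ab s0ab.
  have -> : \int[mu]_x complex.Re (H (x +i* s0)) = 0.
    rewrite -[RHS](_ : \int[mu]_x (cst 0 x : R) = 0); last by rewrite /Rintegral integral0.
    by apply: eq_Rintegral => x _; rewrite /H F0 !mul0r.
  move=> <-; apply: eq_Rintegral => x _; rewrite /H /p.
  have -> : w n (x +i* y0) = (expR (- (n%:R * (x - x0) ^+ 2)))%:C.
    rewrite /w (_ : - _ * _ = (- (n%:R * (x - x0) ^+ 2))%:C).
      by rewrite /cexp /= cos0 sin0 mulr1 mulr0.
    have -> : (x +i* y0) - z0 = (x - x0)%:C.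
      by apply/eqP; rewrite eq_complex/= subrr !eqxx.
    by rewrite -rmorphN -rmorphXn -rmorphM /= mulNr.
  by case: (F _ * c0) => u v /=; ring.
pose c := nrm (F z0) ^+ 2 / 2.
have nz : 0 < nrm (F z0) by rewrite lt_def normc_eq0 Fz0 normc_ge0.
have c_gt0 : 0 < c by rewrite divr_gt0// exprn_gt0.
have [d d0 dP] : exists2 d : R, 0 < d & forall x, `|x - x0| < d -> c <= p x.
  have [D hD] : exists D, cderiv (fun z => F z * c0) z0 D.
    by apply: (holM hF (hcst c0)).
  have [d d0 dP] := cderiv_continuous_ReIm hD c_gt0.
  exists d => // x xd; have := dP (x +i* y0).
  rewrite (_ : (x +i* y0) - z0 = (x - x0) +i* 0); last by apply/eqP; rewrite eq_complex/= subrr !eqxx.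
  rewrite normc_real => /(_ xd) /(le_trans (ler_Re_normc _)); rewrite raddfB/=.
  rewrite (_ : complex.Re (F z0 * c0) = nrm (F z0) ^+ 2) ?Re_mul_conj//.
  by rewrite ler_norml /p => /andP[]; rewrite /c; lra.
pose K := \int[mu]_x `|p x|.
pose J : set R := `]x0 - d / 2, x0 + d / 2[%classic.
have mJ : measurable J by exact: measurable_itv.
have intJ : (\int[mu]_x (\1_J x : R)%:E = d%:E)%E.
  rewrite integral_indic// setIT.
  have E := @lebesgue_measure_itv R `]x0 - d / 2, x0 + d / 2[; rewrite /= lte_fin in E.
  apply: etrans E _; rewrite ifT; last by lra.
  by rewrite -EFinB; congr EFin; field.
have bound (n : nat) : c * d * (1 + 3 / 4 * d ^+ 2 * n%:R) <= K.
  (* On [J] the Gaussian is at least [e1], and at distance [d] or more it is at most [e2], while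
     [p >= 0] in between. The ratio [e1 / e2 = exp (3/4 d^2 n)] is unbounded, so the mass near [x0]
     cannot be balanced by the rest. *)
  pose e1 := expR (- (n%:R * (d ^+ 2 / 4))); pose e2 := expR (- (n%:R * d ^+ 2)).
  have ipw : mu.-integrable setT (EFin \o (fun x => p x * expR (- (n%:R * (x - x0) ^+ 2)))).
    apply: (@integrable_le _ _ (fun x => `|p x|)).
    - apply: measurable_funM; first by case/integrableP: ip => /measurable_EFinP.
      apply: (@measurableT_comp _ _ _ _ _ _ (@expR R)); first exact: measurable_expR.
      apply: measurable_funN; apply: measurable_funM => //; apply: measurable_funX.
      by apply: measurable_funB => //.
    - move=> x; rewrite normrM (ger0_norm (expR_ge0 _)) ler_piMr//.
      by rewrite -expR0 ler_expR oppr_le0 mulr_ge0// sqr_ge0.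
    - exact: (integrable_norm ip).
  have iJ : mu.-integrable setT (EFin \o (\1_J : R -> R)).
    apply: nint_integrable => //.
    by rewrite intJ ltry.
  have iL := integrableB measurableT (integrableZl measurableT (c * e1) iJ)
       (integrableZl measurableT e2 (integrable_norm ip)).
  have : \int[mu]_x (c * e1 * \1_J x - e2 * `|p x|) <= 0.
    rewrite -[leRHS](shift n); apply: le_Rintegral => // x _ /=.
    have e20 : 0 <= e2 * `|p x| by rewrite mulr_ge0// expR_ge0.
    rewrite indicE; case: (boolP (x \in J)) => xJ.
      have xd : `|x - x0| < d / 2.
        by move: xJ; rewrite inE /J/= in_itv/= ltr_norml => /andP[? ?]; apply/andP; split; lra.
      have cp : c <= p x by apply: dP; apply: lt_le_trans xd _; lra.
      apply: (@le_trans _ _ (c * e1)); first by rewrite mulr1 gerBl.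
      apply: ler_pM => //; [exact: ltW|exact: expR_ge0|].
      rewrite ler_expR lerN2 ler_wpM2l// -real_normK ?num_real//.
      by rewrite (_ : d ^+ 2 / 4 = (d / 2) ^+ 2) ?lerXn2r// ?nnegrE ?ltW//; [lra|field].
    rewrite mulr0 sub0r.
    have [xd|xd] := ltP `|x - x0| d.
      by apply: (@le_trans _ _ 0); [rewrite oppr_le0|rewrite mulr_ge0 ?expR_ge0// (le_trans (ltW c_gt0))// dP].
    apply: (@le_trans _ _ (- (`|p x| * expR (- (n%:R * (x - x0) ^+ 2))))); last first.
      by rewrite -mulNr ler_wpM2r ?expR_ge0//; rewrite lerNl -normrN ler_norm.
    rewrite lerN2 mulrC ler_wpM2r// ler_expR lerN2 ler_wpM2l// -[leRHS]real_normK ?num_real//.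
    by rewrite lerXn2r// nnegrE ltW.
  rewrite RintegralB//; last 2 first.
  - exact: (integrableZl measurableT (c * e1) iJ).
  - exact: (integrableZl measurableT e2 (integrable_norm ip)).
  rewrite !RintegralZl//; last exact: (integrable_norm ip).
  have -> : \int[mu]_x (\1_J x : R) = d.
    by rewrite /Rintegral intJ.
  rewrite subr_le0 => H.
  have e1e2 : e1 = e2 * expR (3 / 4 * d ^+ 2 * n%:R) by rewrite /e1 /e2 -expRD; congr expR; field.
  have e20 : 0 < e2 by exact: expR_gt0.
  have : c * d * expR (3 / 4 * d ^+ 2 * n%:R) <= K.
    rewrite -(ler_pM2l e20); apply: le_trans H; rewrite e1e2.
    by rewrite le_eqVlt; apply/orP; left; apply/eqP; ring.
  apply: le_trans; apply: ler_wpM2l; last exact: expR_ge1Dx.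
  by rewrite mulr_ge0// ltW.
have K0 : 0 <= K by apply: Rintegral_ge0 => x _; exact: normr_ge0.
pose t := K / (c * d * (3 / 4 * d ^+ 2)).
have t0 : 0 <= t by rewrite divr_ge0// !mulr_ge0 ?sqr_ge0 ?ltW.
have := bound (Num.bound t); have := archi_boundP t0.
rewrite ltr_pdivrMr; last by rewrite !mulr_gt0 ?exprn_gt0.
have cd : 0 < c * d by rewrite mulr_gt0.
move: (Num.bound t)%:R => N h1 h2.
have h3 : c * d * (1 + 3 / 4 * d ^+ 2 * N) = c * d + N * (c * d * (3 / 4 * d ^+ 2)) by ring.
lra.
Qed.

End IdentityTheorem.

(** * Almost-everywhere limits along heights tending to the edge *)

Section Subsequences.
Context {R : realType}.
Notation mu := (@lebesgue_measure R).
Notation mfun := (measurable_fun [set: R]).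
Notation nrm := Normc.normc.
Implicit Types (F h : R[i] -> R[i]) (g : R -> R[i]) (a b y eps gamma : R).

Definition ccvg (u : nat -> R[i]) (l : R[i]) := nrm (u n - l) @[n --> \oo] --> (0 : R).

Lemma ccvg_le (u : nat -> R) (v : nat -> R) : (forall n, 0 <= u n <= v n) ->
  v n @[n --> \oo] --> (0 : R) -> u n @[n --> \oo] --> (0 : R).
Proof.
move=> uv v0; apply: (@squeeze_cvgr _ _ _ _ (cst 0) v) => //; first exact: nearW.
exact: cvg_cst.
Qed.

Lemma ccvg_norm u l : ccvg u l -> nrm (u n) @[n --> \oo] --> nrm l.
Proof.
move=> ul; apply/cvgrPdist_le => e e0; move/cvgr0Pnorm_le: ul => /(_ e e0).
apply: filterS => n; rewrite ger0_norm ?normc_ge0//; apply: le_trans.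
by rewrite distrC; exact: ler_dist_normc.
Qed.

Lemma ccvgM u v l m : ccvg u l -> ccvg v m -> ccvg (fun n => u n * v n) (l * m).
Proof.
move=> ul vm; apply: (@ccvg_le _ (fun n => nrm (u n - l) * nrm (v n) + nrm l * nrm (v n - m))).
  move=> n; rewrite normc_ge0/= (_ : u n * v n - l * m = (u n - l) * v n + l * (v n - m)); last by ring.
  by apply: le_trans (ler_normcD _ _) _; rewrite !Normc.normcM.
rewrite -[X in _ --> X]addr0 -[X in _ --> X + _](mul0r (nrm m)) -[X in _ --> _ + X](mulr0 (nrm l)).
apply: cvgD; first by apply: seq_cvgM => //; exact: ccvg_norm.
by apply: seq_cvgM => //; exact: cvg_cst.
Qed.

Lemma ccvg_unique u l m : ccvg u l -> ccvg u m -> l = m.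
Proof.
move=> ul um; apply/eqP; rewrite -subr_eq0 -normc_eq0; apply/eqP.
have H : (fun=> nrm (l - m)) n @[n --> \oo] --> (0 : R).
  apply: (@ccvg_le _ (fun n => nrm (u n - m) + nrm (u n - l))).
    move=> n; rewrite normc_ge0/= (_ : l - m = (u n - m) - (u n - l)); last by ring.
    by apply: le_trans (ler_normcD _ _) _; rewrite normcN.
  by rewrite -[X in _ --> X]addr0; apply: cvgD.
have H' := @seq_cvg_cst R (nrm (l - m)).
exact: (cvg_unique _ H' H).
Qed.

Lemma ccvg_cst l : ccvg (fun=> l) l.
Proof. by rewrite /ccvg subrr Normc.normc0; exact: cvg_cst. Qed.

Lemma cderiv_ccvg h (x y D : _) (u : nat -> R) : cderiv h (x +i* y) D ->
  u n @[n --> \oo] --> y -> ccvg (fun n => h (x +i* u n)) (h (x +i* y)).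
Proof.
move=> hD uy; apply/cvgr0Pnorm_le => e e0.
have [d d0 dP] := cderiv_continuous_ReIm hD e0.
move/cvgrPdist_lt: uy => /(_ d d0); apply: filterS => n yu.
rewrite ger0_norm ?normc_ge0//; apply: dP.
rewrite (_ : _ - _ = 0 +i* (u n - y)); last by apply/eqP; rewrite eq_complex/= subrr !eqxx.
by rewrite normc_imag distrC.
Qed.

Lemma rlim0D (N1 N2 : R -> \bar R) b : rlim0 N1 b -> rlim0 N2 b ->
  rlim0 (fun y => N1 y + N2 y)%E b.
Proof.
move=> H1 H2 e e0; have e2 : 0 < e / 2 by rewrite divr_gt0.
have [d1 d10 P1] := H1 _ e2; have [d2 d20 P2] := H2 _ e2.
exists (Num.min d1 d2); first by rewrite lt_min d10.
move=> y /andP[y1]; rewrite -ltrBlDl lt_min => /andP[y2 y3].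
rewrite (splitr e) EFinD; apply: leeD; [apply: P1|apply: P2]; apply/andP; split; lra.
Qed.

Lemma rconv_ae gamma h a b g (y_ : nat -> R) : hol h a b -> cmeasurable g ->
  (forall n, b < y_ n < a) ->
  (forall n, (gauss_norm2 gamma (fun x => on_line h (y_ n) x - g x)%R <= (2^-1 ^+ n)%:E)%E) ->
  {ae mu, forall x, ccvg (fun n => h (x +i* y_ n)) (g x)}.
Proof.
move=> hh mg yab le.
have mD n := cmeasurableB (on_line_cmeasurable hh (yab n)) mg.
have := @ae_cvg0 _ _ (fun n => gauss_integrand_measurable gamma (mD n)) _ le.
move=> /(_ (fun n x => gauss_weight_ge0 _ _ _)); apply: ae_imp => x H.
apply/cvgr0Pnorm_le => e e0; set k := expR _ in H.
have k0 : 0 < k by exact: expR_gt0.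
have ek : 0 < e ^+ 2 * k by rewrite mulr_gt0// exprn_gt0.
move/cvgr0Pnorm_le: H => /(_ _ ek); apply: filterS => n.
rewrite (ger0_norm (normc_ge0 _)) ger0_norm; last by rewrite mulr_ge0 ?sqr_ge0// ltW.
by rewrite ler_pM2r// ler_pXn2r// nnegrE ?normc_ge0// ltW.
Qed.

(** Norm convergence gives a.e. convergence only along suitable sequences. The additional quantity
    [N] allows several convergences to be realized along one common sequence. *)
Lemma lower_value_seq a b eps h g (N : R -> \bar R) : b < a -> hol h a b ->
  is_lower_value eps h b g -> (forall y, 0 <= N y)%E -> rlim0 N b ->
  exists y_ : nat -> R, [/\ forall n, b < y_ n < a, y_ n @[n --> \oo] --> b,
    forall n, (N (y_ n) <= (2^-1 ^+ n)%:E)%E &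
    {ae mu, forall x, ccvg (fun n => h (x +i* y_ n)) (g x)}].
Proof.
move=> ba hh /is_lower_valueP[mg gP] N0 NP.
have eg : eps < eps + 1 by lra.
have [y_ [yab yb yP]] := rlim0_seq ba (rlim0D NP (gP _ eg)).
exists y_; split => //.
  move=> n; apply: le_trans (yP n); rewrite leeDl//; exact: gauss_norm2_ge0.
apply: (rconv_ae hh mg yab (gamma := eps + 1)) => n.
by apply: le_trans (yP n); rewrite leeDr.
Qed.

(** Along one sequence of heights both factors and the product converge a.e., and pointwise limits
    are multiplicative. *)
Lemma lower_value_mul a b eps h1 h2 g1 g2 g : b < a -> hol h1 a b -> hol h2 a b ->
  is_lower_value eps h1 b g1 -> is_lower_value eps h2 b g2 ->
  is_lower_value eps (fun z => h1 z * h2 z) b g ->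
  {ae mu, forall x, g x = g1 x * g2 x}.
Proof.
move=> ba hh1 hh2 l1 /is_lower_valueP[m2 l2] /is_lower_valueP[m l].
have eg : eps < eps + 1 by lra.
have N0 y : (0 <= gauss_norm2 (eps + 1) (fun x => on_line h2 y x - g2 x)%R +
   gauss_norm2 (eps + 1) (fun x => on_line (fun z => h1 z * h2 z)%R y x - g x)%R)%E.
  by rewrite adde_ge0// gauss_norm2_ge0.
have [y_ [yab yb yN ae1]] := lower_value_seq ba hh1 l1 N0 (rlim0D (l2 _ eg) (l _ eg)).
have ae2 : {ae mu, forall x, ccvg (fun n => h2 (x +i* y_ n)) (g2 x)}.
  apply: (rconv_ae hh2 m2 yab (gamma := eps + 1)) => n.
  by apply: le_trans (yN n); rewrite leeDl// gauss_norm2_ge0.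
have ae3 : {ae mu, forall x, ccvg (fun n => h1 (x +i* y_ n) * h2 (x +i* y_ n)) (g x)}.
  apply: (rconv_ae (holM hh1 hh2) m yab (gamma := eps + 1)) => n.
  by apply: le_trans (yN n); rewrite leeDr// gauss_norm2_ge0.
apply: ae_imp (ae_and ae1 (ae_and ae2 ae3)) => x [c1 [c2 c3]].
exact: (ccvg_unique c3 (ccvgM c1 c2)).
Qed.

Lemma rlim0_0 b : rlim0 (fun=> 0%E) b.
Proof. by move=> e e0; exists 1 => // y _; rewrite lee_fin ltW. Qed.

Lemma lower_value_interior a b c eps h g : b < c -> c < a -> hol h a b ->
  is_lower_value eps h c g -> {ae mu, forall x, g x = h (x +i* c)}.
Proof.
move=> bc ca hh lv; have hh' : hol h a c by apply: hol_sub hh _ _ => //; exact: ltW.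
have [y_ [yab yc _ ae1]] := lower_value_seq ca hh' lv (fun=> lexx 0%E) (@rlim0_0 c).
apply: ae_imp ae1 => x c1; have [|D hD] := hh (x +i* c); first by [].
exact: (ccvg_unique c1 (cderiv_ccvg hD yc)).
Qed.

End Subsequences.

(** * Outer functions of the strip *)

Section OuterKernel.
Context {R : realType}.
Notation mu := (@lebesgue_measure R).
Notation mfun := (measurable_fun [set: R]).
Notation nrm := Normc.normc.
Implicit Types (al x y t : R) (z : R[i]) (l : R -> R).

(* The exponential [E z = exp (pi z / (2 al))] maps the strip [|Im z| < 2 al]
   onto the plane slit along the negative half-axis, and the line of height
   [- 2 al] onto the slit. *)
Definition sx al t : R := expR (pi / (2 * al) * t).
Definition Ez al z : R[i] := cexp ((pi / (2 * al))%:C * z).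
Definition om al t : R := sx al t / (1 + sx al t) ^+ 2.

(** This is [2s / (1 + s) - 2s / (E + s)]: a Cauchy kernel of the slit minus its value at [E = 1],
    the image of [z = 0]. The subtracted term is real, so it affects only the phase of the outer
    function, and it makes the kernel decay like [om], which is [1 / (4 cosh^2 (pi t / (4 al)))]. *)
Definition kerT (E : R[i]) (s : R) : R[i] :=
  (2 * s / (s + 1))%:C * (1 - (1 + s)%:C / (E + s%:C)).

Lemma sx_gt0 al t : 0 < sx al t. Proof. exact: expR_gt0. Qed.

Lemma om_gt0 al t : 0 < om al t.
Proof. by rewrite divr_gt0 ?sx_gt0// exprn_gt0// addr_gt0 ?sx_gt0. Qed.

Lemma sx_measurable al : mfun (sx al).
Proof.
apply: (@measurableT_comp _ _ _ _ _ _ (@expR R)); first exact: measurable_expR.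
by apply: measurable_funM => //.
Qed.

Lemma EzE al x y : Ez al (x +i* y) =
  (sx al x * cos (pi / (2 * al) * y)) +i* (sx al x * sin (pi / (2 * al) * y)).
Proof.
by rewrite /Ez /cexp /sx; apply/eqP; rewrite eq_complex /= !mul0r subr0 addr0 !eqxx.
Qed.

(** The difference of the two sides is [(1 - cos th) / 2 * (s - r)^2]. *)
Lemma slit_bound (r th s : R) :
  (1 + cos th) / 2 * (s + r) ^+ 2 <= nrm ((r * cos th) +i* (r * sin th) + s%:C) ^+ 2.
Proof.
rewrite normc_sqrE /= addr0.
have -> : (r * cos th + s) ^+ 2 + (r * sin th) ^+ 2 =
    r ^+ 2 * (cos th ^+ 2 + sin th ^+ 2) + 2 * r * s * cos th + s ^+ 2 by ring.
rewrite cos2Dsin2 -subr_ge0.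
rewrite (_ : _ - _ = (1 - cos th) / 2 * (s - r) ^+ 2); last by field.
by rewrite mulr_ge0 ?sqr_ge0// divr_ge0// subr_ge0 cos_le1.
Qed.

Lemma strip_cos al y : 0 < al -> - (2 * al) < y < 2 * al -> 0 < 1 + cos (pi / (2 * al) * y).
Proof.
move=> a0 /andP[y1 y2].
have p0 := pi_gt0 R.
set th := _ * y.
have th1 : - pi < th < pi.
  rewrite /th mulrAC ltr_pdivrMr ?mulr_gt0// ltr_pdivlMr ?mulr_gt0//.
  by rewrite -mulrN1 -mulrA !ltr_pM2l// mulN1r y1.
rewrite (_ : th = th / 2 + th / 2); last by field.
rewrite cosD -!expr2 sin2cos2 (_ : _ + _ = 2 * cos (th / 2) ^+ 2); last by ring.
rewrite mulr_gt0// exprn_gt0// cos_gt0_pihalf//.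
by move: th1 => /andP[? ?]; apply/andP; split; lra.
Qed.

Lemma kernel_lower_bound al z : 0 < al -> strip (2 * al) (- (2 * al)) z ->
  exists2 c : R, 0 < c & forall s, 0 <= s -> c * (1 + s) <= nrm (Ez al z + s%:C).
Proof.
case: z => x y a0 [y1 y2]; rewrite /= in y1 y2.
have c0 : 0 < 1 + cos (pi / (2 * al) * y) by apply: strip_cos => //; rewrite y1.
set k := 1 + _ in c0.
pose c := Num.sqrt (k / 2) * Num.min 1 (sx al x).
have s0 : 0 < Num.sqrt (k / 2) by rewrite sqrtr_gt0 divr_gt0.
exists c; first by rewrite mulr_gt0// lt_min ltr01 sx_gt0.
move=> s sge0.
have mn : Num.min 1 (sx al x) * (1 + s) <= s + sx al x.
  have m1 : Num.min 1 (sx al x) <= 1 by rewrite ge_min lexx.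
  have m2 : Num.min 1 (sx al x) <= sx al x by rewrite ge_min lexx orbT.
  rewrite mulrDr mulr1 addrC lerD//.
  by rewrite -[leRHS]mul1r ler_wpM2r.
have m0 : 0 <= Num.min 1 (sx al x) * (1 + s).
  by rewrite mulr_ge0// ?le_min ?ler01 ?(ltW (sx_gt0 _ _))// addr_ge0.
rewrite -(@ler_pXn2r _ 2)// ?nnegrE ?normc_ge0//; last by rewrite /c -mulrA mulr_ge0// ltW.
rewrite EzE; apply: le_trans (slit_bound _ _ _).
rewrite /c -[X in X ^+ 2 <= _]mulrA exprMn sqr_sqrtr; last by rewrite divr_ge0// ltW.
apply: ler_pM; rewrite ?sqr_ge0 ?divr_ge0 ?(ltW c0)//.
by rewrite lerXn2r// nnegrE// addr_ge0// ltW// sx_gt0.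
Qed.

Lemma kerT_bound (E : R[i]) (c : R) al t : 0 < c ->
  c * (1 + sx al t) <= nrm (E + (sx al t)%:C) ->
  nrm (kerT E (sx al t)) <= (2 * nrm (E - 1) / c) * om al t.
Proof.
move=> c0; have s0 := sx_gt0 al t; rewrite /om; move: (sx al t) s0 => s s0 cb.
have s1 : 0 < 1 + s by lra.
have n0 : 0 < nrm (E + s%:C) by apply: lt_le_trans cb; rewrite mulr_gt0.
have Es : E + s%:C != 0 by rewrite -normc_eq0 gt_eqF.
have -> : kerT E s = (2 * s / (s + 1))%:C * ((E - 1) / (E + s%:C)).
  rewrite /kerT; congr (_ * _); rewrite rmorphD/= rmorph1; field; exact: Es.
rewrite !Normc.normcM Normc.normcV normcR ger0_norm; last by rewrite divr_ge0//; lra.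
have -> : 2 * nrm (E - 1) / c * (s / (1 + s) ^+ 2) =
    2 * s / (s + 1) * (nrm (E - 1) / (c * (1 + s))) by field; rewrite !gt_eqF//; lra.
apply: ler_wpM2l; first by rewrite divr_ge0//; lra.
by apply: ler_wpM2l; rewrite ?normc_ge0// lef_pV2// posrE mulr_gt0.
Qed.

(** The remainder is exactly [- 2s k^2 / ((E + s)^2 (E + k + s))]. Each factor of the denominator is
    bounded below by a multiple of [1 + s]; two of them produce [om], the third only a constant. *)
Lemma kerT_remainder (E k : R[i]) (c : R) al t : 0 < c ->
  c * (1 + sx al t) <= nrm (E + (sx al t)%:C) ->
  nrm k <= c / 2 ->
  nrm (kerT (E + k) (sx al t) - kerT E (sx al t) -
    (2 * sx al t)%:C / (E + (sx al t)%:C) ^+ 2 * k) <= (4 / c ^+ 3) * nrm k ^+ 2 * om al t.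
Proof.
move=> c0; have s0 := sx_gt0 al t; rewrite /om; move: (sx al t) s0 => s s0 cb kc.
have s1 : 0 < 1 + s by lra.
have n0 : 0 < nrm (E + s%:C) by apply: lt_le_trans cb; rewrite mulr_gt0.
have Es : E + s%:C != 0 by rewrite -normc_eq0 gt_eqF.
have cb' : c / 2 * (1 + s) <= nrm (E + k + s%:C).
  have := ler_normcD (E + k + s%:C) (- k); rewrite normcN.
  rewrite (_ : _ + - k = E + s%:C); last by ring.
  have : c / 2 <= c / 2 * (1 + s) by rewrite ler_peMr//; lra.
  by move: cb; rewrite !mulrDr !mulr1 => *; lra.
have n0' : 0 < nrm (E + k + s%:C) by apply: lt_le_trans cb'; rewrite !mulr_gt0.
have Eks : E + k + s%:C != 0 by rewrite -normc_eq0 gt_eqF.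
have s1C : (s%:C + 1 : R[i]) != 0.
  rewrite (_ : s%:C + 1 = (s + 1)%:C); last by rewrite rmorphD rmorph1.
  by rewrite -normc_eq0 normcR normr_eq0 gt_eqF//; lra.
have -> : kerT (E + k) s - kerT E s - (2 * s)%:C / (E + s%:C) ^+ 2 * k =
   - ((2 * s)%:C * k ^+ 2 * ((E + s%:C) ^+ 2)^-1 * (E + k + s%:C)^-1).
  rewrite /kerT rmorphM rmorphM rmorphV ?unitfE ?gt_eqF//; last by lra.
  by rewrite !rmorphD/= !rmorph1; field; rewrite Eks Es s1C.
rewrite normcN !Normc.normcM !Normc.normcV !expr2 !Normc.normcM normcR ger0_norm; last lra.
have -> : 4 / c ^+ 3 * (nrm k * nrm k) * (s / ((1 + s) * (1 + s))) =
  2 * s * (nrm k * nrm k) * (c * (1 + s) * (c * (1 + s)))^-1 * (c / 2 * (1 + s))^-1 * (1 + s).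
  by field; rewrite !gt_eqF//.
apply: (@le_trans _ _ (2 * s * (nrm k * nrm k) * (c * (1 + s) * (c * (1 + s)))^-1 * (c / 2 * (1 + s))^-1)).
  apply: ler_pM.
  - by rewrite !mulr_ge0 ?normc_ge0 ?invr_ge0 ?mulr_ge0 ?normc_ge0//; lra.
  - by rewrite invr_ge0 normc_ge0.
  - apply: ler_wpM2l; first by rewrite !mulr_ge0 ?normc_ge0//; lra.
    rewrite lef_pV2 ?posrE ?mulr_gt0//; apply: ler_pM => //; by rewrite mulr_ge0// ltW.
  - by rewrite lef_pV2 ?posrE ?mulr_gt0.
rewrite ler_peMr//; last by lra.
by rewrite !mulr_ge0 ?invr_ge0 ?mulr_ge0 ?normc_ge0//; lra.
Qed.

End OuterKernel.

(** * Construction of outer functions *)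

Section OuterFunction.
Context {R : realType}.
Notation mu := (@lebesgue_measure R).
Notation mfun := (measurable_fun [set: R]).
Notation nrm := Normc.normc.
Implicit Types (al x y t : R) (z : R[i]) (l : R -> R) (K : R -> R[i]).

Definition wint al l := mfun l /\ mu.-integrable setT (EFin \o (fun t => l t * om al t)).

Lemma measurable_inv_pos (f : R -> R) : mfun f -> (forall x, 0 < f x) -> mfun (fun x => (f x)^-1).
Proof.
move=> mf f0; rewrite (_ : (fun _ => _) = (fun x => f x `^ (-1))).
  by apply: (@measurableT_comp _ _ _ _ _ _ (@powR R ^~ (-1))) => //; exact: measurable_powR.
by apply/funext => x; rewrite powR_inv1// ltW.
Qed.

Lemma om_measurable al : mfun (om al).
Proof.
have m1 := sx_measurable al.
apply: measurable_funM => //.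
have m2 : mfun (fun t => (1 + sx al t) ^+ 2).
  by apply: measurable_funX; apply: measurable_funD.
apply: (measurable_inv_pos m2) => t.
by rewrite exprn_gt0// addr_gt0// sx_gt0.
Qed.

Lemma normr_om al (r : R) t : `|r * om al t| = `|r| * om al t.
Proof. by rewrite normrM [X in _ * X]ger0_norm// ltW// om_gt0. Qed.

Definition kbound al (C : R) K := cmeasurable K /\ forall t, nrm (K t) <= C * om al t.

Definition cint K l : R[i] :=
  (\int[mu]_t (complex.Re (K t) * l t)) +i* (\int[mu]_t (complex.Im (K t) * l t)).

Lemma kbound_integrable al C K l (p : R[i] -> R) : kbound al C K -> wint al l ->
  mfun (p \o K) -> (forall z, `|p z| <= nrm z) ->
  mu.-integrable setT (EFin \o (fun t => p (K t) * l t)).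
Proof.
move=> [mK bK] [ml il] mpK pK.
apply: (@integrable_le _ _ (fun t => C * `|l t * om al t|)).
- exact: measurable_funM.
- move=> t; rewrite normrM normr_om [leRHS]mulrCA [leLHS]mulrC ler_wpM2l//.
  by rewrite (le_trans (pK _)).
- exact: (integrableZl measurableT C (integrable_norm il)).
Qed.

Lemma kbound_integrable_Re al C K l : kbound al C K -> wint al l ->
  mu.-integrable setT (EFin \o (fun t => complex.Re (K t) * l t)).
Proof.
move=> kK wl; apply: (kbound_integrable (p := @complex.Re R) kK wl); last exact: ler_Re_normc.
by case: kK => -[].
Qed.

Lemma kbound_integrable_Im al C K l : kbound al C K -> wint al l ->
  mu.-integrable setT (EFin \o (fun t => complex.Im (K t) * l t)).
Proof.
move=> kK wl; apply: (kbound_integrable (p := @complex.Im R) kK wl); last exact: ler_Im_normc.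
by case: kK => -[].
Qed.

Lemma cint_bound al C K l : kbound al C K -> wint al l ->
  nrm (cint K l) <= 2 * (C * \int[mu]_t `|l t * om al t|).
Proof.
move=> kK wl; apply: le_trans (ler_normc_ReIm _) _.
have part (p : R[i] -> R) : (forall z, `|p z| <= nrm z) ->
   mu.-integrable setT (EFin \o (fun t => p (K t) * l t)) ->
   `|\int[mu]_t (p (K t) * l t)| <= C * \int[mu]_t `|l t * om al t|.
  move=> pK ip; have [ml il] := wl; have [mK bK] := kK.
  apply: le_trans (le_normr_Rintegral _ ip) _; first by [].
  rewrite -RintegralZl//; last exact: (integrable_norm il).
  apply: le_Rintegral => //.
  - exact: (integrable_norm ip).
  - exact: (integrableZl measurableT C (integrable_norm il)).
  - move=> t _; rewrite normrM normr_om [leRHS]mulrCA [leLHS]mulrC ler_wpM2l//.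
    by rewrite (le_trans (pK _)).
rewrite mulr2n mulrDl mul1r; apply: lerD.
  by apply: (part (@complex.Re R)); [exact: ler_Re_normc|exact: kbound_integrable_Re kK wl].
by apply: (part (@complex.Im R)); [exact: ler_Im_normc|exact: kbound_integrable_Im kK wl].
Qed.

Lemma cintB al C1 C2 K1 K2 l : kbound al C1 K1 -> kbound al C2 K2 -> wint al l ->
  cint (fun t => K1 t - K2 t) l = cint K1 l - cint K2 l.
Proof.
move=> k1 k2 wl.
apply/eqP; rewrite eq_complex /=; apply/andP; split; apply/eqP.
  rewrite -RintegralB//; last 2 first.
  - exact: kbound_integrable_Re k1 wl.
  - exact: kbound_integrable_Re k2 wl.
  by apply: eq_Rintegral => t _; rewrite raddfB/= mulrBl.
rewrite -RintegralB//; last 2 first.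
- exact: kbound_integrable_Im k1 wl.
- exact: kbound_integrable_Im k2 wl.
by apply: eq_Rintegral => t _; rewrite raddfB/= mulrBl.
Qed.

Lemma cintZ al C K l (k : R[i]) : kbound al C K -> wint al l ->
  cint (fun t => K t * k) l = cint K l * k.
Proof.
move=> kK wl; have iR := kbound_integrable_Re kK wl; have iI := kbound_integrable_Im kK wl.
case: k => p q; apply/eqP; rewrite eq_complex /=; apply/andP; split; apply/eqP.
  rewrite -!RintegralZr// -RintegralB//.
  - by apply: eq_Rintegral => t _; case: (K t) => a b /=; ring.
  - exact: (integrableZr measurableT p iR).
  - exact: (integrableZr measurableT q iI).
rewrite -!RintegralZr// -RintegralD//.
- by apply: eq_Rintegral => t _; case: (K t) => a b /=; ring.
- exact: (integrableZr measurableT q iR).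
- exact: (integrableZr measurableT p iI).
Qed.

Lemma cmeasurableV K : cmeasurable K -> (forall t, K t != 0) -> cmeasurable (fun t => (K t)^-1).
Proof.
move=> mK K0; have [m1 m2] := mK.
have n0 t : 0 < complex.Re (K t) ^+ 2 + complex.Im (K t) ^+ 2.
  by rewrite -normc_sqrE exprn_gt0// lt_def normc_eq0 K0 normc_ge0.
have mn : mfun (fun t => (complex.Re (K t) ^+ 2 + complex.Im (K t) ^+ 2)^-1).
  by apply: (measurable_inv_pos _ n0); apply: measurable_funD; exact: measurable_funX.
split.
  rewrite (_ : (fun _ => _) = (fun t => complex.Re (K t) * (complex.Re (K t) ^+ 2 + complex.Im (K t) ^+ 2)^-1)).
    exact: measurable_funM.
  by apply/funext => t; case: (K t).
rewrite (_ : (fun _ => _) = (fun t => - (complex.Im (K t) * (complex.Re (K t) ^+ 2 + complex.Im (K t) ^+ 2)^-1))).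
  by apply: measurable_funN; exact: measurable_funM.
by apply/funext => t; case: (K t) => a b /=.
Qed.

Lemma cmeasurable_real (f : R -> R) : mfun f -> cmeasurable (fun t => (f t)%:C).
Proof. by move=> mf; split => /=; [exact: mf|exact: measurable_cst]. Qed.

Lemma cmeasurable_cst (c : R[i]) : cmeasurable (fun=> c : R[i]).
Proof. by split; exact: measurable_cst. Qed.

Lemma cmeasurableD g h : cmeasurable g -> cmeasurable h -> cmeasurable (fun t : R => g t + h t : R[i]).
Proof.
move=> mg mh; have := cmeasurableB mg (cmeasurableB (cmeasurable_cst 0) mh).
by under [X in cmeasurable X]eq_fun do rewrite sub0r opprK.
Qed.

Lemma kerT_cmeasurable al (E : R[i]) : (forall t, E + (sx al t)%:C != 0) ->
  cmeasurable (fun t => kerT E (sx al t)).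
Proof.
move=> E0; have ms := sx_measurable al.
have m1 : cmeasurable (fun t => E + (sx al t)%:C).
  by apply: cmeasurableD; [exact: cmeasurable_cst|exact: cmeasurable_real].
apply: cmeasurableM.
  apply: cmeasurable_real; apply: measurable_funM; first by apply: measurable_funM.
  apply: measurable_inv_pos; first by apply: measurable_funD.
  by move=> t; rewrite addr_gt0// sx_gt0.
apply: cmeasurableB; first exact: cmeasurable_cst.
apply: cmeasurableM; last exact: cmeasurableV.
by apply: cmeasurable_real; exact: measurable_funD.
Qed.

Definition theta al l (E : R[i]) := cint (fun t => kerT E (sx al t)) l.

Definition slit_dist (E : R[i]) c := 0 < c /\ forall s, 0 <= s -> c * (1 + s) <= nrm (E + s%:C).

Lemma slit_dist_neq0 al E c t : slit_dist E c -> E + (sx al t)%:C != 0.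
Proof.
move=> [c0 H]; rewrite -normc_eq0 gt_eqF//; apply: lt_le_trans (H _ (ltW (sx_gt0 al t))).
by rewrite mulr_gt0// addr_gt0// sx_gt0.
Qed.

Lemma kerT_kbound al E c : slit_dist E c ->
  kbound al (2 * nrm (E - 1) / c) (fun t => kerT E (sx al t)).
Proof.
move=> sE; split; first by apply: kerT_cmeasurable => t; exact: slit_dist_neq0 sE.
by move=> t; have [c0 H] := sE; apply: kerT_bound => //; apply: H; rewrite ltW// sx_gt0.
Qed.

Lemma slit_dist_near E c k : slit_dist E c -> nrm k <= c / 2 -> slit_dist (E + k) (c / 2).
Proof.
move=> [c0 H] kc; split; first by rewrite divr_gt0.
move=> s s0; have := H _ s0; have := ler_normcD (E + k + s%:C) (- k); rewrite normcN.
rewrite (_ : _ + - k = E + s%:C); last by ring.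
have : c / 2 <= c / 2 * (1 + s) by rewrite ler_peMr//; lra.
by rewrite !mulrDr !mulr1 => *; lra.
Qed.

(** Differentiation under the integral sign: the second-order remainder of the kernel is bounded by
    [|k|^2] times [om], uniformly in [t], and this bound is integrated against [l]. *)
Lemma cderiv_theta al l E c : wint al l -> slit_dist E c -> exists D, cderiv (theta al l) E D.
Proof.
move=> wl sE; have [c0 H] := sE.
have Hs t : c * (1 + sx al t) <= nrm (E + (sx al t)%:C) by apply: H; rewrite ltW// sx_gt0.
pose d t := (2 * sx al t)%:C / (E + (sx al t)%:C) ^+ 2.
have E0 t := slit_dist_neq0 al t sE.
have ms := sx_measurable al.
have md : cmeasurable d.
  apply: cmeasurableM; first by apply: cmeasurable_real; apply: measurable_funM.
  apply: cmeasurableV; last by move=> t; rewrite expf_neq0.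
  have m1 : cmeasurable (fun t => E + (sx al t)%:C).
    by apply: cmeasurableD; [exact: cmeasurable_cst|exact: cmeasurable_real].
  by under eq_fun do rewrite expr2; exact: cmeasurableM.
have kd : kbound al (2 / c ^+ 2) d.
  split => // t; rewrite /d /om.
  have s0 := sx_gt0 al t; have := Hs t; move: (sx al t) s0 => s s0 hs.
  rewrite Normc.normcM Normc.normcV expr2 Normc.normcM normcR ger0_norm; last lra.
  have cs : 0 < c * (1 + s) by rewrite mulr_gt0//; lra.
  have -> : 2 / c ^+ 2 * (s / (1 + s) ^+ 2) = 2 * s * (c * (1 + s) * (c * (1 + s)))^-1.
    by field; rewrite !gt_eqF//; lra.
  apply: ler_wpM2l; first lra.
  have n0 : 0 < nrm (E + s%:C) by exact: lt_le_trans cs hs.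
  rewrite lef_pV2 ?posrE; [|exact: (mulr_gt0 n0 n0)|exact: (mulr_gt0 cs cs)].
  by apply: ler_pM => //; exact: ltW.
exists (cint d l).
apply: (@cderiv_quadratic _ _ _ _ (2 * (4 / c ^+ 3 * \int[mu]_t `|l t * om al t|)) (c / 2)).
  by rewrite divr_gt0.
move=> k /ltW kc; have sEk := slit_dist_near sE kc.
have k1 := kerT_kbound al sEk; have k2 := kerT_kbound al sE.
pose r t := kerT (E + k) (sx al t) - kerT E (sx al t) - d t * k.
have k12 : kbound al (2 * nrm (E + k - 1) / (c / 2) + 2 * nrm (E - 1) / c)
     (fun t => kerT (E + k) (sx al t) - kerT E (sx al t)).
  split; first by apply: cmeasurableB; [case: k1|case: k2].
  move=> t; apply: le_trans (ler_normcD _ _) _; rewrite normcN mulrDl.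
  by apply: lerD; [case: k1|case: k2].
have kdk : kbound al (2 / c ^+ 2 * nrm k) (fun t => d t * k).
  split; first by apply: cmeasurableM => //; exact: cmeasurable_cst.
  by move=> t; rewrite Normc.normcM mulrAC ler_wpM2r ?normc_ge0//; case: kd.
have kr : kbound al (4 / c ^+ 3 * nrm k ^+ 2) r.
  split; first by apply: cmeasurableB; [case: k12|case: kdk].
  by move=> t; apply: kerT_remainder.
rewrite /theta -(cintB k1 k2 wl) -(cintZ k kd wl) -(cintB k12 kdk wl).
apply: le_trans (cint_bound kr wl) _.
by rewrite le_eqVlt; apply/orP; left; apply/eqP; ring.
Qed.

(** The factor [i / (4 al)] makes the logarithm of the modulus equal to [- (4 al)^-1] times the
    imaginary part of [theta], which is the Poisson integral of [l] by [pk_kerT]. *)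
Definition outer al l z : R[i] := cexp ((0 +i* (4 * al)^-1) * theta al l (Ez al z)).

Lemma hol_outer al l : 0 < al -> wint al l -> hol (outer al l) (2 * al) (- (2 * al)).
Proof.
move=> a0 wl z zs; have [c c0 H] := kernel_lower_bound a0 zs.
have sE : slit_dist (Ez al z) c by [].
have [D1 h1] := cderiv_theta wl sE.
have h0 : cderiv (Ez al) z (cexp ((pi / (2 * al))%:C * z) * ((pi / (2 * al))%:C * 1)).
  by apply: (@cderiv_comp _ (fun z => (pi / (2 * al))%:C * z) cexp);
    [exact: cderivZ (cderiv_id _)|exact: cderiv_cexp].
by eexists; apply: (@cderiv_comp _ (fun z => (0 +i* (4 * al)^-1) * theta al l (Ez al z)) cexp);
  [exact: cderivZ (cderiv_comp h0 h1)|exact: cderiv_cexp].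
Qed.

End OuterFunction.

(** * The Poisson kernel of the half-strip *)

Section PoissonKernel.
Context {R : realType}.
Notation mu := (@lebesgue_measure R).
Notation mfun := (measurable_fun [set: R]).
Notation nrm := Normc.normc.
Implicit Types (al x y t : R) (z : R[i]) (l : R -> R).

Lemma FTC_is_derive (F f : R -> R) p q : p < q -> (forall t, is_derive t 1 F (f t)) ->
  continuous f -> (\int[mu]_(t in `[p, q]) (f t)%:E = (F q - F p)%:E)%E.
Proof.
move=> pq dF cf; have cF : continuous F.
  by move=> t; apply: differentiable_continuous; apply/derivable1_diffP; case: (dF t).
rewrite (@continuous_FTC2 _ f F)// ?EFinB//.
- exact: continuous_subspaceT.
- split => [t _| |].
  + by case: (dF t).
  + by apply: cvg_at_right_filter; exact: cF.
  + by apply: cvg_at_left_filter; exact: cF.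
- by move=> t _; rewrite derive1E; case: (dF t).
Qed.

Definition sn al y : R := - sin (pi / (2 * al) * y).
Definition cs al y : R := cos (pi / (2 * al) * y).

Definition pden al x y t : R :=
  sx al x ^+ 2 + 2 * sx al x * sx al t * cs al y + sx al t ^+ 2.

(* For [- 2 al < y < 0] this is the Poisson kernel of the lower half of the strip
   for the edge of height [- 2 al]; it is odd in [y]. *)
Definition pk al x y t : R := (2 * al)^-1 * (sx al t * sx al x * sn al y / pden al x y t).

Lemma sn_gt0 al y : 0 < al -> - (2 * al) < y < 0 -> 0 < sn al y.
Proof.
move=> a0 /andP[y1 y2]; rewrite /sn -sinN; apply: sin_gt0_pi; have p0 := pi_gt0 R.
rewrite -mulrN; apply/andP; split; first by rewrite mulr_gt0 ?divr_gt0 ?mulr_gt0// oppr_gt0.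
rewrite mulrAC ltr_pdivrMr ?mulr_gt0// ltr_pM2l//; lra.
Qed.

Lemma cs_sn al y : cs al y ^+ 2 + sn al y ^+ 2 = 1.
Proof. by rewrite /cs /sn sqrrN cos2Dsin2. Qed.

Lemma cs_gtN1 al y : 0 < al -> - (2 * al) < y < 2 * al -> 0 < 1 + cs al y.
Proof. exact: strip_cos. Qed.

Lemma pdenE al x y t : pden al x y t =
  (sx al t + sx al x * cs al y) ^+ 2 + (sx al x * sn al y) ^+ 2.
Proof.
rewrite /pden (_ : _ + (_ * sn _ _) ^+ 2 = sx al t ^+ 2 + 2 * sx al x * sx al t * cs al y +
   sx al x ^+ 2 * (cs al y ^+ 2 + sn al y ^+ 2)); last by ring.
by rewrite cs_sn; ring.
Qed.

Lemma pden_ge al x y t : 0 < 1 + cs al y ->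
  (1 + cs al y) / 2 * (sx al t + sx al x) ^+ 2 <= pden al x y t.
Proof.
move=> c0; rewrite -subr_ge0 (_ : _ - _ = (1 - cs al y) / 2 * (sx al t - sx al x) ^+ 2).
  by rewrite mulr_ge0 ?sqr_ge0// divr_ge0// subr_ge0 cos_le1.
by rewrite /pden; field.
Qed.

Lemma pden_gt0 al x y t : 0 < 1 + cs al y -> 0 < pden al x y t.
Proof.
move=> c0; apply: lt_le_trans (pden_ge _ _ c0).
by rewrite mulr_gt0 ?divr_gt0// exprn_gt0// addr_gt0 ?sx_gt0.
Qed.

(** Symmetry turns the bound on the mass in [t] into one on the mass in [x], which makes the Poisson
    integral a contraction of [L^1]. *)
Lemma pk_sym al x y t : pk al x y t = pk al t y x.
Proof. by rewrite /pk /pden; congr (_ * (_ / _)); ring. Qed.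

(** This oddness is why the modulus of an outer function is inverted by reflection in the real
    axis. *)
Lemma pk_opp al x y t : pk al x (- y) t = - pk al x y t.
Proof.
have Es : sn al (- y) = - sn al y by rewrite /sn mulrN sinN.
have Ec : cs al (- y) = cs al y by rewrite /cs mulrN cosN.
by rewrite /pk /pden Es Ec !(mulrN, mulNr).
Qed.

Lemma pk0 al x t : pk al x 0 t = 0.
Proof. by rewrite /pk /sn mulr0 sin0 oppr0 !(mulr0, mul0r). Qed.

Lemma pk_gt0 al x y t : 0 < al -> - (2 * al) < y < 0 -> 0 < pk al x y t.
Proof.
move=> a0 yy; have sp := sn_gt0 a0 yy; have /andP[y1 y2] := yy.
apply: mulr_gt0; first by rewrite invr_gt0 mulr_gt0.
apply: divr_gt0; first by rewrite !mulr_gt0 ?sx_gt0.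
by apply: pden_gt0; apply: cs_gtN1 => //; apply/andP; split; lra.
Qed.

Lemma pk_kerT al x y t : 0 < al -> - (2 * al) < y < 2 * al ->
  pk al x y t = - (4 * al)^-1 * complex.Im (kerT (Ez al (x +i* y)) (sx al t)).
Proof.
move=> a0 yy; have d0 := pden_gt0 x t (cs_gtN1 a0 yy).
have s0 := sx_gt0 al t.
rewrite EzE -/(cs al y) /pk /kerT.
have -> : sin (pi / (2 * al) * y) = - sn al y by rewrite /sn opprK.
move: (pdenE al x y t) d0 => E d0.
have E0 : (sx al x * cs al y + sx al t) ^+ 2 + (sx al x * - sn al y + 0) ^+ 2 = pden al x y t.
  by rewrite E; ring.
rewrite /= E0 /=; field.
by rewrite !gt_eqF// addr_gt0.
Qed.

Lemma nrm_outer al l x y : 0 < al -> - (2 * al) < y < 2 * al -> wint al l ->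
  nrm (outer al l (x +i* y)) = expR (\int[mu]_t (pk al x y t * l t)).
Proof.
move=> a0 yy wl.
have zs : strip (2 * al) (- (2 * al)) (x +i* y) by move/andP: yy.
have [c c0 H] := kernel_lower_bound a0 zs.
have sE : slit_dist (Ez al (x +i* y)) c by [].
have iI := kbound_integrable_Im (kerT_kbound al sE) wl.
rewrite normc_cexp /theta /cint; congr expR; rewrite [LHS]/= mul0r sub0r -mulNr -RintegralZl//.
by apply: eq_Rintegral => t _; rewrite pk_kerT// mulrA.
Qed.

Lemma pk_integrable al l x y : 0 < al -> - (2 * al) < y < 2 * al -> wint al l ->
  mu.-integrable setT (EFin \o (fun t => pk al x y t * l t)).
Proof.
move=> a0 yy wl.
have zs : strip (2 * al) (- (2 * al)) (x +i* y) by move/andP: yy.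
have [c c0 H] := kernel_lower_bound a0 zs.
have sE : slit_dist (Ez al (x +i* y)) c by [].
have iI := kbound_integrable_Im (kerT_kbound al sE) wl.
rewrite (_ : EFin \o _ = EFin \o (fun t => - (4 * al)^-1 *
   (complex.Im (kerT (Ez al (x +i* y)) (sx al t)) * l t))).
  exact: (integrableZl measurableT _ iI).
by apply/funext => t /=; rewrite pk_kerT// mulrA.
Qed.

Lemma is_derive_sx al t : is_derive t 1 (sx al) (pi / (2 * al) * sx al t).
Proof.
rewrite /sx; have h : is_derive t 1 (fun t : R => pi / (2 * al) * t) (pi / (2 * al)).
  have := @is_deriveZ _ _ _ id (pi / (2 * al)) t 1 1 (is_derive_id _ _).
  by move=> h; apply: is_derive_eq h _; rewrite /GRing.scale/= mulr1.
by apply: is_derive_eq (is_derive1_comp (is_derive_expR (pi / (2 * al) * t)) h) _; rewrite mulrC.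
Qed.

(** In the variable [s = sx al t] the kernel is a Cauchy density with centre [- sx x * cs y] and
    scale [sx x * sn y]; hence the arctangent and the factor [1 / pi]. *)
Definition pkprim al x y t := pi^-1 * atan ((sx al t + sx al x * cs al y) / (sx al x * sn al y)).

Lemma sx_continuous al : continuous (sx al).
Proof.
move=> t; apply: differentiable_continuous; apply/derivable1_diffP.
by case: (is_derive_sx al t).
Qed.

Lemma pk_continuous al x y : 0 < al -> - (2 * al) < y < 2 * al -> continuous (pk al x y).
Proof.
move=> a0 yy t; have cx := @sx_continuous al t.
have cd : pden al x y t' @[t' --> t] --> pden al x y t.
  rewrite /pden; apply: cvgD; last first.
    by rewrite expr2; under eq_fun do rewrite expr2; exact: cvgM.
  apply: cvgD; first exact: cvg_cst.
  apply: cvgM; last exact: cvg_cst.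
  by apply: cvgM => //; exact: cvg_cst.
rewrite /pk; apply: cvgM; first exact: cvg_cst.
apply: cvgM; last by apply: cvgV => //; rewrite gt_eqF// pden_gt0// cs_gtN1.
apply: cvgM; last exact: cvg_cst.
by apply: cvgM => //; exact: cvg_cst.
Qed.

Lemma is_derive_pk_primitive al x y t : 0 < al -> - (2 * al) < y < 0 ->
  is_derive t 1 (pkprim al x y) (pk al x y t).
Proof.
move=> a0 yy; have sp := sn_gt0 a0 yy; have x0 := sx_gt0 al x; have p0 := pi_gt0 R.
have xs : 0 < sx al x * sn al y by rewrite mulr_gt0.
pose k := (sx al x * sn al y)^-1; pose m := sx al x * cs al y.
have h1 : is_derive t 1 (fun t => (sx al t + m) * k) (pi / (2 * al) * sx al t * k).
  have := @is_deriveM _ _ (fun t => sx al t + m) (cst k) t 1 _ _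
     (is_deriveD (is_derive_sx al t) (is_derive_cst m t 1)) (is_derive_cst k t 1).
  move=> H; apply: is_derive_eq H _.
  by rewrite /GRing.scale/= mulr0 add0r addr0 mulrC.
have h2 := @is_derive1_comp _ _ (fun t => (sx al t + m) * k) t _ _
  (is_derive1_atan ((sx al t + m) * k)) h1.
have h3 := @is_deriveZ _ _ _ _ pi^-1 t 1 _ h2.
apply: is_derive_eq h3 _.
have d0 : pden al x y t != 0.
  by rewrite gt_eqF// pden_gt0// cs_gtN1//; move/andP: yy => [? ?]; apply/andP; split; lra.
rewrite /GRing.scale/= /pk.
have E : 1 + ((sx al t + m) * k) ^+ 2 = pden al x y t * k ^+ 2.
  by rewrite pdenE /k /m; field; rewrite !gt_eqF.
rewrite E /k; clear -a0 sp x0 p0 d0.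
move: (pden al x y t) (sx al x) (sx al t) (sn al y) (pi : R) d0 x0 sp p0 => d r s q p d0 x0 sp p0.
by field; rewrite d0 !gt_eqF.
Qed.

End PoissonKernel.

(** * Mass and concentration of the Poisson kernel *)

Section PoissonMass.
Context {R : realType}.
Notation mu := (@lebesgue_measure R).
Notation mfun := (measurable_fun [set: R]).
Notation nrm := Normc.normc.
Implicit Types (al x y t : R) (z : R[i]) (l : R -> R).

Lemma strip_wide al y : 0 < al -> - (2 * al) < y < 0 -> - (2 * al) < y < 2 * al.
Proof. by move=> a0 /andP[? ?]; apply/andP; split; lra. Qed.

Lemma pk_itv al x y p q : 0 < al -> - (2 * al) < y < 0 -> p < q ->
  (\int[mu]_(t in `[p, q]) (pk al x y t)%:E = (pkprim al x y q - pkprim al x y p)%:E)%E.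
Proof.
move=> a0 yy pq; apply: FTC_is_derive => //.
- by move=> t; exact: is_derive_pk_primitive.
- by apply: pk_continuous => //; exact: strip_wide.
Qed.

Lemma pk_measurable al x y : 0 < al -> - (2 * al) < y < 2 * al -> mfun (pk al x y).
Proof. by move=> a0 yy; apply: continuous_measurable_fun; exact: pk_continuous. Qed.

Lemma pk_mass al x y : 0 < al -> - (2 * al) < y < 0 -> (\int[mu]_t (pk al x y t)%:E <= 1)%E.
Proof.
move=> a0 yy; have p0 := pi_gt0 R; have mpk := pk_measurable x a0 (strip_wide a0 yy).
have pk0' t : 0 <= pk al x y t by rewrite ltW// pk_gt0.
(* The successor keeps the interval nondegenerate, as [pk_itv] requires. *)
have mI (n : nat) : mfun (\1_(`[- n.+1%:R, n.+1%:R]%classic) : R -> R).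
  by apply: measurable_indic; exact: measurable_itv.
apply: (@fatou_ae _ (fun n t => pk al x y t * \1_(`[- n.+1%:R, n.+1%:R]%classic) t)) => //.
- by move=> n; exact: (measurable_funM mpk (mI n)).
- by move=> n t; rewrite mulr_ge0.
- apply: ae_every => t; apply: cvg_near_cst.
  exists (Num.bound `|t|) => // n /= nt; rewrite indicE mem_set ?mulr1//= in_itv/= -ler_norml.
  rewrite (le_trans (ltW (archi_boundP _)))// ler_nat; exact: leq_trans nt _.
- apply: nearW => n.
  pose p : R := n.+1%:R; rewrite (_ : (\int[mu]_t _)%E = (\int[mu]_(t in `[(- p)%R, p]) (pk al x y t)%:E)%E).
    rewrite pk_itv//; last by rewrite (@lt_le_trans _ _ 0)// oppr_lt0.
    rewrite lee_fin /pkprim -mulrBr mulrC ler_pdivrMr// mul1r.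
    set u := _ / _; set v := _ / _.
    by have := atan_ltpi2 u; have := atan_gtNpi2 v; lra.
  rewrite [RHS]integral_mkcond; apply: eq_integral => t _.
  by rewrite patchE indicE; case: ifPn; rewrite ?mulr1 ?mulr0.
Qed.

Lemma pk_integrable1 al x y : 0 < al -> - (2 * al) < y < 0 ->
  mu.-integrable setT (EFin \o pk al x y).
Proof.
move=> a0 yy; apply: nint_integrable.
- exact: pk_measurable (strip_wide a0 yy).
- by move=> t; rewrite ltW// pk_gt0.
- exact: le_lt_trans (pk_mass _ a0 yy) (ltry _).
Qed.

Lemma sn_cs_limit al e : 0 < al -> 0 < e -> exists2 d : R, 0 < d &
  forall y, - (2 * al) < y < - (2 * al) + d -> sn al y <= e /\ cs al y <= -1 + e.
Proof.
move=> a0 e0; have p0 := pi_gt0 R.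
pose k := pi / (2 * al); have k0 : 0 < k by rewrite divr_gt0// mulr_gt0.
have kE : k * - (2 * al) = - pi by rewrite /k; field; rewrite gt_eqF.
have := @continuous_sin R (- pi); move/cvgrPdist_le => /(_ e e0)[d1 /= d10 P1].
have := @continuous_cos R (- pi); move/cvgrPdist_le => /(_ e e0)[d2 /= d20 P2].
exists (Num.min d1 d2 / k); first by rewrite divr_gt0// lt_min d10.
move=> y /andP[y1]; rewrite -ltrBlDl ltr_pdivlMr// lt_min => /andP[y2 y3].
have ky : `|- pi - k * y| = (y - - (2 * al)) * k.
  rewrite -kE -mulrBr normrM (ger0_norm (ltW k0)) mulrC distrC ger0_norm//; lra.
have := P1 (k * y); rewrite /ball_/= ky => /(_ y2).
have := P2 (k * y); rewrite /ball_/= ky => /(_ y3).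
rewrite sinN sinpi oppr0 cosN cospi !ler_norml => /andP[h1 h2] /andP[h3 h4].
by rewrite /sn /cs -/k; split; lra.
Qed.

Lemma sxD al x t : sx al (x + t) = sx al x * sx al t.
Proof. by rewrite /sx mulrDr expRD. Qed.

(** As [sx] is multiplicative, [x] cancels from the arguments of the arctangent at [x + d] and
    [x - d]. Near the edge [cs y] tends to [-1] and [sn y] to [0], while [sx (-d) < 1 < sx d], so
    the two arguments tend to opposite infinities, uniformly in [x]. *)
Lemma pk_near_mass al (d e : R) : 0 < al -> 0 < d -> 0 < e -> exists2 d0 : R, 0 < d0 &
  forall y, - (2 * al) < y < - (2 * al) + d0 -> y < 0 -> forall x,
  ((1 - e)%:E <= \int[mu]_(t in `[(x - d)%R, (x + d)%R]) (pk al x y t)%:E)%E.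
Proof.
move=> a0 d0 e0; have p0 := pi_gt0 R.
(* Each end may lose [e pi / 2] of the arctangent, so that after division by [pi] the mass loses at
   most [e]. *)
have [A AP] : exists A : R, forall u, A < u -> pi / 2 - e * pi / 2 <= atan u.
  have := @cvgy_atan R; move/cvgrPdist_le => /(_ (e * pi / 2)).
  rewrite divr_gt0 ?mulr_gt0// => /(_ isT)[A [_ AP]]; exists A => u /AP.
  by rewrite ler_norml => /andP[? ?]; lra.
have k0 : 0 < pi / (2 * al) * d by rewrite mulr_gt0 ?divr_gt0 ?mulr_gt0.
pose X := sx al d - 1; pose Y := 1 - sx al (- d).
have X0 : 0 < X by rewrite subr_gt0 /sx -[ltLHS]expR0 ltr_expR.
have Y0 : 0 < Y by rewrite subr_gt0 /sx -[ltRHS]expR0 ltr_expR mulrN oppr_lt0.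
pose B := `|A| + 1; have B0 : 0 < B by rewrite ltr_wpDl.
(* At the upper end [cs >= -1] leaves the gap [X]; at the lower end [cs <= -1 + e'] leaves
   [Y - e' >= Y / 2]. Divided by [sn <= e'], both exceed [B]. *)
pose e' := Num.min (X / B) (Num.min (Y / 2 / B) (Y / 2)).
have e'0 : 0 < e' by rewrite /e' !lt_min !divr_gt0.
have e'1 : e' <= X / B by rewrite /e' ge_min lexx.
have e'2 : e' <= Y / 2 / B by rewrite /e' !ge_min lexx orbT.
have e'3 : e' <= Y / 2 by rewrite /e' !ge_min lexx !orbT.
have [d1 d10 dP] := sn_cs_limit a0 e'0.
exists d1 => // y yd y0 x; have [s1 c1] := dP y yd.
have yy : - (2 * al) < y < 0 by move/andP: yd => [-> _].
have sp := sn_gt0 a0 yy; have x0 := sx_gt0 al x.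
rewrite pk_itv//; last by lra.
rewrite lee_fin /pkprim.
have E t : (sx al (x + t) + sx al x * cs al y) / (sx al x * sn al y) = (sx al t + cs al y) / sn al y.
  by rewrite sxD; field; rewrite !gt_eqF.
rewrite (E d) (E (- d)); have A1 : A < B by rewrite /B ltr_pwDr// ler_norm.
have u1 : B <= (sx al d + cs al y) / sn al y.
  rewrite ler_pdivlMr//; apply: (@le_trans _ _ (B * (X / B))).
    by rewrite ler_wpM2l ?(ltW B0)// (le_trans s1).
  rewrite [leLHS]mulrC divfK ?gt_eqF// /X; have /andP[+ _] : -1 <= cs al y <= 1 by rewrite cos_geN1 cos_le1.
  by lra.
have u2 : B <= - ((sx al (- d) + cs al y) / sn al y).
  rewrite -mulNr ler_pdivlMr//; apply: (@le_trans _ _ (B * (Y / 2 / B))).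
    by rewrite ler_wpM2l ?(ltW B0)// (le_trans s1).
  rewrite [leLHS]mulrC divfK ?gt_eqF//; move: e'3 s1 c1; rewrite /Y; lra.
have v1 := AP _ (lt_le_trans A1 u1); have v2 := AP _ (lt_le_trans A1 u2).
rewrite atanN in v2.
rewrite -mulrBr mulrC ler_pdivlMr//; lra.
Qed.

(** Points at distance [d] have [|sx t - sx x|] at least [q / 2] times [sx t + sx x], and [pden] is
    at least the square of this difference. The factor [sn al y] remains and tends to zero at the
    edge. *)
Lemma pk_far al N d : 0 < al -> 0 < d -> exists2 C : R, 0 <= C &
  forall x t y, - N <= x <= N -> d <= `|t - x| -> - (2 * al) < y < 0 ->
    pk al x y t <= C * sn al y * om al t.
Proof.
move=> a0 d0; have p0 := pi_gt0 R; have k0 : 0 < pi / (2 * al) by rewrite divr_gt0// mulr_gt0.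
pose q := 1 - sx al (- d).
have q0 : 0 < q by rewrite subr_gt0 /sx -[ltRHS]expR0 ltr_expR mulrN oppr_lt0 mulr_gt0.
have mono u v : u <= v -> sx al u <= sx al v by move=> uv; rewrite ler_expR ler_pM2l.
pose m := Num.min 1 (sx al (- N)); have m0 : 0 < m by rewrite lt_min ltr01 sx_gt0.
exists ((2 * al)^-1 * sx al N / (q / 2 * m) ^+ 2).
  by rewrite divr_ge0 ?sqr_ge0// mulr_ge0 ?invr_ge0 ?mulr_ge0 ?(ltW (sx_gt0 _ _))// ltW.
move=> x t y /andP[x1 x2] dx yy; have sp := sn_gt0 a0 yy.
have s0 := sx_gt0 al t; have r0 := sx_gt0 al x.
have c1 : -1 <= cs al y by exact: cos_geN1.
have diff u v : d <= v - u -> q * sx al v <= sx al v - sx al u.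
  move=> uv; rewrite /q mulrBl mul1r lerD2l lerN2 -sxD; apply: mono; lra.
have abs : q / 2 * (sx al t + sx al x) <= `|sx al t - sx al x|.
  have [tx|tx] := leP x t.
    have dt : d <= t - x by move: dx; rewrite ger0_norm//; lra.
    have := diff _ _ dt; have := mono _ _ tx => h1 h2.
    rewrite ger0_norm; last by lra.
    apply: le_trans h2; rewrite -mulrA ler_wpM2l ?(ltW q0)//; lra.
  have dt : d <= x - t by move: dx; rewrite ltr0_norm//; lra.
  have := diff _ _ dt; have := mono _ _ (ltW tx) => h1 h2.
  rewrite distrC ger0_norm; last by lra.
  apply: le_trans h2; rewrite -mulrA ler_wpM2l ?(ltW q0)//; lra.
have low : m * (1 + sx al t) <= sx al t + sx al x.
  have m1 : m <= 1 by rewrite ge_min lexx.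
  have m2 : m <= sx al x by rewrite (@le_trans _ _ (sx al (- N)))// ?ge_min ?lexx ?orbT// mono.
  have : m * sx al t <= sx al t by rewrite ler_piMl// ltW.
  lra.
have den : (q / 2 * m) ^+ 2 * (1 + sx al t) ^+ 2 <= pden al x y t.
  apply: (@le_trans _ _ ((sx al t - sx al x) ^+ 2)).
    rewrite -exprMn -[leRHS]real_normK ?num_real// lerXn2r// ?nnegrE//.
      by rewrite !mulr_ge0 ?(ltW m0) ?invr_ge0 ?(ltW q0)//; lra.
    by apply: le_trans abs; rewrite -[leLHS]mulrA ler_wpM2l// divr_ge0// (ltW q0).
  have : 0 <= pden al x y t - (sx al t - sx al x) ^+ 2; last by rewrite subr_ge0.
  rewrite (_ : _ - _ = 2 * sx al x * sx al t * (1 + cs al y)); last by rewrite /pden; ring.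
  by rewrite !mulr_ge0 ?(ltW s0) ?(ltW r0)//; lra.
have den0 : 0 < (q / 2 * m) ^+ 2 * (1 + sx al t) ^+ 2.
  by rewrite mulr_gt0 ?exprn_gt0// ?mulr_gt0// ?divr_gt0//; lra.
rewrite /pk /om.
rewrite [leRHS](_ : _ =
  (2 * al)^-1 * (sx al t * sx al N * sn al y / ((q / 2 * m) ^+ 2 * (1 + sx al t) ^+ 2))); last first.
  clear -q0 m0 s0 sp a0; clearbody q m.
  move: (sx al t) (sx al N) (sn al y) s0 => s u v s0.
  by field; rewrite !gt_eqF//; lra.
apply: ler_wpM2l; first by rewrite invr_ge0 mulr_ge0// ltW.
apply: ler_pM.
- by rewrite !mulr_ge0// ltW.
- by rewrite invr_ge0 (le_trans _ den)// ltW.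
- by rewrite ler_wpM2r ?(ltW sp)// ler_wpM2l ?(ltW s0)// mono.
- by rewrite lef_pV2// posrE// (lt_le_trans den0).
Qed.

End PoissonMass.

(** * Poisson integrals near the edge: continuous data *)

Section PoissonConvergence.
Context {R : realType}.
Notation mu := (@lebesgue_measure R).
Notation mfun := (measurable_fun [set: R]).
Notation nrm := Normc.normc.
Implicit Types (al x y t : R) (z : R[i]) (l phi psi : R -> R).

Lemma continuous_unif_itv phi (K e : R) : continuous phi -> 0 < e -> exists2 d : R, 0 < d &
  forall x t, -K <= x <= K -> `|t - x| <= d -> `|phi t - phi x| <= e.
Proof.
move=> cphi e0; have /compact_near_coveringP cov := @segment_compact R (- K) K.
have e2 : 0 < e / 2 by rewrite divr_gt0.
have := cov _ (0 : R)^'+ (fun d x => forall t, `|t - x| <= d -> `|phi t - phi x| <= e) _.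
case=> [x _|d' /= d'0 H].
  have := cphi x; move/cvgrPdist_le => /(_ _ e2)[r /= r0 rP].
  exists (ball x (r / 2), [set d : R | d < r / 2]) => /=.
    split; first by apply: nbhsx_ballx; rewrite divr_gt0.
    by apply: nbhs_right_lt; rewrite divr_gt0.
  move=> [x' d] /= [xx' dr] t tx'.
  have h1 : `|phi x - phi x'| <= e / 2.
    by apply: rP => /=; rewrite (lt_trans xx')// ltr_pdivrMr// ltr_pMr// ltr1n.
  have h2 : `|phi x - phi t| <= e / 2.
    apply: rP => /=; rewrite (_ : x - t = (x - x') - (t - x')); last by ring.
    rewrite (le_lt_trans (ler_normB _ _))// (splitr r) ltrD//.
    exact: le_lt_trans tx' dr.
  rewrite (_ : phi t - phi x' = (phi x - phi x') - (phi x - phi t)); last by ring.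
  by rewrite (le_trans (ler_normB _ _))// (splitr e) lerD.
exists (d' / 2); first by rewrite divr_gt0.
move=> x t xK tx; apply: (H (d' / 2)) => //=.
- by rewrite sub0r normrN gtr0_norm ?divr_gt0// ltr_pdivrMr// ltr_pMr// ltr1n.
- by rewrite divr_gt0.
Qed.

Lemma continuous_bounded_itv phi (K : R) : continuous phi -> exists2 C : R, 0 <= C &
  forall x, -K <= x <= K -> `|phi x| <= C.
Proof.
move=> cphi; have /compact_near_coveringP cov := @segment_compact R (- K) K.
have := cov _ (+oo : set_system R) (fun C x => `|phi x| <= C) _.
case=> [x _|C [_ H]].
  have := cphi x; move/cvgrPdist_le => /(_ _ ltr01)[r /= r0 rP].
  exists (ball x r, [set C : R | `|phi x| + 1 < C]) => /=.
    split; first exact: nbhsx_ballx.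
    by exists (`|phi x| + 1); split => //; exact: num_real.
  move=> [x' C] /= [xx' dr]; rewrite ltW// (le_lt_trans _ dr)//.
  rewrite (_ : phi x' = phi x - (phi x - phi x')); last by ring.
  by rewrite (le_trans (ler_normB _ _))// lerD// rP.
exists (`|C| + 1); first by rewrite addr_ge0.
by move=> x xK; apply: H => //=; rewrite ltr_pwDr// ler_norm.
Qed.

Definition pint al l x y : R := \int[mu]_t (pk al x y t * l t).

(** The Poisson integral is the logarithm of the modulus of a holomorphic function, so its
    measurability in [x] needs no Fubini argument. *)
Lemma pint_measurable al l y : 0 < al -> - (2 * al) < y < 2 * al -> wint al l ->
  mfun (fun x => pint al l x y).
Proof.
move=> a0 yy wl; rewrite (_ : (fun _ => _) = (fun x => ln (nrm (outer al l (x +i* y))))).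
  apply: (@measurableT_comp _ _ _ _ _ _ (@ln R)); first exact: measurable_ln.
  by apply: cmeasurable_nrm; exact: (on_line_cmeasurable (hol_outer a0 wl) yy).
by apply/funext => x; rewrite nrm_outer// expRK.
Qed.

(** At [x = 0] and the middle height [- al] one has [cs = 0] and [sn = 1], and [2 al] times the
    kernel is [s / (1 + s^2)], which dominates [om]. *)
Lemma om_integrable al : 0 < al -> mu.-integrable setT (EFin \o om al).
Proof.
move=> a0; have p0 := pi_gt0 R.
have yy : - (2 * al) < - al < 0 by apply/andP; split; lra.
have i1 := pk_integrable1 0 a0 yy.
apply: (@integrable_le _ _ (fun t => (2 * al) * pk al 0 (- al) t)).
- exact: om_measurable.
- move=> t; rewrite ger0_norm ?(ltW (om_gt0 _ _))//.
  have s0 := sx_gt0 al t.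
  have E : pi / (2 * al) * (- al) = - (pi / 2) by field; rewrite gt_eqF.
  have sE : sn al (- al) = 1 by rewrite /sn E sinN sin_pihalf opprK.
  have cE : cs al (- al) = 0 by rewrite /cs E cosN cos_pihalf.
  rewrite /pk /pden sE cE mulr0 addr0 /om.
  have -> : sx al 0 = 1 by rewrite /sx mulr0 expR0.
  rewrite mulrA mulfV ?mul1r ?mulr1 ?gt_eqF ?mulr_gt0//.
  apply: ler_wpM2l; first exact: ltW.
  rewrite lef_pV2 ?posrE; [|by rewrite exprn_gt0// addr_gt0|by rewrite expr1n ltr_pwDl// exprn_ge0// ltW].
  by rewrite expr1n; move: (sx al t) s0 => s s0; nra.
- exact: (integrableZl measurableT (2 * al) i1).
Qed.

Lemma om_ge al (K : R) : 0 < al -> exists2 c : R, 0 < c & forall t, -K <= t <= K -> c <= om al t.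
Proof.
move=> a0; have p0 := pi_gt0 R; have k0 : 0 < pi / (2 * al) by rewrite divr_gt0// mulr_gt0.
have q0 := sx_gt0 al K; exists (sx al (- K) / (1 + sx al K) ^+ 2).
  by rewrite divr_gt0 ?sx_gt0// exprn_gt0// addr_gt0.
move=> t /andP[t1 t2]; have s0 := sx_gt0 al t.
apply: ler_pM; [exact/ltW/sx_gt0| by rewrite invr_ge0 sqr_ge0| by rewrite ler_expR ler_pM2l|].
rewrite lef_pV2 ?posrE ?exprn_gt0 ?addr_gt0// lerXn2r ?nnegrE ?addr_ge0 ?(ltW s0) ?(ltW q0)//.
by rewrite lerD2l ler_expR ler_pM2l.
Qed.

Lemma pmass_bounds al x y (d e : R) : 0 < al -> - (2 * al) < y < 0 ->
  ((1 - e)%:E <= \int[mu]_(t in `[(x - d)%R, (x + d)%R]) (pk al x y t)%:E)%E ->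
  1 - e <= \int[mu]_t (pk al x y t) <= 1.
Proof.
move=> a0 yy H; have i1 := pk_integrable1 x a0 yy.
have fin : (\int[mu]_t (pk al x y t)%:E)%E \is a fin_num by exact: integrable_fin_num i1.
rewrite /Rintegral -!lee_fin fineK// pk_mass// andbT (le_trans H)//.
apply: ge0_subset_integral => //.
- by apply/measurable_EFinP; apply: pk_measurable => //; exact: strip_wide.
- by move=> t _; rewrite lee_fin ltW// pk_gt0.
Qed.

(** Three contributions of [e / 3]: the oscillation of [phi] near [x], the far part of the kernel,
    and the mass by which the kernel falls short of one. *)
Lemma pint_cvg_continuous al (N e : R) phi psi : 0 < al -> continuous phi -> wint al psi ->
  (forall t, - (N + 1) <= t <= N + 1 -> psi t = phi t) -> 0 < e ->
  exists2 d : R, 0 < d & forall y, - (2 * al) < y < - (2 * al) + d -> y < 0 ->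
    forall x, - N <= x <= N -> `|pint al psi x y - phi x| <= e.
Proof.
move=> a0 cphi wpsi psiE e0; have [mpsi ipsi] := wpsi.
have e3 : 0 < e / 3 by rewrite divr_gt0.
have [K K0 KP] := continuous_bounded_itv N cphi.
have [d1 d10 d1P] := continuous_unif_itv N cphi e3.
(* The cap [1] keeps points near [[-N, N]] inside [[-(N + 1), N + 1]], where [psi] agrees with
   [phi]. *)
pose d' := Num.min d1 1; have d'0 : 0 < d' by rewrite lt_min d10 ltr01.
have [C C0 CP] := pk_far N a0 d'0.
have iW : mu.-integrable setT (EFin \o (fun t => (`|psi t| + K) * om al t)).
  rewrite (_ : EFin \o _ = ((EFin \o (fun t => `|psi t * om al t|)%R) \+ (EFin \o (fun t => K * om al t)%R))%E).
    apply: integrableD => //; first exact: (integrable_norm ipsi).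
    exact: (integrableZl measurableT K (om_integrable a0)).
  by apply/funext => t /=; rewrite -EFinD normr_om mulrDl.
pose W := \int[mu]_t ((`|psi t| + K) * om al t).
have W0 : 0 <= W.
  by apply: Rintegral_ge0 => t _; rewrite mulr_ge0 ?addr_ge0// ltW// om_gt0.
have e'0 : 0 < e / 3 / (K + 1) by rewrite divr_gt0// ltr_wpDl.
have [d2 d20 d2P] := pk_near_mass a0 d'0 e'0.
have CW : 0 <= C * W by rewrite mulr_ge0.
have e''0 : 0 < e / 3 / (C * W + 1) by rewrite divr_gt0// ltr_wpDl.
have [d3 d30 d3P] := sn_cs_limit a0 e''0.
exists (Num.min d2 d3); first by rewrite lt_min d20.
move=> y /andP[y1]; rewrite -ltrBlDl lt_min => /andP[y2 y3] y0 x xN.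
have yy : - (2 * al) < y < 0 by rewrite y1.
have yd2 : - (2 * al) < y < - (2 * al) + d2 by apply/andP; split; lra.
have yd3 : - (2 * al) < y < - (2 * al) + d3 by apply/andP; split; lra.
have := pmass_bounds a0 yy (d2P y yd2 y0 x).
have [sP _] := d3P y yd3; have sp := sn_gt0 a0 yy.
have i1 := pk_integrable1 x a0 yy.
set m := \int[mu]_t _ => /andP[m1 m2].
have i2 := pk_integrable x a0 (strip_wide a0 yy) wpsi.
have i3 : mu.-integrable setT (EFin \o (fun t => pk al x y t * phi x)).
  exact: (integrableZr measurableT (phi x) i1).
have i4 : mu.-integrable setT (EFin \o (fun t => pk al x y t * (psi t - phi x))).
  rewrite (_ : EFin \o _ = ((EFin \o (fun t => pk al x y t * psi t)%R) \- (EFin \o (fun t => pk al x y t * phi x)%R))%E).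
    exact: integrableB.
  by apply/funext => t /=; rewrite -EFinB mulrBr.
have -> : pint al psi x y - phi x = \int[mu]_t (pk al x y t * (psi t - phi x)) - phi x * (1 - m).
  rewrite (_ : \int[mu]_t (pk al x y t * (psi t - phi x)) = pint al psi x y - m * phi x); first by ring.
  rewrite /pint /m -RintegralZr// -RintegralB//.
  by apply: eq_Rintegral => t _; rewrite mulrBr.
have B1 : `|\int[mu]_t (pk al x y t * (psi t - phi x))| <= e / 3 + e / 3.
  apply: le_trans (le_normr_Rintegral measurableT i4) _.
  have i5 : mu.-integrable setT (EFin \o (fun t => e / 3 * pk al x y t + C * sn al y * ((`|psi t| + K) * om al t))).
    rewrite (_ : EFin \o _ = ((EFin \o (fun t => e / 3 * pk al x y t)%R) \+ (EFin \o (fun t => C * sn al y * ((`|psi t| + K) * om al t))%R))%E)//.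
    apply: integrableD => //; first exact: (integrableZl measurableT (e / 3) i1).
    exact: (integrableZl measurableT (C * sn al y) iW).
  apply: (@le_trans _ _ (\int[mu]_t (e / 3 * pk al x y t + C * sn al y * ((`|psi t| + K) * om al t)))).
    apply: le_Rintegral => //; first exact: (integrable_norm i4).
    move=> t _; have p0 := pk_gt0 x t a0 yy; rewrite normrM (ger0_norm (ltW p0)).
    have w0 := ltW (om_gt0 al t).
    have [td|td] := leP `|t - x| d'.
      have tN : psi t = phi t.
        apply: psiE; have : `|t - x| <= 1 by rewrite (le_trans td)// ge_min lexx orbT.
        by rewrite ler_norml; move/andP: xN => [? ?] /andP[? ?]; apply/andP; split; lra.
      have : `|psi t - phi x| <= e / 3 by rewrite tN d1P// (le_trans td)// ge_min lexx.
      move=> h; rewrite ler_wpDr//.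
        by apply: mulr_ge0; [exact: mulr_ge0 C0 (ltW sp)|apply: mulr_ge0 => //; exact: addr_ge0].
      by rewrite [leRHS]mulrC ler_wpM2l// ltW.
    rewrite ler_wpDl//; first by rewrite mulr_ge0// ltW.
    rewrite [X in _ <= _ * X]mulrC mulrA; apply: ler_pM => //; [exact: ltW| |].
      by apply: CP => //; rewrite ltW.
    by rewrite (le_trans (ler_normB _ _))// lerD2l KP.
  rewrite RintegralD//; last 2 first.
  - exact: (integrableZl measurableT (e / 3) i1).
  - exact: (integrableZl measurableT (C * sn al y) iW).
  have -> : \int[mu]_t (e / 3 * pk al x y t) = e / 3 * m by apply: RintegralZl.
  have -> : \int[mu]_t (C * sn al y * ((`|psi t| + K) * om al t)) = C * sn al y * W by apply: RintegralZl.
  apply: lerD.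
    by rewrite ler_piMr// ltW.
  rewrite mulrAC (@le_trans _ _ (C * W * (e / 3 / (C * W + 1))))// ?ler_wpM2l//.
  rewrite mulrA ler_pdivrMr ?ltr_wpDl// mulrC ler_wpM2l ?(ltW e3)//; lra.
have B2 : `|phi x * (1 - m)| <= e / 3.
  rewrite normrM; apply: (@le_trans _ _ (K * (e / 3 / (K + 1)))).
    by apply: ler_pM; rewrite ?KP// ler_norml; apply/andP; split; lra.
  by rewrite mulrA ler_pdivrMr ?ltr_wpDl// mulrC ler_wpM2l ?(ltW e3)//; lra.
apply: le_trans (ler_normB _ _) _; rewrite [leRHS](_ : _ = e / 3 + e / 3 + e / 3); last by field.
exact: lerD.
Qed.

End PoissonConvergence.

(** * Poisson integrals near the edge: locally integrable data *)

Section PoissonApproximation.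
Context {R : realType}.
Notation mu := (@lebesgue_measure R).
Notation mfun := (measurable_fun [set: R]).
Notation nrm := Normc.normc.
Implicit Types (al x y t : R) (z : R[i]) (l phi psi : R -> R).

Lemma pk_joint_measurable al y : 0 < al -> - (2 * al) < y < 2 * al ->
  measurable_fun [set: R * R] (fun z : R * R => pk al z.1 y z.2).
Proof.
move=> a0 yy; apply: (@separately_measurable _ (fun x t => pk al x y t)).
  move=> t; rewrite (_ : (fun x => _) = pk al t y); first exact: pk_measurable.
  by apply/funext => x; rewrite pk_sym.
by move=> x; exact: pk_continuous.
Qed.

(** Tonelli's theorem: by symmetry the inner integral over [x] is the mass of the kernel, at most
    one. *)
Lemma pint_contract al l y : 0 < al -> - (2 * al) < y < 0 -> wint al l -> (forall t, 0 <= l t) ->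
  (\int[mu]_x (pint al l x y)%:E <= \int[mu]_x (l x)%:E)%E.
Proof.
move=> a0 yy wl l0; have yw := strip_wide a0 yy; have [ml _] := wl.
have E x : (pint al l x y)%:E = (\int[mu]_t (pk al x y t * l t)%:E)%E.
  by rewrite /pint /Rintegral fineK//; apply: integrable_fin_num => //; exact: pk_integrable.
under eq_integral do rewrite E.
rewrite (@fubini_tonelli _ _ _ _ R mu mu (fun z : R * R => (pk al z.1 y z.2 * l z.2)%:E)); last 2 first.
- apply/measurable_EFinP; apply: measurable_funM; first exact: pk_joint_measurable.
  exact: (measurableT_comp ml measurable_snd).
- by move=> z; rewrite lee_fin mulr_ge0// ltW// pk_gt0.
apply: ge0_le_integral => //.
- by move=> t _; apply: integral_ge0 => x _; rewrite lee_fin mulr_ge0// ltW// pk_gt0.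
- apply: (@measurable_fun_fubini_tonelli_G _ _ _ _ R mu (fun z : R * R => (pk al z.1 y z.2 * l z.2)%:E)).
    apply/measurable_EFinP; apply: measurable_funM; first exact: pk_joint_measurable.
    exact: (measurableT_comp ml measurable_snd).
  by move=> z; rewrite lee_fin mulr_ge0// ltW// pk_gt0.
- exact/measurable_EFinP.
move=> t _ /=; under eq_integral do rewrite pk_sym mulrC.
rewrite nintZ//; last 2 first.
- exact: pk_measurable.
- by move=> x; rewrite ltW// pk_gt0.
rewrite -[leRHS]mule1; apply: lee_wpmul2l; first by rewrite lee_fin.
exact: pk_mass.
Qed.

Lemma wint_le al l l' : wint al l -> mfun l' -> (forall t, `|l' t| <= `|l t|) -> wint al l'.
Proof.
move=> [ml il] ml' ll; split => //.
apply: (integrable_le _ _ (integrable_norm il)).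
  exact: (measurable_funM ml' (om_measurable al)).
by move=> t; rewrite normr_om /= normr_om ler_wpM2r// ltW// om_gt0.
Qed.

Lemma wintD al l l' : wint al l -> wint al l' -> wint al (fun t => l t + l' t).
Proof.
move=> [ml il] [ml' il']; split; first exact: measurable_funD.
rewrite (_ : EFin \o _ = ((EFin \o (fun t => l t * om al t)%R) \+ (EFin \o (fun t => l' t * om al t)%R))%E).
  exact: integrableD.
by apply/funext => t /=; rewrite -EFinD mulrDl.
Qed.

Lemma wintN al l : wint al l -> wint al (fun t => - l t).
Proof.
move=> wl; have [ml _] := wl; apply: (wint_le wl); first exact: measurable_funN.
by move=> t; rewrite normrN.
Qed.

Lemma wint_cst al c : 0 < al -> wint al (fun=> c : R).
Proof.
move=> a0; split; first exact: measurable_cst.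
exact: (integrableZl measurableT c (om_integrable a0)).
Qed.

Lemma wint_integrable al (u : R -> R) : 0 < al -> mu.-integrable setT (EFin \o u) -> wint al u.
Proof.
move=> a0 iu; have mu_ : mfun u by apply/measurable_EFinP; case/integrableP: iu.
split => //; apply: (integrable_le _ _ (integrable_norm iu)).
  exact: (measurable_funM mu_ (om_measurable al)).
move=> t; rewrite normr_om ler_piMr//; have s0 := sx_gt0 al t.
rewrite /om ler_pdivrMr ?exprn_gt0 ?addr_gt0//; move: (sx al t) s0 => s s0; nra.
Qed.

Lemma pintD al l l' x y : 0 < al -> - (2 * al) < y < 2 * al -> wint al l -> wint al l' ->
  pint al (fun t => l t + l' t) x y = pint al l x y + pint al l' x y.
Proof.
move=> a0 yy wl wl'; rewrite /pint -RintegralD//; try exact: pk_integrable.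
by apply: eq_Rintegral => t _; rewrite mulrDr.
Qed.

Lemma pint_norm al l x y : 0 < al -> - (2 * al) < y < 0 -> wint al l ->
  `|pint al l x y| <= pint al (fun t => `|l t|) x y.
Proof.
move=> a0 yy wl; have yw := strip_wide a0 yy; have [ml _] := wl.
have wl' : wint al (fun t => `|l t|).
  by apply: (wint_le wl); [exact: measurableT_comp|move=> t; rewrite normr_id].
apply: le_trans (le_normr_Rintegral measurableT (pk_integrable x a0 yw wl)) _.
apply: le_Rintegral => //.
- exact: (integrable_norm (pk_integrable x a0 yw wl)).
- exact: pk_integrable.
- by move=> t _; rewrite normrM (gtr0_norm (pk_gt0 _ _ _ _)).
Qed.

Lemma wint_itv_integrable al l (K : R) : 0 < al -> wint al l ->
  mu.-integrable `[- K, K]%classic (EFin \o l).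
Proof.
move=> a0 [ml il]; have [c c0 cP] := om_ge K a0.
have mI : measurable (`[- K, K]%classic : set R) by exact: measurable_itv.
apply: (@le_integrable _ _ _ mu _ mI _ (EFin \o (fun t => c^-1 * `|l t * om al t|))).
- by apply/measurable_EFinP; exact: measurable_funTS.
- move=> t /=; rewrite in_itv/= => tK; rewrite lee_fin normr_om.
  rewrite [leRHS]ger0_norm; last first.
    by apply: mulr_ge0; [rewrite invr_ge0 ltW|exact: mulr_ge0 (normr_ge0 _) (ltW (om_gt0 _ _))].
  by rewrite mulrCA ler_peMr// mulrC ler_pdivlMr// mul1r cP.
- apply: (@integrableS _ _ _ mu setT) => //.
  exact: (integrableZl measurableT c^-1 (integrable_norm il)).
Qed.

(** On a slightly larger interval [l] is a continuous function up to a small [L^1] error [r]. The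
    Poisson integral of [|r|] is small by contraction, and [l - r] is covered by the continuous
    case, as it agrees with [phi] on that interval. *)
Lemma pint_L1loc al l (N : R) : 0 < al -> 0 <= N -> wint al l ->
  rlim0 (fun y => \int[mu]_x (\1_(`[- N, N]%classic) x * `|pint al l x y - l x|)%:E)%E (- (2 * al)).
Proof.
move=> a0 N0 wl e e0; have [ml _] := wl.
pose J : set R := `[- (N + 1), N + 1]%classic.
have mJ : measurable J by exact: measurable_itv.
have mN : measurable (`[- N, N]%classic : set R) by exact: measurable_itv.
have iJ : mu.-integrable J (EFin \o l) by apply: (wint_itv_integrable _ a0 wl).
have muJ : (mu J < +oo)%E.
  have := @lebesgue_measure_itv R `[- (N + 1), N + 1]; rewrite /J => ->.
  by case: ifP => _; rewrite -?EFinB ltry.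
have e4 : 0 < e / 4 by rewrite divr_gt0.
have [phi [cphi [iphi Iphi]]] : exists phi, continuous phi /\
    mu.-integrable J (EFin \o phi) /\ (\int[mu]_(x in J) `|(l x - phi x)%:E| <= (e / 4)%:E)%E.
  have [g_ [cg ig gP]] := approximation_continuous_integrable mJ muJ iJ.
  move: gP => /fine_cvgP[fin]; move/cvgrPdist_le => /(_ _ e4) => H.
  have [n [n1 n2]] := filter_ex (filterI fin H).
  exists (g_ n); split => //; split => //; move: n2; rewrite sub0r normrN /= => n2.
  by rewrite -(fineK n1) lee_fin (le_trans (ler_norm _)).
pose r t := (l t - phi t) * \1_J t; pose psi t := l t - r t.
have mphi : mfun phi by exact: continuous_measurable_fun.
have m1J : mfun (\1_J : R -> R) by exact: measurable_indic.
have mr : mfun r by apply: measurable_funM => //; exact: measurable_funB.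
have mar : mfun (fun t => `|r t|) by exact: measurableT_comp.
have Ir : (\int[mu]_x (`|r x|)%:E <= (e / 4)%:E)%E.
  apply: le_trans Iphi; rewrite [leRHS]integral_mkcond le_eqVlt; apply/orP; left; apply/eqP.
  apply: eq_integral => x _; rewrite patchE /r indicE; case: ifPn => _; rewrite ?mulr1//.
  by rewrite mulr0 normr0.
have ir : mu.-integrable setT (EFin \o r).
  apply: (@integrable_le _ _ (fun t => `|r t|)) => //.
  by apply: nint_integrable => //; exact: le_lt_trans Ir (ltry _).
have wr := wint_integrable a0 ir.
have war := wint_integrable a0 (integrable_norm ir).
have wpsi : wint al psi by exact: wintD wl (wintN wr).
have psiE t : - (N + 1) <= t <= N + 1 -> psi t = phi t.
  by move=> tJ; rewrite /psi /r indicE mem_set ?mulr1 ?subKr//= in_itv.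
(* [2 N] is the length of the interval of integration; the summand [1] avoids a zero denominator. *)
have e'0 : 0 < e / 4 / (2 * N + 1) by rewrite divr_gt0// ltr_wpDl// mulr_ge0.
have [d d0 dP] := pint_cvg_continuous a0 cphi wpsi psiE e'0.
exists (Num.min d (2 * al)); first by rewrite lt_min d0 mulr_gt0.
move=> y /andP[y1]; rewrite -ltrBlDl lt_min => /andP[y2 y3].
have y0 : y < 0 by lra.
have yy : - (2 * al) < y < 0 by rewrite y1.
have yw := strip_wide a0 yy.
have yd : - (2 * al) < y < - (2 * al) + d by apply/andP; split; lra.
have mpr : mfun (fun x => pint al (fun t => `|r t|) x y) by exact: pint_measurable.
have m1N : mfun (\1_(`[- N, N]%classic) : R -> R) by exact: measurable_indic.
have pr0 x : 0 <= pint al (fun t => `|r t|) x y.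
  by apply: Rintegral_ge0 => t _; rewrite mulr_ge0// ltW// pk_gt0.
have m2 : mfun (fun x => e / 4 / (2 * N + 1) * \1_(`[- N, N]%classic) x) by exact: measurable_funM.
have n2 x : 0 <= e / 4 / (2 * N + 1) * \1_(`[- N, N]%classic) x.
  by rewrite mulr_ge0 ?(ltW e'0).
apply: (@le_trans _ _ (\int[mu]_x (pint al (fun t => `|r t|)%R x y +
    (e / 4 / (2 * N + 1) * \1_(`[- N, N]%classic) x + `|r x|))%R%:E)%E).
  apply: le_nint.
  - apply: measurable_funM => //; apply: measurableT_comp => //; apply: measurable_funB => //.
    exact: pint_measurable.
  - by apply: measurable_funD => //; exact: measurable_funD.
  - by move=> x; rewrite mulr_ge0.
  - move=> x; rewrite indicE; have [xN|xN] := boolP (x \in _); last first.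
      by rewrite mul0r addr_ge0// mulr0 add0r.
    rewrite mul1r mulr1; move: xN; rewrite inE/= in_itv/= => xN.
    have xJ : - (N + 1) <= x <= N + 1 by move/andP: xN => [? ?]; apply/andP; split; lra.
    have -> : pint al l x y - l x = pint al r x y + ((pint al psi x y - phi x) - r x).
      have {1}-> : l = (fun t => r t + psi t) by apply/funext => t; rewrite /psi; ring.
      rewrite pintD// -(psiE x xJ) /psi; ring.
    apply: le_trans (ler_normD _ _) _; apply: lerD; first exact: pint_norm.
    by apply: le_trans (ler_normB _ _) _; rewrite lerD2r dP.
have n3 x : 0 <= e / 4 / (2 * N + 1) * \1_(`[- N, N]%classic) x + `|r x| by rewrite addr_ge0.
rewrite (nintD mpr (measurable_funD m2 mar) pr0 n3) (nintD m2 mar n2 (fun=> normr_ge0 _)).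
have -> : e%:E = ((e / 4)%:E + ((e / 4 + e / 4)%:E + (e / 4)%:E))%E.
  by rewrite -!EFinD; congr EFin; field.
apply: leeD; first exact: le_trans (pint_contract a0 yy war (fun t => normr_ge0 (r t))) Ir.
apply: leeD => //; rewrite nintZ//; last exact: ltW.
rewrite integral_indic// setIT.
have := @lebesgue_measure_itv R `[- N, N] => /= ->.
case: ifP => _; last by rewrite mule0 lee_fin addr_ge0// ltW.
rewrite -EFinB -EFinM lee_fin (_ : N - - N = 2 * N); last by ring.
apply: (@le_trans _ _ (e / 4)); last by rewrite lerDl ltW.
by rewrite mulrAC ler_pdivrMr ?ltr_wpDl ?mulr_ge0// ler_wpM2l ?(ltW e4)// lerDl.
Qed.

Lemma pint_ubound al l x y (c : R) : 0 < al -> - (2 * al) < y <= 0 -> wint al l ->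
  (forall t, l t <= c) -> 0 <= c -> pint al l x y <= c.
Proof.
move=> a0 /andP[y1 y2] wl lc c0; move: y2; rewrite le_eqVlt => /predU1P[->|y2].
  rewrite /pint; under eq_Rintegral do rewrite pk0 mul0r.
  by rewrite /Rintegral integral0.
have yy : - (2 * al) < y < 0 by rewrite y1.
have i1 := pk_integrable1 x a0 yy.
have m1 : \int[mu]_t pk al x y t <= 1.
  rewrite -lee_fin /Rintegral fineK; last exact: (integrable_fin_num measurableT i1).
  exact: pk_mass.
apply: (@le_trans _ _ (\int[mu]_t (pk al x y t * c))).
  apply: le_Rintegral => //.
  - by apply: pk_integrable => //; exact: strip_wide.
  - exact: (integrableZr measurableT c i1).
  - by move=> t _; rewrite ler_wpM2l// ltW// pk_gt0.
have -> : \int[mu]_t (pk al x y t * c) = (\int[mu]_t pk al x y t) * c by exact: RintegralZr.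
by rewrite ler_piMl.
Qed.

End PoissonApproximation.

(** * Boundary modulus of outer functions *)

Section OuterBoundary.
Context {R : realType}.
Notation mu := (@lebesgue_measure R).
Notation mfun := (measurable_fun [set: R]).
Notation nrm := Normc.normc.
Implicit Types (al x y t eps gamma : R) (z : R[i]) (l : R -> R) (g : R -> R[i]) (h : R[i] -> R[i]).

Lemma gauss_mass gamma : 0 < gamma ->
  (\int[mu]_x (expR (- (2 * gamma * x ^+ 2)))%:E = (Num.sqrt (pi / (2 * gamma)))%:E)%E.
Proof.
move=> g0; have p0 := pi_gt0 R.
(* The standard deviation of the normal density with exponent [- 2 gamma x^2]. *)
pose s := (2 * Num.sqrt gamma)^-1; have sg : 0 < Num.sqrt gamma by rewrite sqrtr_gt0.
have s0 : 0 < s by rewrite invr_gt0 mulr_gt0.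
have s2 : s ^+ 2 = (4 * gamma)^-1.
  by rewrite /s exprVn exprMn sqr_sqrtr ?(ltW g0)//; congr (_ * _)^-1; ring.
have P0 : 0 < pi / (2 * gamma) by rewrite divr_gt0// mulr_gt0.
have pE : normal_peak s = (Num.sqrt (pi / (2 * gamma)))^-1.
  by rewrite /normal_peak s2; congr (Num.sqrt _)^-1; field; rewrite gt_eqF.
have := integral_normal_pdf 0 s.
have -> : (\int[mu]_x (normal_pdf 0 s x)%:E =
    (normal_peak s)%:E * \int[mu]_x (expR (- (2 * gamma * x ^+ 2)))%:E)%E.
  rewrite -nintZ; last 3 first.
  - exact: gauss_measurable.
  - by move=> x; exact: expR_ge0.
  - by rewrite pE invr_ge0 sqrtr_ge0.
  apply: eq_integral => x _; rewrite /normal_pdf gt_eqF// /normal_fun s2 subr0.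
  by congr (_ * expR _)%:E; field; rewrite gt_eqF.
rewrite pE => E; rewrite -[LHS]mul1e -[1%E](_ : (Num.sqrt (pi / (2 * gamma)))%:E * (Num.sqrt (pi / (2 * gamma)))^-1%:E = 1)%E.
  by rewrite -muleA E mule1.
by rewrite -EFinM mulfV// gt_eqF// sqrtr_gt0.
Qed.

Lemma gauss_norm2_le_cst gamma g (M : R) : 0 < gamma -> cmeasurable g -> 0 <= M ->
  {ae mu, forall x, nrm (g x) <= M} ->
  (gauss_norm2 gamma g <= (M ^+ 2 * Num.sqrt (pi / (2 * gamma)))%:E)%E.
Proof.
move=> g0 mg M0 gM; rewrite EFinM -gauss_mass//.
rewrite -(nintZ (gauss_measurable gamma) (fun x => expR_ge0 _) (sqr_ge0 M)).
apply: ae_ge0_le_integral => //.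
- by move=> x _; rewrite lee_fin gauss_weight_ge0.
- by apply/measurable_EFinP; exact: gauss_integrand_measurable.
- by move=> x _; rewrite lee_fin mulr_ge0 ?sqr_ge0// expR_ge0.
- by apply/measurable_EFinP; apply: measurable_funM => //; exact: gauss_measurable.
apply: ae_imp gM => x gM _; rewrite lee_fin ler_wpM2r ?expR_ge0//.
by rewrite lerXn2r ?nnegrE ?normc_ge0.
Qed.

Lemma bounded_Hclass a b eps h (M : R) : 0 <= eps -> hol h a b ->
  (forall x y, b < y < a -> nrm (h (x +i* y)) <= M) -> Hclass a b eps h.
Proof.
move=> e0 hh hM; apply: Hclass_intro => // gamma eg.
exists (M ^+ 2 * Num.sqrt (pi / (2 * gamma))) => y yab.
apply: (gauss_norm2_le_cst (le_lt_trans e0 eg) (on_line_cmeasurable hh yab)).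
  exact: le_trans (normc_ge0 _) (hM 0 y yab).
by apply: ae_every => x; exact: hM.
Qed.

(** Heights are chosen along which the outer function converges a.e. and its log-modulus, the
    Poisson integral, converges to [l] a.e. on [[-n, n]]; then [n] varies. *)
Lemma outer_lower_norm al l eps g : 0 < al -> wint al l ->
  is_lower_value eps (outer al l) (- (2 * al)) g -> {ae mu, forall x, nrm (g x) = expR (l x)}.
Proof.
move=> a0 wl lv; have ho := hol_outer a0 wl; have [ml _] := wl.
have ba : - (2 * al) < 2 * al by lra.
have one (n : nat) : {ae mu, forall x, - n%:R <= x <= n%:R -> nrm (g x) = expR (l x)}.
  have n0 : 0 <= n%:R :> R by [].
  have m1N : mfun (\1_(`[- n%:R, n%:R]%classic) : R -> R).
    by apply: measurable_indic; exact: measurable_itv.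
  have nn y x : 0 <= (\1_(`[- n%:R, n%:R]%classic) x : R) * `|pint al l x y - l x| by rewrite mulr_ge0.
  have [y_ [yab yb yN yc]] := lower_value_seq ba ho lv (fun y => nint_ge0 (nn y)) (pint_L1loc a0 n0 wl).
  have mg k : mfun (fun x => (\1_(`[- n%:R, n%:R]%classic) x : R) * `|pint al l x (y_ k) - l x|).
    apply: measurable_funM => //; apply: measurableT_comp => //.
    by apply: measurable_funB => //; exact: pint_measurable.
  have c0 := ae_cvg0 mg (fun k x => nn (y_ k) x) yN.
  apply: ae_imp (ae_and yc c0) => x [/ccvg_norm h1 h2] xn.
  apply: (cvg_unique _ h1) => //.
  have -> : (fun k => nrm (outer al l (x +i* y_ k))) = (fun k => expR (pint al l x (y_ k))).
    by apply/funext => k; rewrite nrm_outer.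
  apply: (cvg_comp (fun k => pint al l x (y_ k)) expR); last exact: continuous_expR.
  apply/cvgrPdist_le => e e0; move/cvgrPdist_le: h2 => /(_ e e0); apply: filterS => k.
  by rewrite indicE mem_set ?mul1r/= ?in_itv//= sub0r normrN normr_id distrC.
apply: ae_imp (ae_all one) => x H; apply: (H (Num.bound `|x|)).
by rewrite -ler_norml ltW// archi_boundP.
Qed.

Lemma nrm_outer0 al l x : 0 < al -> wint al l -> nrm (outer al l x%:C) = 1.
Proof.
move=> a0 wl; rewrite nrm_outer//; last by apply/andP; split; lra.
under eq_Rintegral do rewrite pk0 mul0r.
by rewrite /Rintegral integral0 expR0.
Qed.

Lemma pint_neg al l x y : 0 < al -> - (2 * al) < y < 2 * al -> wint al l ->
  pint al (fun t => - l t) x y = - pint al l x y.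
Proof.
move=> a0 yy wl; apply/eqP; rewrite -addr_eq0 -pintD//; last exact: wintN.
by apply/eqP; rewrite /pint; under eq_Rintegral do rewrite addNr mulr0; rewrite /Rintegral integral0.
Qed.

Lemma pint_opp al l x y : 0 < al -> - (2 * al) < y < 2 * al -> wint al l ->
  pint al l x (- y) = - pint al l x y.
Proof.
move=> a0 yy wl; rewrite -pint_neg//; apply: eq_Rintegral => t _.
by rewrite pk_opp mulrN mulNr.
Qed.

Lemma outer_bounded al l x y (c : R) : 0 < al -> - (2 * al) < y <= 0 -> wint al l ->
  (forall t, l t <= c) -> 0 <= c -> nrm (outer al l (x +i* y)) <= expR c.
Proof.
move=> a0 yy wl lc c0; have /andP[y1 y2] := yy; rewrite nrm_outer//.
  by rewrite ler_expR; exact: pint_ubound.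
by apply/andP; split; lra.
Qed.

(** Doubling the width halves the exponential rate, so [om (2 al)] decays more slowly than [om al]
    and its surplus absorbs the factor [t^2]. *)
Lemma om_sqr_integrable al : 0 < al -> mu.-integrable setT (EFin \o (fun t => t ^+ 2 * om al t)).
Proof.
move=> a0; have a20 : 0 < 2 * al by rewrite mulr_gt0.
have p0 := pi_gt0 R; pose k : R := pi / (2 * (2 * al)).
have k0 : 0 < k by rewrite divr_gt0// mulr_gt0.
apply: (@integrable_le _ _ (fun t => 16 / k ^+ 2 * om (2 * al) t)).
- exact: (measurable_funM (measurable_funX 2 (@measurable_id _ _ _)) (om_measurable al)).
- move=> t; rewrite normr_om ger0_norm ?sqr_ge0//.
  have E : sx al t = sx (2 * al) t ^+ 2.
    by rewrite /sx -expRM_natl; congr expR; rewrite -/k /k; field; rewrite gt_eqF.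
  have r0 := sx_gt0 (2 * al) t.
  (* With [k t = 2 v] this follows from [v <= exp v] for [v >= 0] and [(- v) exp v <= 1] for
     [v < 0]. *)
  have A : (k * t) ^+ 2 * sx (2 * al) t <= 4 * (1 + sx (2 * al) t ^+ 2).
    rewrite /sx -/k; pose v := k * t / 2.
    have -> : k * t = 2 * v by rewrite /v; field.
    have -> : expR (2 * v) = expR v ^+ 2 by rewrite expRM_natl.
    have := expR_ge1Dx v; have := expR_ge1Dx (- v).
    have := expRxMexpNx_1 v; have := expR_gt0 v; have := expR_gt0 (- v).
    move: (expR v) (expR (- v)) => q p p00 q00 pq h1 h2.
    have [v0|v0] := leP 0 v.
      have h : v ^+ 2 <= q ^+ 2 by rewrite lerXn2r ?nnegrE//; lra.
      have := sqr_ge0 (q ^+ 2); have : 0 < q ^+ 2 by rewrite exprn_gt0.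
      move: (q ^+ 2) h => Q h Q0 Q1; rewrite exprMn; nra.
    have h : (- v * q) ^+ 2 <= 1 by rewrite expr_le1//; nra.
    rewrite exprMn sqrrN in h; rewrite exprMn.
    have : 0 <= (q ^+ 2) ^+ 2 by exact: sqr_ge0.
    move: (q ^+ 2) (v ^+ 2) h => Q V h Q1; lra.
  have k2 : 0 < k ^+ 2 by rewrite exprn_gt0.
  rewrite /om E; move: (sx _ t) r0 A => r r0 A.
  have B : k ^+ 2 * t ^+ 2 * r * (1 + r) ^+ 2 <= 4 * (1 + r ^+ 2) * (2 * (1 + r ^+ 2)).
    rewrite -exprMn; apply: ler_pM => //.
    - by rewrite mulr_ge0 ?sqr_ge0 ?(ltW r0).
    - exact: sqr_ge0.
    - by have := sqr_ge0 (1 - r); lra.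
  have q0 : 0 < 1 + r ^+ 2 by rewrite ltr_pwDl// sqr_ge0.
  have q1 : 0 < 1 + r by rewrite addr_gt0.
  rewrite mulrA -subr_ge0.
  rewrite (_ : _ - _ = r / (k ^+ 2 * (1 + r) ^+ 2 * (1 + r ^+ 2) ^+ 2) *
     (16 * (1 + r ^+ 2) ^+ 2 - k ^+ 2 * t ^+ 2 * r * (1 + r) ^+ 2)); last first.
    by clear -k0 q0 q1 r0; clearbody k; field; rewrite !gt_eqF.
  apply: mulr_ge0.
    apply: (divr_ge0 (ltW r0)); apply: mulr_ge0; last exact: sqr_ge0.
    by apply: mulr_ge0; exact: sqr_ge0.
  rewrite subr_ge0 (le_trans B)//; have := sqr_ge0 (1 + r ^+ 2); move: (1 + r ^+ 2) => Q Q2; nra.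
- exact: (integrableZl measurableT (16 / k ^+ 2) (om_integrable a20)).
Qed.

End OuterBoundary.

(** * Weighted bounds for products with outer functions *)

Section OuterDomination.
Context {R : realType}.
Notation mu := (@lebesgue_measure R).
Notation mfun := (measurable_fun [set: R]).
Notation nrm := Normc.normc.
Implicit Types (al x y t a b eps gamma : R) (z : R[i]) (l : R -> R) (g : R -> R[i]) (h : R[i] -> R[i]).

Lemma upper_value_mul a b eps h1 h2 g1 g2 g : b < a -> hol h1 a b -> hol h2 a b ->
  is_upper_value eps h1 a g1 -> is_upper_value eps h2 a g2 ->
  is_upper_value eps (fun z => h1 z * h2 z) a g ->
  {ae mu, forall x, g x = g1 x * g2 x}.
Proof.
move=> ba hh1 hh2 /is_upper_valueP u1 /is_upper_valueP u2 /is_upper_valueP u.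
have ba' : - a < - b by rewrite ltrN2.
have u' : is_lower_value eps (fun z => bar_fun h1 z * bar_fun h2 z) (- a) (fun x => (g x)^*).
  by rewrite (_ : (fun z => _) = bar_fun (fun z => h1 z * h2 z))//; apply/funext => z; rewrite /bar_fun rmorphM.
have := lower_value_mul ba' (hol_bar hh1) (hol_bar hh2) u1 u2 u'.
by apply: ae_imp => x E; apply: (can_inj (@conjcK R)); rewrite E rmorphM.
Qed.

Lemma upper_value_interior a b c eps h g : b < c -> c < a -> hol h a b ->
  is_upper_value eps h c g -> {ae mu, forall x, g x = h (x +i* c)}.
Proof.
move=> bc ca hh /is_upper_valueP u.
have bc' : - a < - c by rewrite ltrN2.
have ca' : - c < - b by rewrite ltrN2.
have := lower_value_interior bc' ca' (hol_bar hh) u.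
apply: ae_imp => x E; apply: (can_inj (@conjcK R)).
by rewrite E /bar_fun /= opprK.
Qed.

Lemma Hclass_sub a b a' b' eps h : b <= b' -> a' <= a -> b < a -> Hclass a b eps h -> Hclass a' b' eps h.
Proof.
move=> bb aa ba hH; apply: Hclass_intro; first exact: hol_sub (Hclass_hol hH) _ _.
move=> gamma eg; have [M M0 MP] := Hclass_bound ba hH eg.
exists M => y /andP[y1 y2]; apply: MP.
by rewrite (le_lt_trans bb)//= (lt_le_trans y2).
Qed.

Lemma Hclass_mul_bounded a b eps h k (M : R) : b < a -> 0 <= M -> Hclass a b eps h -> hol k a b ->
  (forall x y, b < y < a -> nrm (k (x +i* y)) <= M) -> Hclass a b eps (fun z => h z * k z).
Proof.
move=> ba M0 hH hk kM; have hh := Hclass_hol hH; have hm := holM hh hk.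
apply: Hclass_intro => // gamma eg; have [C C0 CP] := Hclass_bound ba hH eg.
exists (M ^+ 2 * C) => y yab.
have m1 := gauss_integrand_measurable gamma (on_line_cmeasurable hh yab).
apply: le_trans (_ : (M ^+ 2)%:E * gauss_norm2 gamma (on_line h y) <= _)%E; last first.
  by rewrite [leRHS]EFinM; apply: lee_wpmul2l; [rewrite lee_fin sqr_ge0|exact: CP].
rewrite /gauss_norm2 -nintZ ?sqr_ge0//; last by move=> x; exact: gauss_weight_ge0.
apply: le_nint.
- exact: gauss_integrand_measurable (on_line_cmeasurable hm yab).
- exact: measurable_funM.
- by move=> x; exact: gauss_weight_ge0.
- move=> x; rewrite /on_line [leRHS]mulrA ler_wpM2r ?expR_ge0// Normc.normcM exprMn mulrC.
  by rewrite ler_wpM2r ?sqr_ge0// lerXn2r ?nnegrE ?normc_ge0// kM.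
Qed.

(** If [l] is bounded above, the outer function is bounded in the lower half-strip and the product
    belongs to the class. Its edge moduli are [|hb| exp l] and [|ht|], so the maximum principle
    applies. *)
Lemma outer_dominate_bounded al eps gamma l (c : R) h hb ht (E : R) :
  0 < al -> 0 <= eps -> 0 <= gamma -> wint al l -> (forall t, l t <= c) ->
  Hclass 0 (- (2 * al)) eps h -> is_lower_value eps h (- (2 * al)) hb -> is_upper_value eps h 0 ht ->
  ((expR (2 * gamma * (2 * al) ^+ 2))%:E * gauss_norm2 gamma (fun x => hb x * (expR (l x))%:C)%R <= E%:E)%E ->
  (gauss_norm2 gamma ht <= E%:E)%E ->
  forall y, - (2 * al) < y < 0 ->
  ((expR (2 * gamma * y ^+ 2))%:E * gauss_norm2 gamma (on_line (fun z => h z * outer al l z)%R y) <= E%:E)%E.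
Proof.
move=> a0 e0 g0 wl lc hH lb ut Eb Et.
have ba : - (2 * al) < 0 by lra.
have hh := Hclass_hol hH; have ho := hol_outer a0 wl; have [ml _] := wl.
have ho' : hol (outer al l) 0 (- (2 * al)) by apply: hol_sub ho _ _ => //; lra.
(* The kernel has mass at most one, so an upper bound passes from [l] to its Poisson integral only
   if it is nonnegative. *)
pose c' := Num.max c 0.
have lc' t : l t <= c' by rewrite le_max lc.
have ob x y : - (2 * al) < y <= 0 -> nrm (outer al l (x +i* y)) <= expR c'.
  by move=> yy; apply: outer_bounded => //; rewrite le_max lexx orbT.
have ob' x y : - (2 * al) < y < 0 -> nrm (outer al l (x +i* y)) <= expR c'.
  by move=> /andP[y1 y2]; apply: ob; rewrite y1 ltW.
have kH : Hclass 0 (- (2 * al)) eps (fun z => h z * outer al l z).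
  exact: (Hclass_mul_bounded ba (expR_ge0 c') hH ho' ob').
have oH : Hclass 0 (- (2 * al)) eps (outer al l) by exact: bounded_Hclass ob'.
have ol := lower_valueP e0 ba oH.
have kl := lower_valueP e0 ba kH.
have olE := outer_lower_norm a0 wl ol.
have klE := lower_value_mul ba hh ho' lb ol kl.
have upper_exists k : Hclass 0 (- (2 * al)) eps k -> exists g, is_upper_value eps k 0 g.
  move=> kk; have kb := Hclass_bar ba kk.
  have [|g gP] := lower_value_exists e0 _ kb; first by lra.
  by exists (fun x => (g x)^*); apply/is_upper_valueP; under eq_fun do rewrite conjcK.
have [ot oP] := upper_exists _ oH; have [kt kP] := upper_exists _ kH.
have otE := upper_value_interior ba (_ : 0 < 2 * al) ho oP.
have ktE := upper_value_mul ba hh ho' ut oP kP.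
have mE := cmeasurableM (proj1 lb) (cmeasurable_real (measurableT_comp (@measurable_expR R) ml)).
apply: (max_principle e0 ba kH kl kP g0).
- rewrite sqrrN (_ : gauss_norm2 gamma _ = gauss_norm2 gamma (fun x => hb x * (expR (l x))%:C))//.
  apply: gauss_norm2_ae => //; first by case: kl.
  apply: ae_imp (ae_and klE olE) => x [-> h2].
  by rewrite !Normc.normcM h2 normcR (ger0_norm (expR_ge0 _)).
- rewrite expr0n mulr0 expR0 mul1e.
  rewrite (_ : gauss_norm2 gamma _ = gauss_norm2 gamma ht)//.
  apply: gauss_norm2_ae; [by case: kP|by case: ut|].
  apply: ae_imp (ae_and ktE (otE _)) => [x [-> ->]|]; last by rewrite mulr_gt0.
  by rewrite Normc.normcM (nrm_outer0 x a0 wl) mulr1.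
Qed.

Lemma truncate_le (u : R) (n : nat) : `|Num.min u n%:R| <= `|u|.
Proof.
have n0 : 0 <= n%:R :> R by [].
by have [un|un] := leP u n%:R; rewrite // !ger0_norm// ?ltW// (le_lt_trans n0).
Qed.

Lemma pint_truncate al l x y : 0 < al -> - (2 * al) < y < 2 * al -> wint al l ->
  pint al (fun t => Num.min (l t) n%:R) x y @[n --> \oo] --> pint al l x y.
Proof.
move=> a0 yy wl; have [ml _] := wl.
have il := pk_integrable x a0 yy wl.
have mp := pk_measurable x a0 yy.
have mln (n : nat) : mfun (fun t => Num.min (l t) n%:R).
  by apply: measurable_minr => //.
apply: (@Rint_dominated _ _ _ (fun t => `|pk al x y t * l t|)).
- by move=> n; exact: measurable_funM.
- exact: measurable_funM.
- apply: ae_every => t; apply: cvg_near_cst; exists (Num.bound `|l t|) => // n /= nt.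
  congr (_ * _); apply/min_idPl; rewrite (le_trans (ler_norm _))// (le_trans (ltW (archi_boundP _)))//.
  by rewrite ler_nat.
- exact: (integrable_norm il).
- by move=> n t; rewrite !normrM ler_wpM2l// truncate_le.
Qed.

Lemma wint_truncate al l (n : nat) : wint al l -> wint al (fun t => Num.min (l t) n%:R).
Proof.
move=> wl; have [ml _] := wl; apply: (wint_le wl); first exact: measurable_minr.
by move=> t; exact: truncate_le.
Qed.

(** For unbounded [l] the product is not known in advance to lie in the class. Cutting [l] off at
    height [n] only decreases the edge norm, and Fatou's lemma gives the bound in the limit. *)
Lemma outer_dominate al eps gamma l h hb ht (E : R) :
  0 < al -> 0 <= eps -> 0 <= gamma -> wint al l ->
  Hclass 0 (- (2 * al)) eps h -> is_lower_value eps h (- (2 * al)) hb -> is_upper_value eps h 0 ht ->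
  ((expR (2 * gamma * (2 * al) ^+ 2))%:E * gauss_norm2 gamma (fun x => hb x * (expR (l x))%:C)%R <= E%:E)%E ->
  (gauss_norm2 gamma ht <= E%:E)%E ->
  forall y, - (2 * al) < y < 0 ->
  ((expR (2 * gamma * y ^+ 2))%:E * gauss_norm2 gamma (on_line (fun z => h z * outer al l z)%R y) <= E%:E)%E.
Proof.
move=> a0 e0 g0 wl hH lb ut Eb Et y yy.
have yw := strip_wide a0 yy; have [ml _] := wl.
have hh := Hclass_hol hH; have ho := hol_outer a0 wl.
have mh := on_line_cmeasurable hh yy.
have mo := on_line_cmeasurable ho yw.
pose ln_ n t := Num.min (l t) n%:R.
have wln n : wint al (ln_ n) by exact: wint_truncate.
have mln n : mfun (ln_ n) by case: (wln n).
have mon n := on_line_cmeasurable (hol_outer a0 (wln n)) yw.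
have mexp k : mfun k -> cmeasurable (fun x => hb x * (expR (k x))%:C).
  by move=> mk; apply: (cmeasurableM (proj1 lb)); apply: cmeasurable_real; exact: measurableT_comp.
have H n : ((expR (2 * gamma * y ^+ 2))%:E *
    gauss_norm2 gamma (on_line (fun z => h z * outer al (ln_ n) z)%R y) <= E%:E)%E.
  have ln_le t : ln_ n t <= n%:R by rewrite ge_min lexx orbT.
  apply: (outer_dominate_bounded a0 e0 g0 (wln n) ln_le hH lb ut _ Et yy).
  apply: le_trans Eb; apply: lee_wpmul2l; first by rewrite lee_fin expR_ge0.
  apply: le_nint.
  - by apply: gauss_integrand_measurable; exact: mexp.
  - by apply: gauss_integrand_measurable; exact: mexp.
  - by move=> x; exact: gauss_weight_ge0.
  - move=> x; rewrite ler_wpM2r ?expR_ge0// !Normc.normcM !normcR !(ger0_norm (expR_ge0 _)).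
    rewrite lerXn2r ?nnegrE ?mulr_ge0 ?normc_ge0 ?expR_ge0// ler_wpM2l ?normc_ge0//.
    by rewrite ler_expR ge_min lexx.
have mI k : cmeasurable (on_line k y) ->
    mfun (fun x => nrm (h (x +i* y) * k (x +i* y)) ^+ 2 * expR (- (2 * gamma * x ^+ 2))).
  by move=> mk; apply: gauss_integrand_measurable; exact: cmeasurableM.
rewrite /gauss_norm2 -nintZ ?expR_ge0//; last 2 first.
- exact: mI.
- by move=> x; exact: gauss_weight_ge0.
apply: (@fatou_ae _ (fun n x => expR (2 * gamma * y ^+ 2) *
   (nrm (h (x +i* y) * outer al (ln_ n) (x +i* y)) ^+ 2 * expR (- (2 * gamma * x ^+ 2))))).
- by move=> n; apply: measurable_funM => //; exact: mI.
- by apply: measurable_funM => //; exact: mI.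
- by move=> n x; rewrite mulr_ge0 ?expR_ge0// gauss_weight_ge0.
- by move=> x; rewrite mulr_ge0 ?expR_ge0// gauss_weight_ge0.
- apply: ae_every => x; apply: (@seq_cvgM _ _ _ _ _ (@seq_cvg_cst _ _)).
  apply: (@seq_cvgM _ _ _ _ _ _ (@seq_cvg_cst _ _)).
  under eq_fun do rewrite Normc.normcM nrm_outer//.
  rewrite Normc.normcM nrm_outer//.
  have c : nrm (h (x +i* y)) * expR (pint al (ln_ n) x y) @[n --> \oo] -->
      nrm (h (x +i* y)) * expR (pint al l x y).
    apply: (@seq_cvgM _ _ _ _ _ (@seq_cvg_cst _ _)).
    apply: (cvg_comp (fun n => pint al (ln_ n) x y) expR); last exact: continuous_expR.
    exact: pint_truncate.
  exact: (@seq_cvgM _ _ _ _ _ c c).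
- apply: nearW => n; rewrite nintZ ?expR_ge0//; first exact: H.
  + exact: mI.
  + by move=> x; exact: gauss_weight_ge0.
Qed.

End OuterDomination.

(** * Existence *)

Section OuterExistence.
Context {R : realType}.
Notation mu := (@lebesgue_measure R).
Notation mfun := (measurable_fun [set: R]).
Notation nrm := Normc.normc.
Implicit Types (al x y t a b eps gamma : R) (z : R[i]) (l : R -> R) (g : R -> R[i]) (h f : R[i] -> R[i]).

Definition shift_fun (c : R) h : R[i] -> R[i] := fun z => h (z + (0 +i* c)).

Lemma on_line_shift c h y : on_line (shift_fun c h) y = on_line h (y + c).
Proof.
apply/funext => x; rewrite /on_line /shift_fun; congr h.
by apply/eqP; rewrite eq_complex /= addr0 !eqxx.
Qed.

Lemma Hclass_shift a b eps h (c : R) : b < a -> Hclass a b eps h ->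
  Hclass (a - c) (b - c) eps (shift_fun c h).
Proof.
move=> ba hH; apply: Hclass_intro; first exact: hol_shift (Hclass_hol hH).
move=> gamma eg; have [M M0 MP] := Hclass_bound ba hH eg.
by exists M => y /andP[y1 y2]; rewrite on_line_shift; apply: MP; apply/andP; split; lra.
Qed.

Lemma lower_value_shift b eps h g (c : R) : is_lower_value eps h b g ->
  is_lower_value eps (shift_fun c h) (b - c) g.
Proof.
move=> /is_lower_valueP[mg H]; apply/is_lower_valueP; split => // gamma eg e e0.
have [d d0 dP] := H _ eg e e0; exists d => // y /andP[y1 y2].
have := dP (y + c); rewrite -on_line_shift; apply.
by apply/andP; split; lra.
Qed.

Lemma bar_fun_shift c h : bar_fun (shift_fun c h) = shift_fun (- c) (bar_fun h).
Proof.
apply/funext => -[x y]; rewrite /bar_fun /shift_fun; congr ((h _)^*).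
by apply/eqP; rewrite eq_complex /= !addr0 eqxx /=; apply/eqP; ring.
Qed.

Lemma upper_value_shift a eps h g (c : R) : is_upper_value eps h a g ->
  is_upper_value eps (shift_fun c h) (a - c) g.
Proof.
move=> /is_upper_valueP H; apply/is_upper_valueP; rewrite bar_fun_shift.
rewrite (_ : - (a - c) = - a - - c); last by ring.
exact: lower_value_shift.
Qed.

Lemma upper_value_exists a b eps h : 0 <= eps -> b < a -> Hclass a b eps h ->
  exists g, is_upper_value eps h a g.
Proof.
move=> e0 ba hH; have [|g gP] := lower_value_exists e0 _ (Hclass_bar ba hH); first by rewrite ltrN2.
by exists (fun x => (g x)^*); apply/is_upper_valueP; under eq_fun do rewrite conjcK.
Qed.

Lemma upper_valueP a b eps h : 0 <= eps -> b < a -> Hclass a b eps h ->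
  is_upper_value eps h a (upper_value eps h a).
Proof. by move=> e0 ba /(upper_value_exists e0 ba)[g gP]; apply: xgetPex; exists g. Qed.

Lemma lower_value_finite a b eps gamma h g : b < a -> Hclass a b eps h -> is_lower_value eps h b g ->
  eps < gamma -> (gauss_norm2 gamma g < +oo)%E.
Proof.
move=> ba hH /is_lower_valueP[mg H] eg; have [M M0 MP] := Hclass_bound ba hH eg.
have [d d0 dP] := H _ eg 1 ltr01.
pose y := b + Num.min d (a - b) / 2.
have m0 : 0 < Num.min d (a - b) by rewrite lt_min d0 subr_gt0.
have m1 : Num.min d (a - b) <= d by rewrite ge_min lexx.
have m2 : Num.min d (a - b) <= a - b by rewrite ge_min lexx orbT.
have yb : b < y < b + d by rewrite /y; apply/andP; split; lra.
have ya : b < y < a by rewrite /y; apply/andP; split; lra.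
have my := on_line_cmeasurable (Hclass_hol hH) ya.
have -> : g = (fun x => on_line h y x - (on_line h y x - g x)) by apply/funext => x; rewrite subKr.
apply: le_lt_trans (gauss_norm2_triangle _ my (cmeasurableB my mg)) _.
apply: (@le_lt_trans _ _ (2%:E * (M%:E + 1%:E))%E); last by rewrite ltry.
by apply: lee_wpmul2l => //; apply: leeD; [exact: MP|exact: dP].
Qed.

(** In use [d] is an essential lower bound of [|g|]: the maximum then changes [|g|] only on a null
    set and makes the logarithm bounded below everywhere. *)
Definition log_modulus (d : R) g : R -> R := fun x => ln (Num.max d (nrm (g x))).

Lemma expR_log_modulus d g x : 0 < d -> expR (log_modulus d g x) = Num.max d (nrm (g x)).
Proof. by move=> d0; rewrite lnK// posrE lt_max d0. Qed.

Lemma log_modulus_ge d g x : 0 < d -> ln d <= log_modulus d g x.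
Proof. by move=> d0; rewrite ler_ln ?posrE ?lt_max ?d0// le_max lexx. Qed.

(** From below the bound is [ln d]. From above, [ln u <= u] applied to the squared modulus times the
    Gaussian bounds the logarithm by an integrable function plus [gamma t^2] and constants, all
    integrable against [om]. *)
Lemma wint_log_modulus al gamma d g : 0 < al -> 0 <= gamma -> 0 < d -> cmeasurable g ->
  (gauss_norm2 gamma g < +oo)%E -> wint al (log_modulus d g).
Proof.
move=> a0 g0 d0 mg fin.
have mm : mfun (fun x => Num.max d (nrm (g x))).
  by apply: measurable_maxr => //; exact: cmeasurable_nrm.
have ml : mfun (log_modulus d g).
  by apply: (@measurableT_comp _ _ _ _ _ _ (@ln R)) mm; exact: measurable_ln.
have w1 : wint al (fun x => nrm (g x) ^+ 2 * expR (- (2 * gamma * x ^+ 2))).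
  apply: wint_integrable => //; apply: nint_integrable => //.
    exact: gauss_integrand_measurable.
  by move=> x; exact: gauss_weight_ge0.
have w2 : wint al (fun x => gamma * x ^+ 2).
  split; first by apply: measurable_funM => //; exact: measurable_funX.
  rewrite (_ : EFin \o _ = EFin \o (fun t => gamma * (t ^+ 2 * om al t))).
    exact: (integrableZl measurableT gamma (om_sqr_integrable a0)).
  by apply/funext => t /=; rewrite mulrA.
have w3 := wint_cst (2 * `|ln d| + d ^+ 2) a0.
apply: (wint_le (wintD (wintD w1 w2) w3) ml) => t.
set w := expR _; have wp : 0 < w by exact: expR_gt0.
have w1' : w <= 1 by rewrite -[leRHS]expR0 ler_expR oppr_le0 mulr_ge0 ?sqr_ge0// mulr_ge0.
have lnd := log_modulus_ge g t d0.
have M0 : 0 < Num.max d (nrm (g t)) by rewrite lt_max d0.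
have up : 2 * log_modulus d g t - 2 * gamma * t ^+ 2 <= Num.max d (nrm (g t)) ^+ 2 * w.
  apply: le_trans (ltW (ln_sublinear (mulr_gt0 (exprn_gt0 2 M0) wp))).
  rewrite lnM ?posrE ?exprn_gt0// lnXn// /w expRK mulr2n /log_modulus; lra.
have M2 : Num.max d (nrm (g t)) ^+ 2 <= d ^+ 2 + nrm (g t) ^+ 2.
  by have [_|_] := leP d (nrm (g t)); rewrite ?lerDl ?lerDr sqr_ge0.
have M3 : Num.max d (nrm (g t)) ^+ 2 * w <= d ^+ 2 + nrm (g t) ^+ 2 * w.
  apply: le_trans (ler_wpM2r (ltW wp) M2) _; rewrite mulrDl lerD2r.
  by rewrite ler_piMr ?sqr_ge0.
have T0 : 0 <= gamma * t ^+ 2 by rewrite mulr_ge0 ?sqr_ge0.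
have N0 : 0 <= nrm (g t) ^+ 2 * w by rewrite mulr_ge0 ?sqr_ge0// ltW.
have D0 : 0 <= d ^+ 2 by exact: sqr_ge0.
have := ler_norm (ln d); have := ler_norm (- ln d); rewrite normrN; have := normr_ge0 (ln d) => h1 h2 h3.
 rewrite [leRHS]ger0_norm; last lra.
rewrite ler_norml; apply/andP; split; lra.
Qed.

(** Below the axis the Poisson integral of [- l] is bounded by [|d|]. Above it, the modulus at
    height [y] is that of [outer al l] at height [- y], which is dominated by taking for [h] the
    constant [1], with edge moduli [exp l] and [1]. *)
Lemma outer_inverse_Hclass al eps l (d : R) : 0 < al -> 0 <= eps -> wint al l -> (forall t, d <= l t) ->
  (forall gamma, eps < gamma -> (gauss_norm2 gamma (fun x => (expR (l x))%:C)%R < +oo)%E) ->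
  Hclass (2 * al) (- (2 * al)) eps (outer al (fun t => - l t)).
Proof.
move=> a0 e0 wl dl fin; have wnl := wintN wl; have ho := hol_outer a0 wnl; have [ml _] := wl.
have ba : - (2 * al) < 0 by lra.
apply: Hclass_intro => // gamma eg; have g0 : 0 < gamma by exact: le_lt_trans e0 eg.
pose S := Num.sqrt (pi / (2 * gamma)).
pose G := fine (gauss_norm2 gamma (fun x => (expR (l x))%:C)).
have GE : gauss_norm2 gamma (fun x => (expR (l x))%:C) = G%:E.
  by rewrite fineK// ge0_fin_numE ?fin// gauss_norm2_ge0.
have G0 : 0 <= G by rewrite -lee_fin -GE gauss_norm2_ge0.
pose E := expR (2 * gamma * (2 * al) ^+ 2) * G + S.
pose B := expR `|d|.
have S0 : 0 <= S by exact: sqrtr_ge0.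
have E0 : 0 <= E by rewrite addr_ge0// mulr_ge0// expR_ge0.
exists (E + B ^+ 2 * S) => y /andP[y1 y2].
have m1 := on_line_cmeasurable ho (introT andP (conj y1 y2)).
have [y0|y0] := leP y 0.
  apply: (@le_trans _ _ (B ^+ 2 * S)%:E); last by rewrite lee_fin lerDr.
  apply: gauss_norm2_le_cst => //; first exact: expR_ge0.
  apply: ae_every => x; apply: outer_bounded => //; first by rewrite y1.
  by move=> t; have := dl t; have := ler_norm (- d); rewrite normrN; lra.
have yy : - (2 * al) < - y < 0 by apply/andP; split; lra.
have yw : - (2 * al) < y < 2 * al by rewrite y1.
have yw' := strip_wide a0 yy.
have oneH : Hclass 0 (- (2 * al)) eps (fun=> 1 : R[i]).
  apply: (bounded_Hclass (M := 1)) => //; first by move=> z _; exists 0; exact: cderiv_cst.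
  by move=> x t _; rewrite normcR normr1.
have m11 : cmeasurable (fun=> 1 : R[i]) by exact: cmeasurable_cst.
have z0 gam : gauss_norm2 gam (fun=> 1 - 1 : R[i]) = 0%E.
  by rewrite /gauss_norm2 integral0_eq// => x _; rewrite subrr Normc.normc0 expr0n mul0r.
have lv b : is_lower_value eps (fun=> 1 : R[i]) b (fun=> 1).
  by apply/is_lower_valueP; split => // gam _ e e0'; exists 1 => // t _; rewrite /= z0 lee_fin ltW.
have uv : is_upper_value eps (fun=> 1 : R[i]) 0 (fun=> 1).
  apply/is_upper_valueP; rewrite (_ : bar_fun _ = fun=> 1); last first.
    by apply/funext => z; rewrite /bar_fun /= oppr0.
  by rewrite (_ : (fun=> _) = fun=> 1); [exact: lv|apply/funext => x; rewrite /= oppr0].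
have H1 : ((expR (2 * gamma * (2 * al) ^+ 2))%:E *
    gauss_norm2 gamma (fun x => 1 * (expR (l x))%:C)%R <= E%:E)%E.
  by under [X in gauss_norm2 _ X]eq_fun do rewrite mul1r; rewrite GE -EFinM lee_fin lerDl.
have H2 : (gauss_norm2 gamma (fun=> 1%R : R[i]) <= E%:E)%E.
  apply: (@le_trans _ _ (1 ^+ 2 * S)%:E).
    by apply: gauss_norm2_le_cst => //; apply: ae_every => x; rewrite normcR normr1.
  by rewrite lee_fin expr1n mul1r lerDr mulr_ge0// expR_ge0.
have := outer_dominate a0 e0 (ltW g0) wl oneH (lv _) uv H1 H2 yy.
have -> : gauss_norm2 gamma (on_line (fun z => 1 * outer al l z) (- y)) =
    gauss_norm2 gamma (on_line (outer al (fun t => - l t)) y).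
  apply: eq_integral => x _; rewrite /on_line mul1r !nrm_outer//.
  by rewrite -/(pint al l x (- y)) -/(pint al (fun t => - l t) x y) pint_opp// pint_neg.
move=> H; apply: (@le_trans _ _ E%:E); last by rewrite lee_fin lerDl mulr_ge0 ?sqr_ge0.
apply: le_trans H; rewrite -[leLHS]mul1e.
apply: lee_wpmul2r; first exact: gauss_norm2_ge0.
by rewrite lee_fin -[leLHS]expR0 ler_expR mulr_ge0 ?sqr_ge0// mulr_ge0// ltW.
Qed.

End OuterExistence.

(** * The boundary function vanishes only on a null set *)

Section BoundaryNonvanishing.
Context {R : realType}.
Notation mu := (@lebesgue_measure R).
Notation mfun := (measurable_fun [set: R]).
Notation nrm := Normc.normc.
Implicit Types (al x y t a b eps gamma : R) (z : R[i]) (l : R -> R) (g : R -> R[i]) (h f : R[i] -> R[i]).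

Lemma ae_exists_near (P : R -> Prop) (x0 r : R) : 0 < r -> {ae mu, forall x, P x} ->
  exists2 x, `|x - x0| <= r & P x.
Proof.
move=> r0 aeP; apply: contrapT => H.
have : mu.-negligible (`[x0 - r, x0 + r]%classic : set R).
  apply: negligibleS aeP => x /=; rewrite in_itv/= => xr Px; apply: H; exists x => //.
  by rewrite ler_distl.
move/negligibleP => /(_ (measurable_itv _)).
have := @lebesgue_measure_itv R `[x0 - r, x0 + r] => /= ->.
rewrite lte_fin ifT; last lra.
by rewrite -EFinB => -[]; lra.
Qed.

Lemma gauss_norm2_real gamma g : (gauss_norm2 gamma g < +oo)%E ->
  exists2 M : R, 0 <= M & gauss_norm2 gamma g = M%:E.
Proof.
move=> fin; exists (fine (gauss_norm2 gamma g)); first by rewrite fine_ge0// gauss_norm2_ge0.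
by rewrite fineK// ge0_fin_numE// gauss_norm2_ge0.
Qed.

(* Multiplication by [O_(n 1_Z)], where [Z] is the zero set of [g], preserves the
   moduli on both edges, so that the norms inside stay bounded, whereas
   [|O_(n 1_Z)|] tends to infinity there unless [Z] is null. *)
Lemma is_lower_value_neq0 al eps h g : 0 < al -> 0 <= eps -> Hclass 0 (- (2 * al)) eps h ->
  is_lower_value eps h (- (2 * al)) g -> (exists2 z, strip 0 (- (2 * al)) z & h z != 0) ->
  {ae mu, forall x, g x != 0}.
Proof.
move=> a0 e0 hH lg [[x0 y] /= yst hz]; rewrite /= in yst.
have ba : - (2 * al) < 0 by lra.
have yy : - (2 * al) < y < 0 by move/andP: yst.
have hh := Hclass_hol hH; have mg : cmeasurable g by case: lg.
have [ht uht] := upper_value_exists e0 ba hH.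
pose gamma := eps + 1; have eg : eps < gamma by rewrite /gamma; lra.
have g0 : 0 <= gamma by lra.
have fg := lower_value_finite ba hH lg eg.
have ft : (gauss_norm2 gamma ht < +oo)%E.
  have /is_upper_valueP ub := uht; rewrite -gauss_norm2_conj.
  by apply: (lower_value_finite _ (Hclass_bar ba hH) ub eg); rewrite ltrN2.
have [G G0 GE] := gauss_norm2_real fg; have [H H0 HE] := gauss_norm2_real ft.
pose E := expR (2 * gamma * (2 * al) ^+ 2) * G + H.
have GH : 0 <= expR (2 * gamma * (2 * al) ^+ 2) * G by rewrite mulr_ge0 ?expR_ge0.
pose Z : set R := [set x | nrm (g x) = 0].
have mZ : measurable Z.
  rewrite (_ : Z = setT `&` (fun x => nrm (g x)) @^-1` [set 0]); last by rewrite setTI.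
  by apply: (cmeasurable_nrm mg) => //.
pose rho : R -> R := \1_Z.
have mrho : mfun rho by exact: measurable_indic.
have r01 t : 0 <= rho t by rewrite /rho indicE; case: (_ \in _).
have wrho (n : nat) : wint al (fun t => n%:R * rho t).
  apply: (wint_le (wint_cst n%:R a0)); first exact: measurable_funM.
  move=> t; rewrite normrM ler_piMr// /rho indicE; by case: (_ \in _); rewrite ?normr1 ?normr0.
have gE (n : nat) x : nrm (g x * (expR (n%:R * rho x))%:C) = nrm (g x).
  rewrite Normc.normcM normcR (ger0_norm (expR_ge0 _)) /rho indicE.
  have [|_] := boolP (x \in Z); first by rewrite inE => ->; rewrite mul0r.
  by rewrite mulr0 expR0 mulr1.
have yw := strip_wide a0 yy.
have my := on_line_cmeasurable hh yy.
have P0 x : 0 <= pint al rho x y by apply: Rintegral_ge0 => t _; rewrite mulr_ge0// ltW// pk_gt0.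
have wr1 : wint al rho by have := wrho 1; under [X in wint _ X]eq_fun do rewrite mul1r.
have mP := pint_measurable a0 yw wr1.
have pE (n : nat) x : pint al (fun t => n%:R * rho t) x y = n%:R * pint al rho x y.
  rewrite /pint; under eq_Rintegral do rewrite mulrCA.
  by apply: RintegralZl => //; exact: pk_integrable.
(* The squared modulus of the outer function is at least its log-modulus [n * pint al rho], because
   [exp u >= 1 + u]; the right side does not depend on [n], so the integral has to vanish. *)
have main (n : nat) : (n%:R%:E * \int[mu]_x (pint al rho x y *
    (nrm (h (x +i* y)) ^+ 2 * expR (- (2 * gamma * x ^+ 2))))%:E <= E%:E)%E.
  have H1 : ((expR (2 * gamma * (2 * al) ^+ 2))%:E *
     gauss_norm2 gamma (fun x => g x * (expR (n%:R * rho x))%:C)%R <= E%:E)%E.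
    rewrite (_ : gauss_norm2 gamma _ = gauss_norm2 gamma g); last first.
      by apply: eq_integral => x _; rewrite gE.
    by rewrite GE -EFinM lee_fin lerDl.
  have H2 : (gauss_norm2 gamma ht <= E%:E)%E by rewrite HE lee_fin lerDr.
  have := outer_dominate a0 e0 g0 (wrho n) hH lg uht H1 H2 yy.
  apply: le_trans; rewrite -nintZ//; last 2 first.
  - by apply: measurable_funM => //; exact: gauss_integrand_measurable.
  - by move=> x; rewrite mulr_ge0// gauss_weight_ge0.
  have mO := on_line_cmeasurable (hol_outer a0 (wrho n)) yw.
  have mi := gauss_integrand_measurable gamma (cmeasurableM my mO).
  rewrite /gauss_norm2 -nintZ ?expR_ge0//; last by move=> x; exact: gauss_weight_ge0.
  apply: le_nint.
  - apply: measurable_funM => //; apply: measurable_funM => //; exact: gauss_integrand_measurable.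
  - exact: measurable_funM.
  - move=> x; apply: mulr_ge0 => //; apply: mulr_ge0 => //; exact: gauss_weight_ge0.
  - move=> x; apply: (@le_trans _ _ (nrm (on_line h y x * on_line (outer al (fun t => n%:R * rho t)) y x) ^+ 2 * expR (- (2 * gamma * x ^+ 2)))).
      rewrite Normc.normcM exprMn /on_line nrm_outer// -/(pint al (fun t => n%:R * rho t) x y) pE.
      have := gauss_weight_ge0 gamma (h (x +i* y)) x.
      have := expR_ge1Dx (n%:R * pint al rho x y).
      have u0 : 0 <= n%:R * pint al rho x y by rewrite mulr_ge0.
      rewrite mulrA; move: u0.
      move: (expR (n%:R * pint al rho x y)) (n%:R * pint al rho x y) (nrm (h (x +i* y)) ^+ 2) (expR (- _)) => e u N w u0 ue Nw.
      rewrite [leLHS]mulrC [leRHS]mulrAC ler_wpM2l//; nra.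
    rewrite ler_peMl ?gauss_weight_ge0// -[leLHS]expR0 ler_expR mulr_ge0 ?sqr_ge0// mulr_ge0//.
have mi2 : mfun (fun x => pint al rho x y * (nrm (h (x +i* y)) ^+ 2 * expR (- (2 * gamma * x ^+ 2)))).
  by apply: measurable_funM => //; exact: gauss_integrand_measurable.
have zero : (\int[mu]_x (pint al rho x y *
    (nrm (h (x +i* y)) ^+ 2 * expR (- (2 * gamma * x ^+ 2))))%:E <= 0)%E.
  have := main; set I := (\int[mu]_x _)%E => mainI.
  have I1 : (I <= E%:E)%E by have := mainI 1%N; rewrite mul1e.
  case: I mainI I1 => [r| |] // mainI _; rewrite lee_fin leNgt; apply/negP => r0.
  have := mainI (Num.bound (E / r)); rewrite -EFinM lee_fin -ler_pdivlMr// leNgt => /negP; apply.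
  by apply: archi_boundP; rewrite divr_ge0 ?(ltW r0)// addr_ge0.
have nn x : 0 <= pint al rho x y * (nrm (h (x +i* y)) ^+ 2 * expR (- (2 * gamma * x ^+ 2))).
  by rewrite mulr_ge0// gauss_weight_ge0.
have ae0 := nint_eq0_ae mi2 nn zero.
have [D hD] : exists D, cderiv h (x0 +i* y) D by apply: hh.
have n0 : 0 < nrm (h (x0 +i* y)) by rewrite lt_def normc_eq0 hz normc_ge0.
have [d d0 dP] := cderiv_continuous_ReIm hD (divr_gt0 n0 (ltr0Sn _ 1)).
have d2 : 0 < d / 2 by rewrite divr_gt0.
(* At a point near [x0] where [h] is still nonzero the Poisson integral of the indicator of [Z] is
   therefore zero; the kernel being positive, [Z] is null. *)
have [x xd] := ae_exists_near x0 d2 ae0.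
have hx : nrm (h (x +i* y)) != 0.
  have : nrm (h (x +i* y) - h (x0 +i* y)) <= nrm (h (x0 +i* y)) / 2.
    apply: dP; rewrite (_ : _ - _ = (x - x0)%:C); last by apply/eqP; rewrite eq_complex /= subrr !eqxx.
    by rewrite normcR (le_lt_trans xd)// ltr_pdivrMr// ltr_pMr// ltr1n.
  have := ler_dist_normc (h (x +i* y)) (h (x0 +i* y)); rewrite ler_norml => /andP[h1 _] h2.
  by rewrite gt_eqF//; lra.
have w0 : nrm (h (x +i* y)) ^+ 2 * expR (- (2 * gamma * x ^+ 2)) != 0.
  by rewrite mulf_neq0 ?expf_neq0// gt_eqF// expR_gt0.
move/eqP; rewrite mulf_eq0 (negbTE w0) orbF => /eqP Px.
have ipk := pk_integrable x a0 yw wr1.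
have npk t : 0 <= pk al x y t * rho t by rewrite mulr_ge0// ltW// pk_gt0.
have zpk : (\int[mu]_t (pk al x y t * rho t)%:E <= 0)%E.
  rewrite -(fineK (integrable_fin_num measurableT ipk)) lee_fin.
  by move: Px; rewrite /pint /Rintegral => ->.
have mpk : mfun (fun t => pk al x y t * rho t) by apply: measurable_funM => //; exact: pk_measurable.
apply: ae_imp (nint_eq0_ae mpk npk zpk) => t /eqP.
rewrite mulf_eq0 (gt_eqF (pk_gt0 _ _ _ _))//= => /eqP rt; apply/eqP => gt.
move: rt; rewrite /rho indicE mem_set; first by move/eqP; rewrite oner_eq0.
by rewrite /Z /= gt Normc.normc0.
Qed.

End BoundaryNonvanishing.

Section Existence.
Context {R : realType}.
Notation mu := (@lebesgue_measure R).
Notation mfun := (measurable_fun [set: R]).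
Notation nrm := Normc.normc.
Implicit Types (al x y t a b eps gamma : R) (z : R[i]) (l : R -> R) (g : R -> R[i]) (h f : R[i] -> R[i]).

Lemma log_boundary_modulus al eps f : 0 < al -> 0 <= eps -> Hclass al (- al) eps f ->
  (0 < ess_inf mu (fun x : R => (nrm (lower_value eps f (- al) x))%:E))%E ->
  exists l d, [/\ wint al l, forall t, d <= l t,
    {ae mu, forall x, nrm (lower_value eps f (- al) x) = expR (l x)} &
    forall gamma, eps < gamma -> (gauss_norm2 gamma (fun x => (expR (l x))%:C)%R < +oo)%E].
Proof.
move=> a0 e0 fH f_inf; have ba : - al < al by lra.
have lg := lower_valueP e0 ba fH; set g := lower_value eps f (- al) in lg f_inf *.
have mg : cmeasurable g by case: lg.
(* The essential infimum is an extended real; if it is infinite, any positive [d] will do. *)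
have [d d0 dP] : exists2 d : R, 0 < d & (d%:E <= ess_inf mu (fun x : R => (nrm (g x))%:E))%E.
  case: (ess_inf _ _) f_inf => [r| |] // r0; first by exists r.
  by exists 1 => //; rewrite leey.
have fin gamma : eps < gamma -> (gauss_norm2 gamma g < +oo)%E.
  by move=> eg; exact: lower_value_finite ba fH lg eg.
have e1 : eps < eps + 1 by lra.
have wl : wint al (log_modulus d g) by apply: wint_log_modulus (fin _ e1) => //; lra.
have ml : mfun (log_modulus d g) by case: wl.
have gE : {ae mu, forall x, nrm (g x) = expR (log_modulus d g x)}.
  move/ess_infP: dP; apply: ae_imp => x; rewrite lee_fin => dx.
  by rewrite expR_log_modulus//; apply/esym/max_idPr.
exists (log_modulus d g), (ln d); split => //.
- by move=> t; exact: log_modulus_ge.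
- move=> gamma eg; rewrite (_ : gauss_norm2 gamma _ = gauss_norm2 gamma g) ?fin//.
  apply: gauss_norm2_ae => //.
    by apply: cmeasurable_real; apply: measurableT_comp => //; exact: measurable_expR.
  by apply: ae_imp gE => x ->; rewrite normcR ger0_norm// expR_ge0.
Qed.

Definition outer_left al f l : R[i] -> R[i] :=
  fun z => shift_fun (- al) f z * shift_fun (- (2 * al)) (outer al (fun t => - l t)) z.

Lemma outer_factorization al eps f l (d : R) : 0 < al -> 0 <= eps -> Hclass al (- al) eps f ->
  (exists2 z, strip al (- al) z & f z != 0) ->
  wint al l -> (forall t, d <= l t) ->
  {ae mu, forall x, nrm (lower_value eps f (- al) x) = expR (l x)} ->
  (forall gamma, eps < gamma -> (gauss_norm2 gamma (fun x => (expR (l x))%:C)%R < +oo)%E) ->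
  factorization al eps f (outer_left al f l) (outer al (fun t => - l t)).
Proof.
move=> a0 e0 fH [z0 z0s fz0] wl dl gE fin.
set w2 := outer al _; set w1 := outer_left al f l.
have ba : - al < al by lra.
have ba2 : - (2 * al) < 2 * al by lra.
have a20 : 0 < 2 * al by lra.
have wnl := wintN wl.
have w2H : Hclass (2 * al) (- (2 * al)) eps w2 by exact: outer_inverse_Hclass dl fin.
have sf : Hclass (2 * al) 0 eps (shift_fun (- al) f).
  have := Hclass_shift (- al) ba fH.
  rewrite (_ : al - - al = 2 * al); last by ring.
  by rewrite (_ : - al - - al = 0); last by ring.
have hw2 : hol (shift_fun (- (2 * al)) w2) (4 * al) 0.
  have := Hclass_hol (Hclass_shift (- (2 * al)) ba2 w2H).
  rewrite (_ : 2 * al - - (2 * al) = 4 * al); last by ring.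
  by rewrite (_ : - (2 * al) - - (2 * al) = 0); last by ring.
have hw2' : hol (shift_fun (- (2 * al)) w2) (2 * al) 0 by apply: hol_sub hw2 _ _ => //; lra.
have bw2 x y : 0 < y < 2 * al -> nrm (shift_fun (- (2 * al)) w2 (x +i* y)) <= expR `|d|.
  move=> /andP[y1 y2]; rewrite -/(on_line _ y x) on_line_shift.
  apply: outer_bounded => //; first by apply/andP; split; lra.
  by move=> t; have := dl t; have := ler_norm (- d); rewrite normrN; lra.
have w1H : Hclass (2 * al) 0 eps w1.
  exact: (Hclass_mul_bounded a20 (expR_ge0 `|d|) sf hw2' bw2).
have sw2 : Hclass (2 * al) 0 eps (shift_fun (- (2 * al)) w2) by exact: bounded_Hclass bw2.
have lf := lower_valueP e0 ba fH; have lw2 := lower_valueP e0 ba2 w2H.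
have lw1 := lower_valueP e0 a20 w1H.
have lsf := lower_value_shift (- al) lf; have lsw2 := lower_value_shift (- (2 * al)) lw2.
rewrite subrr in lsf; rewrite subrr in lsw2.
have w1E := lower_value_mul a20 (Hclass_hol sf) hw2' lsf lsw2 lw1.
have w2E := outer_lower_norm a0 wnl lw2.
split => //.
- apply: ae_imp (ae_and w1E (ae_and w2E gE)) => x [-> [h2 h3]]; split; last exact: nrm_outer0.
  by rewrite Normc.normcM h2 h3 expRN mulfV// gt_eqF// expR_gt0.
(* Second equation: the upper value of [w1] is [fu * w2 x], so the reflected value is the inverse of
   its conjugate. The lower value of [bar_fun f] is the conjugate of [fu] and cancels where [fu] is
   nonzero; what remains is [w2 x], since [|w2 x| = 1]. *)
- have uf := upper_valueP e0 ba fH; set fu := upper_value eps f al in uf.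
  have uw1 := upper_valueP e0 a20 w1H; have usw2 := upper_valueP e0 a20 sw2.
  have usf : is_upper_value eps (shift_fun (- al) f) (2 * al) fu.
    by have := upper_value_shift (- al) uf; rewrite (_ : al - - al = 2 * al)//; ring.
  have c4 : 2 * al < 4 * al by lra.
  have sE := upper_value_interior a20 c4 hw2 usw2.
  have uE := upper_value_mul a20 (Hclass_hol sf) hw2' usf usw2 uw1.
  have bH := Hclass_bar ba fH; rewrite opprK in bH.
  have /is_upper_valueP lb := uf.
  have lbE := is_lower_value_unique ba (Hclass_hol bH) (lower_valueP e0 ba bH) lb.
  have fu0 : {ae mu, forall x, (fu x)^* != 0}.
    have := lower_value_shift al lb; rewrite (_ : - al - al = - (2 * al)); last by ring.
    move=> lsb; apply: (is_lower_value_neq0 a0 e0 _ lsb).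
      have := Hclass_shift al ba bH; rewrite subrr.
      by rewrite (_ : - al - al = - (2 * al)); last by ring.
    case: z0 z0s fz0 => x y [y1 y2] fz0; exists (x +i* (- y - al)); first by split => /=; simpl in *; lra.
    rewrite -/(on_line _ (- y - al) x) on_line_shift subrK /on_line /bar_fun /= opprK.
    by rewrite fmorph_eq0.
  apply: ae_imp (ae_and (ae_and lbE fu0) (ae_and uE sE)) => x [[-> fx0] [uEx sEx]].
  rewrite /reflected_value uEx sEx -/(on_line _ (2 * al) x) on_line_shift subrr.
  have n1 : nrm (w2 x%:C) = 1 by exact: nrm_outer0.
  rewrite rmorphM invfM mulrA mulfV// mul1r /on_line -/(x%:C).
  move: n1; move: (w2 _) => w n1.
  have ww : w * w^* = 1.
    have := normc_sqrE w; rewrite n1 expr1n; case: w {n1} => p q /= E.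
    by apply/eqP; rewrite eq_complex /=; apply/andP; split; apply/eqP; [rewrite E|]; ring.
  have w0 : w^* != 0 by apply: contraTneq isT => E; have := oner_neq0 R[i]; rewrite -ww [X in _ * X]E mulr0 eqxx.
  by apply: (mulIf w0); rewrite ww mulVf.
Qed.

End Existence.

(** * Uniqueness *)

Section Unimodular.
Context {R : realType}.
Notation mu := (@lebesgue_measure R).
Notation mfun := (measurable_fun [set: R]).
Notation nrm := Normc.normc.
Implicit Types (al x y t a b eps gamma : R) (z : R[i]) (l : R -> R) (g : R -> R[i]) (F h f p q : R[i] -> R[i]).

(** If [D] were nonzero, a small step [k] with [D k] a positive multiple [r] of [p z] would raise
    the modulus to [1 + r] up to an error of [r / 2]. *)
Lemma cderiv_unimodular p z D (d : R) : 0 < d ->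
  (forall k, nrm k < d -> nrm (p (z + k)) = 1) -> cderiv p z D -> D = 0.
Proof.
move=> d0 p1 hD; apply/eqP; apply: contrapT => /negP D0.
have n0 : 0 < nrm D by rewrite lt_def normc_eq0 D0 normc_ge0.
have [d' d'0 dP] := hD _ (divr_gt0 n0 (ltr0Sn _ 1)).
pose r := Num.min d d' / 2 * nrm D.
have m0 : 0 < Num.min d d' by rewrite lt_min d0.
have r0 : 0 < r by rewrite mulr_gt0// divr_gt0.
have pz : nrm (p z) = 1 by have := p1 0; rewrite addr0 Normc.normc0; apply.
pose k := r%:C * p z / D.
have kE : nrm k = Num.min d d' / 2.
  by rewrite /k !Normc.normcM Normc.normcV pz mulr1 normcR gtr0_norm// /r mulfK// gt_eqF.
have kd : nrm k < d /\ nrm k < d'.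
  have m1 : Num.min d d' <= d by rewrite ge_min lexx.
  have m2 : Num.min d d' <= d' by rewrite ge_min lexx orbT.
  by rewrite kE; split; lra.
have := dP k (proj2 kd); have Dk : D * k = r%:C * p z by rewrite /k mulrC divfK.
have := ler_normcD (p (z + k)) (- (p (z + k) - p z - D * k)).
rewrite normcN (p1 k (proj1 kd)) Dk.
rewrite (_ : _ + - _ = (1 + r)%:C * p z); last by rewrite rmorphD rmorph1; ring.
rewrite Normc.normcM pz mulr1 normcR ger0_norm; last by lra.
have kr : nrm D * nrm k = r by rewrite kE /r mulrC.
rewrite (_ : nrm D / 2 * nrm k = r / 2); last by rewrite -kr mulrAC.
by move=> h1 h2; lra.
Qed.

Lemma hol_derivative0_cst F a b z1 z2 : (forall z, strip a b z -> cderiv F z 0) ->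
  strip a b z1 -> strip a b z2 -> F z1 = F z2.
Proof.
move=> F0 z1s z2s; pose s t : R[i] := z1 + t%:C * (z2 - z1).
have ss t : 0 <= t <= 1 -> strip a b (s t).
  rewrite /s; clear s; case: z1 z1s z2s => x1 y1 [/= h1 h2]; case: z2 => x2 y2 [/= h3 h4] /andP[t0 t1].
  split => /=; rewrite mul0r addr0.
    have [y12|y12] := leP y1 y2; first by apply: lt_le_trans h1 _; rewrite lerDl mulr_ge0// subr_ge0.
    by apply: lt_le_trans h3 _; rewrite -subr_ge0 (_ : _ - _ = (1 - t) * (y1 - y2)); [rewrite mulr_ge0// subr_ge0// ltW|ring].
  have [y12|y12] := leP y1 y2.
    by apply: le_lt_trans h4; rewrite -subr_ge0 (_ : _ - _ = (1 - t) * (y2 - y1)); [rewrite mulr_ge0// subr_ge0|ring].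
  by apply: le_lt_trans h2; rewrite gerDl mulr_ge0_le0// subr_le0 ltW.
(* The mean value theorem holds for real functions only, so it is applied along the segment to the
   real and imaginary parts. *)
have part (P : R[i] -> R) : (forall u v, P (u - v) = P u - P v) -> (forall u, `|P u| <= nrm u) ->
    P (F z1) = P (F z2).
  move=> PB Pn; have dP t : 0 <= t <= 1 -> is_derive t 1 (fun t => P (F (s t))) 0.
    move=> t01; have H : forall e : R, 0 < e -> exists2 d : R, 0 < d & forall k : R, `|k| < d ->
        `|P (F (s (t + k))) - P (F (s t)) - 0 * k| <= e * `|k|.
      move=> e e0; pose n := nrm (z2 - z1) + 1.
      have n0 : 0 < n by rewrite ltr_wpDl// normc_ge0.
      have [d d0 H] := F0 _ (ss t t01) _ (divr_gt0 e0 n0).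
      exists (d / n); first by rewrite divr_gt0.
      move=> k kd; rewrite mul0r subr0 -PB; apply: le_trans (Pn _) _.
      have -> : s (t + k) = s t + k%:C * (z2 - z1) by rewrite /s rmorphD; ring.
      have kn : nrm (k%:C * (z2 - z1)) <= `|k| * n by rewrite Normc.normcM normcR ler_wpM2l// lerDl.
      have := H (k%:C * (z2 - z1)); rewrite mul0r subr0 => {}H.
      apply: le_trans (H _) _; first by apply: le_lt_trans kn _; rewrite -ltr_pdivlMr.
      apply: le_trans (ler_wpM2l (ltW (divr_gt0 e0 n0)) kn) _.
      by rewrite mulrCA [X in _ * X]divfK ?gt_eqF// mulrC.
    by have [h1 h2] := iffRL (derivable_difference (fun t => P (F (s t))) t 0) H; exact: DeriveDef.
  have [|||c _] := @MVT _ (fun t => P (F (s t))) (fun=> 0) 0 1.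
  - exact: ltr01.
  - by move=> t; rewrite in_itv/= => /andP[t0 t1]; apply: dP; rewrite !ltW.
  - apply: continuous_in_subspaceT => t; rewrite inE/= in_itv/= => t01.
    apply: differentiable_continuous; apply/derivable1_diffP.
    by case: (dP t t01).
  by rewrite mul0r => /eqP; rewrite subr_eq0 /s !mul0r addr0 mul1r addrC subrK => /eqP.
case: (F z1) (F z2) part => u1 v1 [u2 v2] part.
have E1 := part (@complex.Re R) (@raddfB _ _ _) (@ler_Re_normc R).
have E2 := part (@complex.Im R) (@raddfB _ _ _) (@ler_Im_normc R).
by rewrite /= in E1 E2; rewrite E1 E2.
Qed.

Lemma strip_nbhs a b z : strip a b z -> exists2 d : R, 0 < d & forall k, nrm k < d -> strip a b (z + k).
Proof.
case: z => x y [/= h1 h2]; exists (Num.min (y - b) (a - y)); first by rewrite lt_min !subr_gt0 h1.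
move=> k; rewrite lt_min => /andP[k1 k2]; have := ler_Im_normc k.
by rewrite ler_norml; case: k k1 k2 => u v /= k1 k2 /andP[k3 k4]; split => /=; lra.
Qed.

Lemma unimodular_cst p a b z1 z2 : hol p a b -> (forall z, strip a b z -> nrm (p z) = 1) ->
  strip a b z1 -> strip a b z2 -> p z1 = p z2.
Proof.
move=> hp p1; apply: hol_derivative0_cst => z zs; have [D hD] := hp z zs.
have [d d0 dP] := strip_nbhs zs.
by rewrite -(cderiv_unimodular d0 (fun k kd => p1 _ (dP k kd)) hD).
Qed.

Lemma ae_cst_continuous (phi : R -> R) (c : R) : continuous phi -> {ae mu, forall x, phi x = c} ->
  forall x, phi x = c.
Proof.
move=> cphi aec x; apply/eqP; rewrite -subr_eq0 -normr_le0; apply/ler_addgt0Pr => e e0.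
have := cphi x; move/cvgrPdist_le => /(_ _ e0)[d /= d0 dP].
have d2 : 0 < d / 2 by rewrite divr_gt0.
have [x' xx' <-] := ae_exists_near x d2 aec.
by rewrite add0r; apply: dP => /=; rewrite distrC (le_lt_trans xx')// ltr_pdivrMr// ltr_pMr// ltr1n.
Qed.

(** As [|p| |q| = 1], the square of [|p| - |q|] is [|p|^2 + |q|^2 - 2]. Its weighted integral is at
    most [2 (exp (gamma B) - 1)] times the Gaussian mass: the first factor is of order [gamma], the
    mass of order [gamma^(-1/2)], so the product tends to zero. *)
Lemma reciprocal_unimodular a b (B : R) p q : hol p a b -> hol q a b ->
  (forall z, strip a b z -> nrm (p z) * nrm (q z) = 1) ->
  (forall gamma y, 0 < gamma -> b < y < a ->
     (gauss_norm2 gamma (on_line p y) <= (expR (gamma * B) * Num.sqrt (pi / (2 * gamma)))%:E)%E /\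
     (gauss_norm2 gamma (on_line q y) <= (expR (gamma * B) * Num.sqrt (pi / (2 * gamma)))%:E)%E) ->
  0 <= B -> forall z, strip a b z -> nrm (p z) = 1.
Proof.
move=> hp hq pq H B0 [x y] [/= y1 y2]; have yab : b < y < a by rewrite y1.
have pq1 t : nrm (p (t +i* y)) * nrm (q (t +i* y)) = 1 by apply: pq.
have mp := on_line_cmeasurable hp yab; have mq := on_line_cmeasurable hq yab.
pose phi t := (nrm (p (t +i* y)) - nrm (q (t +i* y))) ^+ 2.
have mphi : mfun phi.
  by apply: measurable_funX; apply: measurable_funB; [exact: cmeasurable_nrm mp|exact: cmeasurable_nrm mq].
have phi0 t : 0 <= phi t by exact: sqr_ge0.
pose w gamma t : R := expR (- (2 * gamma * t ^+ 2)).
have mw gamma : mfun (w gamma) by exact: gauss_measurable.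
have w0 gamma t : 0 <= w gamma t by exact: expR_ge0.
have est gamma : 0 < gamma -> gamma * B <= 2^-1 -> (\int[mu]_t (phi t * w gamma t)%:E <=
    (4 * (gamma * B) * Num.sqrt (pi / (2 * gamma)))%:E)%E.
  move=> g0 gB; have [h1 h2] := H gamma y g0 yab; set S := Num.sqrt _ in h1 h2 *.
  have S0 : 0 <= S by exact: sqrtr_ge0.
  have h3 : (\int[mu]_t (phi t * w gamma t)%:E + (2 * S)%:E <= (2 * (expR (gamma * B) * S))%:E)%E.
    have SE : (S%:E = \int[mu]_t (w gamma t)%:E)%E by rewrite /w gauss_mass.
    have m1 : mfun (fun t => phi t * w gamma t) by exact: measurable_funM.
    have m2 : mfun (fun t => 2 * w gamma t) by exact: measurable_funM.
    have n1 t : 0 <= phi t * w gamma t by rewrite mulr_ge0.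
    have n2 t : 0 <= 2 * w gamma t by rewrite mulr_ge0.
    rewrite [X in (_ + X)%E]EFinM SE -(nintZ (mw gamma) (w0 gamma))//.
    rewrite -(nintD m1 m2 n1 n2).
    rewrite [leRHS](_ : _ = ((expR (gamma * B) * S)%:E + (expR (gamma * B) * S)%:E)%E); last first.
      by rewrite -EFinD; congr EFin; ring.
    apply: le_trans (leeD h1 h2); rewrite /gauss_norm2 -nintD.
    - rewrite le_eqVlt; apply/orP; left; apply/eqP; apply: eq_integral => t _; congr EFin.
      rewrite /phi /on_line sqrrB pq1 -/(w gamma t); ring.
    - exact: gauss_integrand_measurable.
    - exact: gauss_integrand_measurable.
    - by move=> t; exact: gauss_weight_ge0.
    - by move=> t; exact: gauss_weight_ge0.
  have u0 : 0 <= gamma * B by rewrite mulr_ge0// ltW.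
  have eu : expR (gamma * B) <= 1 + 2 * (gamma * B).
    have := expR_ge1Dx (- (gamma * B)); have := expRxMexpNx_1 (gamma * B).
    have := expR_gt0 (gamma * B).
    move: (gamma * B) gB u0 => v v2 v0.
    move: (expR v) (expR (- v)) => E E' E0 EE' E1.
    have : E * (1 - v) <= 1 by have := ler_wpM2l (ltW E0) E1; rewrite EE'.
    by move=> h; nra.
  rewrite -leeBrDr// in h3; apply: le_trans h3 _; rewrite -EFinB lee_fin.
  move: (expR (gamma * B)) eu => E eu; clear -S0 eu u0; clearbody S; nra.
have zero : (\int[mu]_t (phi t)%:E <= 0)%E.
  apply/lee_addgt0Pr => e e0; rewrite add0e.
  (* Taking [gamma = u^2] makes the square root explicit: the bound becomes [u * C]. *)
  pose u (n : nat) : R := n.+1%:R^-1.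
  have u0 n : 0 < u n by rewrite invr_gt0.
  have ucv : u n @[n --> \oo] --> (0 : R) by exact: cvg_harmonic.
  pose C := 4 * B * Num.sqrt (pi / 2).
  apply: (@fatou_ae _ (fun n t => phi t * w (u n ^+ 2) t)) => //.
  - by move=> n; exact: measurable_funM.
  - by move=> n t; rewrite mulr_ge0.
  - apply: ae_every => t; rewrite -[X in _ --> X]mulr1.
    apply: (@seq_cvgM _ _ _ _ _ (@seq_cvg_cst _ _)).
    rewrite -[X in _ --> X]expR0 (_ : 0 = - (2 * (0 * 0) * t ^+ 2)); last by ring.
    apply: (continuous_cvg _ (@continuous_expR R _)); apply: cvgN.
    apply: (@seq_cvgM _ _ _ _ _ _ (@seq_cvg_cst _ _)).
    apply: (@seq_cvgM _ _ _ _ _ (@seq_cvg_cst _ _)).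
    exact: (@seq_cvgM _ _ _ _ _ ucv ucv).
  - have c1 : u n * C @[n --> \oo] --> 0 * C by apply: (@seq_cvgM _ _ _ _ _ ucv (@seq_cvg_cst _ _)).
    have c2 : u n * u n * B @[n --> \oo] --> 0 * 0 * B.
      apply: (@seq_cvgM _ _ _ _ _ _ (@seq_cvg_cst _ _)); exact: (@seq_cvgM _ _ _ _ _ ucv ucv).
    rewrite mul0r in c1; rewrite !mul0r in c2.
    move/cvgrPdist_le: c1 => /(_ e e0) c1; move/cvgrPdist_le: c2 => /(_ 2^-1).
    rewrite invr_gt0 => /(_ (ltr0Sn _ 1)) c2; near=> n.
    have s0 : 0 < u n ^+ 2 by rewrite exprn_gt0.
    have d2 : u n ^+ 2 * B <= 2^-1.
      by have : `|0 - u n * u n * B| <= 2^-1 by [near: n]; rewrite sub0r normrN; exact: le_trans (ler_norm _).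
    apply: le_trans (est _ s0 d2) _; rewrite lee_fin.
    have : `|0 - u n * C| <= e by near: n.
    rewrite sub0r normrN => /(le_trans (ler_norm _)); apply: le_trans.
    have -> : pi / (2 * u n ^+ 2) = pi / 2 * ((u n)^-1) ^+ 2 by field; rewrite gt_eqF.
    rewrite sqrtrM ?divr_ge0 ?pi_ge0// sqrtr_sqr ger0_norm ?invr_ge0 ?(ltW (u0 n))//.
    rewrite /C le_eqVlt; apply/orP; left; apply/eqP.
    by move: (Num.sqrt _) (u n) (u0 n) => s v v0; field; rewrite gt_eqF.
have ae1 := nint_eq0_ae mphi phi0 zero.
have [_ _ cn] := hol_line_continuous hp yab.
apply: (ae_cst_continuous cn); apply: ae_imp ae1 => t /eqP.
rewrite sqrf_eq0 subr_eq0 => /eqP E; have := pq1 t; rewrite -E -expr2 => /eqP.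
by rewrite sqrf_eq1 => /orP[/eqP//|/eqP E']; have := normc_ge0 (p (t +i* y)); rewrite E'; lra.
Unshelve. all: by end_near.
Qed.

End Unimodular.

Section Uniqueness.
Context {R : realType}.
Notation mu := (@lebesgue_measure R).
Notation mfun := (measurable_fun [set: R]).
Notation nrm := Normc.normc.
Implicit Types (al x y t a b eps gamma : R) (z : R[i]) (l : R -> R) (g : R -> R[i]) (A F h f p q : R[i] -> R[i]).

(** The product equals [1] on the real axis, and the identity theorem extends this to the strip. *)
Lemma bar_reciprocal a eps A : 0 < a -> 0 <= eps -> Hclass a (- a) eps A ->
  (forall x, nrm (A x%:C) = 1) -> forall z, strip a (- a) z -> A z * bar_fun A z = 1.
Proof.
move=> a0 e0 AH A1 z zs; have ba : - a < a by lra.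
have bH := Hclass_bar ba AH; rewrite opprK in bH.
have hA := Hclass_hol AH; have hB := Hclass_hol bH.
pose gamma := eps + 1; have eg : eps < gamma by rewrite /gamma; lra.
have g0 : 0 < gamma by lra.
(* Both factors are square integrable against the weight of [gamma], so their product needs the
   multiplier with [2 gamma] to be integrable on lines. *)
pose H z := (A z * bar_fun A z - 1) * gmul (2 * gamma) z.
have hg : hol (gmul (2 * gamma)) a (- a) by move=> w _; exact: cderiv_gmul.
have hAB := holM hA hB.
have hAB1 : hol (fun z => A z * bar_fun A z - 1) a (- a).
  move=> w ws; have [D hD] := hAB w ws; exists (D - 0).
  have := cderivD hD (cderiv_cst (-1) w); rewrite subr0 addr0; exact.
have hH : hol H a (- a) by exact: holM.
have [M M0 MP] := Hclass_bound ba AH eg; have [N N0 NP] := Hclass_bound ba bH eg.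
have LH : L1strip H a (- a).
  exists (expR (2 * gamma * a ^+ 2) * (M + N + Num.sqrt (pi / (2 * gamma)))) => y yab.
  have mA := on_line_cmeasurable hA yab; have mB := on_line_cmeasurable hB yab.
  have i1 := gauss_integrand_measurable gamma mA; have i2 := gauss_integrand_measurable gamma mB.
  have i3 := @gauss_measurable R gamma.
  have n1 x := gauss_weight_ge0 gamma (on_line A y x) x.
  have n2 x := gauss_weight_ge0 gamma (on_line (bar_fun A) y x) x.
  have n3 x : 0 <= expR (- (2 * gamma * x ^+ 2)) by exact: expR_ge0.
  apply: (@le_trans _ _ (\int[mu]_x (expR (2 * gamma * a ^+ 2) *
     (nrm (on_line A y x) ^+ 2 * expR (- (2 * gamma * x ^+ 2)) +
      nrm (on_line (bar_fun A) y x) ^+ 2 * expR (- (2 * gamma * x ^+ 2)) +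
      expR (- (2 * gamma * x ^+ 2))))%R%:E)%E).
    apply: le_nint.
    - exact: (cmeasurable_nrm (on_line_cmeasurable hH yab)).
    - by apply: measurable_funM => //; apply: measurable_funD => //; exact: measurable_funD.
    - by move=> x; exact: normc_ge0.
    - move=> x; rewrite /H Normc.normcM normc_gmul.
      have e1 : expR (- (2 * gamma * (x ^+ 2 - y ^+ 2))) <=
          expR (2 * gamma * a ^+ 2) * expR (- (2 * gamma * x ^+ 2)).
        rewrite -expRD ler_expR -subr_ge0 (_ : _ - _ = 2 * gamma * (a ^+ 2 - y ^+ 2)); last by ring.
        rewrite mulr_ge0//; first lra.
        by move/andP: yab => [y1 y2]; rewrite subr_sqr mulr_ge0//; lra.
      apply: le_trans (ler_wpM2l (normc_ge0 _) e1) _.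
      have e2 : nrm (A (x +i* y) * bar_fun A (x +i* y) - 1) <=
          nrm (on_line A y x) ^+ 2 + nrm (on_line (bar_fun A) y x) ^+ 2 + 1.
        apply: le_trans (ler_normcD _ _) _; rewrite normcN normcR normr1 lerD2r Normc.normcM.
        rewrite -/(on_line A y x) -/(on_line (bar_fun A) y x).
        move: (nrm (on_line A y x)) (nrm (on_line (bar_fun A) y x)) => u v.
        by have := sqr_ge0 (u - v); have := sqr_ge0 (u + v); nra.
      rewrite [leRHS](_ : _ = (nrm (on_line A y x) ^+ 2 + nrm (on_line (bar_fun A) y x) ^+ 2 + 1) *
        (expR (2 * gamma * a ^+ 2) * expR (- (2 * gamma * x ^+ 2)))); last by ring.
      by apply: ler_wpM2r e2; rewrite mulr_ge0// expR_ge0.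
  rewrite nintZ ?expR_ge0//; last 2 first.
  - by apply: measurable_funD => //; exact: measurable_funD.
  - by move=> x; rewrite !addr_ge0.
  rewrite EFinM; apply: lee_wpmul2l; first by rewrite lee_fin expR_ge0.
  rewrite nintD//; [|exact: measurable_funD|by move=> x; rewrite addr_ge0].
  rewrite nintD// gauss_mass// !EFinD; apply: leeD => //; apply: leeD; [exact: MP|exact: NP].
have H0 x : H (x +i* 0) = 0.
  rewrite /H /bar_fun -/(x%:C) (_ : x%:C^* = x%:C); last by rewrite /= oppr0.
  have := A1 x; have := normc_sqrE (A x%:C) => E n1; rewrite n1 expr1n in E.
  case: (A x%:C) E {n1} => u v /= E.
  rewrite (_ : _ * _ - 1 = 0) ?mul0r//.
  by apply/eqP; rewrite eq_complex /=; apply/andP; split; apply/eqP; [rewrite E|]; ring.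
have y0 : - a < 0 < a by rewrite a0 oppr_lt0 a0.
have /eqP := hol_L1_zero hH LH y0 H0 zs.
by rewrite mulf_eq0 (negbTE (cexp_neq0 _)) orbF subr_eq0 => /eqP.
Qed.

(** The product has modulus one on both edges, so the maximum principle compares it with the
    constant [1]; the exponent comes from the edge height [2 al]. *)
Lemma outer_dominate_one al eps l h hb gamma y : 0 < al -> 0 <= eps -> wint al l ->
  Hclass (2 * al) (- (2 * al)) eps h -> is_lower_value eps h (- (2 * al)) hb ->
  {ae mu, forall x, nrm (hb x) * expR (l x) = 1} -> (forall x, nrm (h x%:C) = 1) ->
  0 < gamma -> - (2 * al) < y < 0 ->
  (gauss_norm2 gamma (on_line (fun z => h z * outer al l z)%R y) <=
   (expR (gamma * (2 * (2 * al) ^+ 2)) * Num.sqrt (pi / (2 * gamma)))%:E)%E.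
Proof.
move=> a0 e0 wl hH lb hbE h1 g0 yy; have [ml _] := wl.
have ba : - (2 * al) < 2 * al by lra.
have ba0 : - (2 * al) < 0 by lra.
have hH0 : Hclass 0 (- (2 * al)) eps h by apply: (Hclass_sub _ _ ba hH) => //; lra.
have [ht uht] := upper_value_exists e0 ba0 hH0.
have htE := upper_value_interior ba0 (_ : 0 < 2 * al) (Hclass_hol hH) uht.
set S := Num.sqrt _; have S0 : 0 <= S by exact: sqrtr_ge0.
rewrite mulrCA (mulrA 2 gamma); set E := expR _ * S.
have ES : S <= E by rewrite ler_peMl// -[leLHS]expR0 ler_expR mulr_ge0 ?sqr_ge0// mulr_ge0// ltW.
have H1 : ((expR (2 * gamma * (2 * al) ^+ 2))%:E *
    gauss_norm2 gamma (fun x => hb x * (expR (l x))%:C)%R <= E%:E)%E.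
  rewrite EFinM; apply: lee_wpmul2l; first by rewrite lee_fin expR_ge0.
  rewrite -[S]mul1r -[X in (X * _)%:E](expr1n _ 2); apply: gauss_norm2_le_cst => //.
    by apply: (cmeasurableM (proj1 lb)); apply: cmeasurable_real; exact: measurableT_comp.
  by apply: ae_imp hbE => x E1; rewrite Normc.normcM normcR (ger0_norm (expR_ge0 _)) E1.
have H2 : (gauss_norm2 gamma ht <= E%:E)%E.
  apply: (@le_trans _ _ S%:E); last by rewrite lee_fin.
  rewrite -[S]mul1r -[X in (X * _)%:E](expr1n _ 2); apply: gauss_norm2_le_cst => //; first by case: uht.
  by apply: ae_imp (htE _) => [x ->|]; [rewrite h1|rewrite mulr_gt0].
have := outer_dominate a0 e0 (ltW g0) wl hH0 lb uht H1 H2 yy.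
apply: le_trans; rewrite -[leLHS]mul1e; apply: lee_wpmul2r; first exact: gauss_norm2_ge0.
by rewrite lee_fin -[leLHS]expR0 ler_expR mulr_ge0 ?sqr_ge0// mulr_ge0// ltW.
Qed.

End Uniqueness.

Section UniquenessTheorem.
Context {R : realType}.
Notation mu := (@lebesgue_measure R).
Notation nrm := Normc.normc.
Implicit Types (al x y t a b eps gamma : R) (z : R[i]) (l : R -> R) (f : R[i] -> R[i]).

Lemma outer_uniqueness al eps f l (w1' w2' : R[i] -> R[i]) : 0 < al -> 0 <= eps ->
  wint al l ->
  {ae mu, forall x, nrm (lower_value eps f (- al) x) = expR (l x)} ->
  factorization al eps f (outer_left al f l) (outer al (fun t => - l t)) ->
  factorization al eps f w1' w2' ->
  exists c : R[i], [/\ nrm c = 1,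
    {ae mu, forall x, lower_value eps w1' 0 x = c * lower_value eps (outer_left al f l) 0 x} &
    {ae mu, forall x : R, w2' x%:C = c * outer al (fun t => - l t) x%:C}].
Proof.
move=> a0 e0 wl gE [_ w2H _ w1E _] [_ AH one AE _].
set w2 := outer al _ in w2H w1E *; set w1 := outer_left al f l in w1E *.
have ba : - (2 * al) < 2 * al by lra.
have a20 : 0 < 2 * al by lra.
have ba0 : - (2 * al) < 0 by lra.
have wnl := wintN wl.
have hA := Hclass_hol AH; have hw := Hclass_hol w2H.
have BH := Hclass_bar ba AH; rewrite opprK in BH; have hB := Hclass_hol BH.
have lA := lower_valueP e0 ba AH; have lw := lower_valueP e0 ba w2H.
have lB := lower_valueP e0 ba BH.
have y0 : - (2 * al) < 0 < 2 * al by rewrite ba0.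
have A1 x : nrm (w2' x%:C) = 1.
  have [_ _ cn] := hol_line_continuous hA y0.
  by apply: (ae_cst_continuous cn); apply: ae_imp one => t [].
have AB := bar_reciprocal a20 e0 AH A1.
have B1 x : nrm (bar_fun w2' x%:C) = 1.
  by rewrite /bar_fun normc_conj (_ : x%:C^* = x%:C) ?A1//= oppr0.
(* Taking moduli in the first equation, with [w1'] unimodular, determines [|w2'|] on the lower
   edge. *)
have Ab : {ae mu, forall x, nrm (lower_value eps w2' (- (2 * al)) x) * expR (l x) = 1}.
  apply: ae_imp (ae_and gE (ae_and one AE)) => x [h1 [[h2 _] h3]].
  by rewrite -h1 mulrC -Normc.normcM -h3.
have lAB : is_lower_value eps (fun z => w2' z * bar_fun w2' z) (- (2 * al)) (fun=> 1).
  apply/is_lower_valueP; split; first exact: cmeasurable_cst.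
  move=> gamma _ e ee; exists (2 * al) => // y /andP[y1 y2].
  rewrite (_ : gauss_norm2 _ _ = 0%E) ?lee_fin ?ltW//.
  apply: integral0_eq => x _; rewrite /on_line AB; last by split => /=; lra.
  by rewrite subrr Normc.normc0 expr0n mul0r.
have ABE := lower_value_mul ba hA hB lA lB lAB.
(* The boundary values of [w2'] and of its reflection multiply to [1], so the reflection has the
   reciprocal modulus and is matched with [- l]. *)
have Bb : {ae mu, forall x, nrm (lower_value eps (bar_fun w2') (- (2 * al)) x) * expR (- l x) = 1}.
  apply: ae_imp (ae_and Ab ABE) => x [h1 h2].
  have := congr1 (@Normc.normc R) h2; rewrite normcR normr1 Normc.normcM => h3.
  apply: (mulfI (_ : nrm (lower_value eps w2' (- (2 * al)) x) != 0)).
    by apply/eqP => E; move/eqP: h1; rewrite E mul0r eq_sym oner_eq0.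
  rewrite mulrA -h3 mul1r mulr1 expRN; apply: (mulIf (_ : expR (l x) != 0)); first by rewrite gt_eqF ?expR_gt0.
  by rewrite mulVf ?h1// gt_eqF ?expR_gt0.
(* By [bar_reciprocal] the function [p] is [w2 / w2'], and [|q| = 1 / |p|]. Both are products with
   an outer function to which [outer_dominate_one] applies, with data [- l] and [l]. *)
pose p z := bar_fun w2' z * w2 z; pose q z := w2' z * outer al l z.
have sub F : hol F (2 * al) (- (2 * al)) -> hol F 0 (- (2 * al)).
  by move=> hF; apply: hol_sub hF _ _ => //; lra.
have hp : hol p 0 (- (2 * al)) by apply: sub; exact: holM.
have hq : hol q 0 (- (2 * al)) by apply: sub; apply: holM => //; exact: hol_outer.
have up z : strip 0 (- (2 * al)) z -> strip (2 * al) (- (2 * al)) z by move=> [z1 z2]; split => //; lra.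
have w2E z : strip 0 (- (2 * al)) z -> w2 z = w2' z * p z.
  by move=> /up zs; rewrite /p mulrA AB// mul1r.
have p1 z : strip 0 (- (2 * al)) z -> nrm (p z) = 1.
  apply: (reciprocal_unimodular (B := 2 * (2 * al) ^+ 2) hp hq).
  - move=> [x y] zs; have [z1 z2] := up _ zs; rewrite /= in z1 z2.
    have yw : - (2 * al) < y < 2 * al by rewrite z1.
    have := AB _ (up _ zs) => /(congr1 (@Normc.normc R)); rewrite normcR normr1 Normc.normcM => E.
    rewrite /p /q !Normc.normcM mulrACA [X in X * _]mulrC E mul1r /w2 !nrm_outer//.
    by rewrite -/(pint al (fun t => - l t) x y) -/(pint al l x y) pint_neg// expRN mulVf// gt_eqF// expR_gt0.
  - move=> gamma y g0 yy; split.
      exact: (outer_dominate_one a0 e0 wnl BH lB Bb B1 g0 yy).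
    exact: (outer_dominate_one a0 e0 wl AH lA Ab A1 g0 yy).
  - by rewrite mulr_ge0// sqr_ge0.
have z1s : strip 0 (- (2 * al)) (0 +i* (- al)) by split => /=; lra.
pose c := (p (0 +i* (- al)))^-1.
have c0 : p (0 +i* (- al)) != 0 by rewrite -normc_eq0 p1// oner_eq0.
have c1 : nrm c = 1 by rewrite /c Normc.normcV p1// invr1.
have low z : strip 0 (- (2 * al)) z -> w2' z = c * w2 z.
  by move=> zs; rewrite w2E// (unimodular_cst hp p1 zs z1s) mulrC mulfK.
have lcw : is_lower_value eps w2' (- (2 * al)) (fun x => c * lower_value eps w2 (- (2 * al)) x).
  have /is_lower_valueP[mw H] := lw.
  apply/is_lower_valueP; split; first by apply: cmeasurableM => //; exact: cmeasurable_cst.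
  move=> gamma eg e ee; have [d d0 dP] := H _ eg e ee.
  exists (Num.min d (2 * al)); first by rewrite lt_min d0.
  move=> y /andP[y1]; rewrite -ltrBlDl lt_min => /andP[y2 y3].
  apply: le_trans (dP y _); last by apply/andP; split; lra.
  rewrite le_eqVlt; apply/orP; left; apply/eqP; apply: eq_integral => x _.
  rewrite /on_line low; last by split => /=; lra.
  by rewrite -mulrBr Normc.normcM c1 mul1r.
have lE := is_lower_value_unique ba hA lA lcw.
exists c; split; first exact: c1.
  by apply: ae_imp (ae_and (ae_and AE w1E) lE) => x [[-> ->] ->]; rewrite mulrCA.
apply: ae_every => x.
have [D1 h1] : exists D, cderiv w2' (x +i* 0) D by apply: hA.
have [D2 h2] : exists D, cderiv w2 (x +i* 0) D by apply: hw.
(* The identity [w2' = c w2] is known below the axis; heights increasing to [0] carry it to the axis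
   by continuity. *)
pose u (n : nat) : R := - al * n.+1%:R^-1.
have u0 : u n @[n --> \oo] --> (0 : R).
  by rewrite -(mulr0 (- al)); apply: (@seq_cvgM _ _ _ _ _ (@seq_cvg_cst _ _)); exact: cvg_harmonic.
have uE n : - (2 * al) < u n < 0.
  have n0 : 0 < n.+1%:R^-1 :> R by rewrite invr_gt0.
  have n1 : n.+1%:R^-1 <= 1 :> R by rewrite invf_le1// ler1n.
  by rewrite /u; move: (n.+1%:R^-1) n0 n1 => v v0 v1; apply/andP; split; nra.
apply: (ccvg_unique (cderiv_ccvg h1 u0)).
have -> : (fun n => w2' (x +i* u n)) = (fun n => c * w2 (x +i* u n)).
  by apply/funext => n; rewrite low//; have /andP[] := uE n; split.
exact: ccvgM (ccvg_cst c) (cderiv_ccvg h2 u0).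
Qed.

End UniquenessTheorem.

Theorem theorem1 (R : realType) (eps alpha : R) (f : R[i] -> R[i])
    (eps_gt0 : 0 < eps) (alpha_gt0 : 0 < alpha)
    (fH : Hclass alpha (- alpha) eps f)
    (f_neq0 : exists2 z, strip alpha (- alpha) z & f z != 0)
    (f_inf : (0 < ess_inf (@lebesgue_measure R)
                (fun x : R => (Normc.normc (lower_value eps f (- alpha) x))%:E))%E) :
  exists w1 w2 : R[i] -> R[i],
    factorization alpha eps f w1 w2 /\
    forall w1' w2' : R[i] -> R[i],
      factorization alpha eps f w1' w2' ->
      exists c : R[i],
        [/\ Normc.normc c = 1,
            {ae @lebesgue_measure R, forall x : R,
               lower_value eps w1' 0 x = c * lower_value eps w1 0 x} &
            {ae @lebesgue_measure R, forall x : R,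
               w2' x%:C = c * w2 x%:C}].
Proof.
have [l [d [wl dl gE fin]]] := log_boundary_modulus alpha_gt0 (ltW eps_gt0) fH f_inf.
have fact := outer_factorization alpha_gt0 (ltW eps_gt0) fH f_neq0 wl dl gE fin.
exists (outer_left alpha f l), (outer alpha (fun t => - l t)); split; first exact: fact.
by move=> w1' w2' fact'; exact: (outer_uniqueness alpha_gt0 (ltW eps_gt0) wl gE fact fact').
Qed.
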